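(* For every $\alpha>0$ there exists $\epsilon>0$ (depending on $\alpha$) such that for every map $\mathbf{p}:\mathsf{A}_2\to\mathbb{R}^2$: $$\text{if } \|\mathbf{p}\|\le \epsilon,\ \text{ then }\ \mathrm{E}_{\Phi_\alpha}(\mathsf{A}_2+\mathbf{p})\ \ge\ \mathrm{E}_{\Phi_\alpha}(\mathsf{A}_2).$$ Moreover, the value of $\epsilon$ can be chosen uniformly for $\alpha$ in compact subsets of $(0,+\infty)$.
   Context: Hexagonal lattice: $r_\star:=\sqrt{2/\sqrt3}$, $\sigma:=r_\star(1,0)$, $\tau:=r_\star(\tfrac12,\tfrac{\sqrt3}{2})$, and $\mathsf{A}_2:=\sigma\mathbb{Z}+\tau\mathbb{Z}\subset\mathbb{R}^2$ (covolume $1$). Gaussian potential: $\Phi_\alpha(r):=e^{-\pi\alpha r^2}$. Energy: for $f:(0,+\infty)\to\mathbb{R}$ and a locally finite set $\mathsf{X}\subset\mathbb{R}^2$, $$\mathrm{E}_f(\mathsf{X}):=\liminf_{r\to\infty}\frac{1}{|\mathsf{X}\cap \mathrm{B}_r|}\sum_{x,y\in \mathsf{X}\cap \mathrm{B}_r,\ x\ne y} f(|x-y|),$$ where $\mathrm{B}_r$ is the disk of center $0$ and radius $r$, $|\mathsf{X}\cap\mathrm{B}_r|$ is the number of points, and the sum is over ordered pairs. Perturbations: for $\mathbf{p}:\mathsf{A}_2\to\mathbb{R}^2$, $\mathsf{A}_2+\mathbf{p}:=\{x+\mathbf{p}(x):x\in\mathsf{A}_2\}$ and $\|\mathbf{p}\|:=\sup_{x\in\mathsf{A}_2}|\mathbf{p}(x)|$.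 *)

(* Defs.v *)
(* Based on MathComp-Analysis; the reals are an arbitrary [R : realType]. *)
From HB Require Import structures.
From mathcomp Require Export all_boot all_order all_algebra.
From mathcomp Require Export finmap.
From mathcomp Require Export all_classical all_reals all_analysis.
Export Order.TTheory GRing.Theory Num.Theory.
Export numFieldNormedType.Exports.

Set Implicit Arguments.
Unset Strict Implicit.
Unset Printing Implicit Defensive.

Local Open Scope classical_set_scope.
Local Open Scope ring_scope.

Definition vec2 (R : realType) (a b : R) : 'rV[R]_2 :=
  \row_(j < 2) (if j == ord0 then a else b).

(* The library's norm [`|x|] on ['rV[R]_2] is the sup norm, hence this
   Euclidean norm. *)
Definition enorm (R : realType) (x : 'rV[R]_2) : R :=
  Num.sqrt (\sum_(j < 2) x 0 j ^+ 2).

Definition rstar (R : realType) : R := Num.sqrt (2 / Num.sqrt 3).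

Definition hex_sigma (R : realType) : 'rV[R]_2 := rstar R *: vec2 1 0.

Definition hex_tau (R : realType) : 'rV[R]_2 :=
  rstar R *: vec2 (1 / 2) (Num.sqrt 3 / 2).

Definition A2 (R : realType) : set 'rV[R]_2 :=
  [set x | exists m n : int, x = hex_sigma R *~ m + hex_tau R *~ n].
Arguments A2 R : clear implicits.

Definition Phi (R : realType) (alpha r : R) : R :=
  expR (- (pi * alpha * r ^+ 2)).

Definition disk (R : realType) (r : R) : set 'rV[R]_2 :=
  [set x | enorm x < r].

(* Only the values of [f] on the positive reals are used.  The sums over
   [\in] and [fset_set] are meaningful for finite sets, so [X] is to be locally
   finite.  When [X `&` disk r] is empty the quotient is [0 / 0 = 0]; unless
   [X] is empty this does not affect the limit inferior. *)
Definition energy (R : realType) (f : R -> R) (X : set 'rV[R]_2) : \bar R :=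
  limf_einf
    (fun r : R =>
       ((\sum_(x \in X `&` disk r) \sum_(y \in (X `&` disk r) `\ x)
            f (enorm (x - y)))
        / (#|` fset_set (X `&` disk r)|)%:R)%:E)
    (pinfty_nbhs R).

(* A map on the lattice is represented by a total map [p]; neither [perturb p]
   nor [pert_norm p] depends on its values outside [A2 R]. *)
Definition perturb (R : realType) (p : 'rV[R]_2 -> 'rV[R]_2) :
    set 'rV[R]_2 :=
  [set x + p x | x in A2 R].

Definition pert_norm (R : realType) (p : 'rV[R]_2 -> 'rV[R]_2) : \bar R :=
  ereal_sup [set (enorm (p x))%:E | x in A2 R].

(* Main.v *)
Require Import Defs.
From mathcomp Require Import ring lra zify.

(** The energy of the perturbed lattice is expanded to second order at every
  pair of points. The zeroth order is the energy of the lattice; the linear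
  terms cancel because the lattice is symmetric; the quadratic terms are a
  convolution, hence multiplication, in the Fourier variable [k], by the
  symbol [D (k) = sum over x of H (x) (1 - cos (k . x))], with [H (x)] the
  Hessian of the Gaussian at [x]. The perturbation does not decay, so a small
  remainder is useless unless it is small compared with this quadratic form.
  It is: the cubic remainder only involves differences of displacements, and
  its symbol is at most a constant times [eps] times the comparison symbol
  [wave2], which vanishes on the dual lattice and to second order there, while
  [D (k)] is at least a positive multiple of [wave2] ([symbol_lower]). So for
  small [eps] the remainder is absorbed by the kernel ([kernel_symbol]).

  Points are written [r_star / 2 (a, sqrt 3 b)] with [a + b] even, and [la =
  pi alpha r_star ^ 2 / 4]. The positivity of [D] has two regimes. If [la] is
  larger than [1 / 2], the contribution of every orbit of the rotation by 120
  degrees is nonnegative, because the numbers [1 - cos] of three phases with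
  sum zero have square roots that satisfy the triangle inequality
  ([wave_orbit], [direct_gain]). If [la] is at most 0.501, Poisson summation
  turns [D (k)] into a positive multiple of [F (k) - F (0)], where [F (k)] is
  the sum of [(v . (xi + k)) ^ 2 exp (- B |xi + k| ^ 2)] over the dual lattice
  and [B = pi ^ 2 / (3 la)] is at least [51 / 8] ([dual_symbol]). With [k] in
  the hexagonal cell, the origin and the six shortest dual vectors gain a
  definite proportion ([shell_symm]), and all the other ones lose less than
  that ([dual_outer]). The Poisson identity is needed only up to a constant
  and follows from Polya's evaluation of a power of the cosine at equally
  spaced points ([polya_limit]).

  Positivity of the symbol gives positivity in real space on finite windows by
  a discrete Fourier transform of long period ([toeplitz_le]). The energy of a
  window with [n] points is therefore at least [n] times the lattice sum minus
  boundary terms ([energy_lower]), and these are [o (n)], since the points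
  near the boundary circle of a large disk have many disjoint translates
  inside it ([window_defect]). The energy of the lattice itself is at most the
  lattice sum. All constants are controlled by the range of [alpha], which
  gives both parts of the theorem. *)

Set Implicit Arguments.
Unset Strict Implicit.
Unset Printing Implicit Defensive.

Local Open Scope classical_set_scope.
Local Open Scope ring_scope.

(** * Unconditional sums of real families *)
Section UnconditionalSums.
Context {R : realType}.

Section OneIndex.
Variable T : eqType.
Implicit Types (f g : T -> R) (s t : seq T) (a b : R).

(** Convergence along the net of finite sets of indices: the sums below run
  over lattices, on which no order is natural, and are reindexed by
  symmetries. *)
Definition has_sum f a := forall e : R, 0 < e -> exists s0 : seq T,
  forall s, uniq s -> {subset s0 <= s} -> `|\sum_(u <- s) f u - a| <= e.

Definition bounded_sums f (A : R) := forall s, uniq s -> \sum_(u <- s) `|f u| <= A.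

Definition abs_summable f := exists A, bounded_sums f A.

Definition hsum f : R := xget 0 [set a | has_sum f a].

Lemma sub_undup_cat s1 s2 : {subset s1 <= undup (s1 ++ s2)} /\
  {subset s2 <= undup (s1 ++ s2)}.
Proof. by split=> x xs; rewrite mem_undup mem_cat xs ?orbT. Qed.

Lemma has_sum_eval f a s0 (e : R) : has_sum f a -> 0 < e ->
  exists s, [/\ uniq s, {subset s0 <= s} & `|\sum_(u <- s) f u - a| <= e].
Proof.
move=> H e0; have [s1 h1] := H e e0.
have [i1 i2] := sub_undup_cat s0 s1.
exists (undup (s0 ++ s1)); split=> //; first exact: undup_uniq.
by apply: h1 => //; exact: undup_uniq.
Qed.

Lemma has_sum_le f g a b : has_sum f a -> has_sum g b -> (forall u, f u <= g u) -> a <= b.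
Proof.
move=> Hf Hg fg; apply/ler_addgt0Pr => e e0.
have e20 : 0 < e / 2 by rewrite divr_gt0.
have [s1 h1] := Hf _ e20.
have [s [us ss hs]] := has_sum_eval s1 Hg e20.
have := h1 s us ss; have : \sum_(u <- s) f u <= \sum_(u <- s) g u by exact: ler_sum.
move: hs; rewrite !ler_norml; lra.
Qed.

Lemma has_sum_unique f a b : has_sum f a -> has_sum f b -> a = b.
Proof. by move=> Ha Hb; apply/eqP; rewrite eq_le !(has_sum_le Ha Hb, has_sum_le Hb Ha). Qed.

Lemma hsumE f a : has_sum f a -> hsum f = a.
Proof.
by move=> Ha; rewrite /hsum; case: xgetP => [x _ Hx|/(_ a)//]; exact: has_sum_unique Hx Ha.
Qed.

Lemma has_sumD f g a b : has_sum f a -> has_sum g b -> has_sum (fun u => f u + g u) (a + b).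
Proof.
move=> Hf Hg e e0; have e20 : 0 < e / 2 by rewrite divr_gt0.
have [s1 h1] := Hf _ e20; have [s2 h2] := Hg _ e20.
exists (s1 ++ s2) => s us ss.
have k1 : {subset s1 <= s} by move=> x xs; apply: ss; rewrite mem_cat xs.
have k2 : {subset s2 <= s} by move=> x xs; apply: ss; rewrite mem_cat xs orbT.
have := h1 s us k1; have := h2 s us k2; rewrite big_split /= !ler_norml; lra.
Qed.

Lemma has_sumZ f a (k : R) : has_sum f a -> has_sum (fun u => k * f u) (k * a).
Proof.
move=> Hf e e0.
have k0 : 0 < `|k| + 1 by rewrite ltr_wpDl.
have [s1 h1] := Hf (e / (`|k| + 1)) (divr_gt0 e0 k0).
exists s1 => s us ss; rewrite -mulr_sumr -mulrBr normrM.
have := h1 s us ss; rewrite ler_pdivlMr//.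
have := normr_ge0 k; have := normr_ge0 (\sum_(u <- s) f u - a); nra.
Qed.

Lemma has_sum_finite f s0 : uniq s0 -> (forall u, u \notin s0 -> f u = 0) ->
  has_sum f (\sum_(u <- s0) f u).
Proof.
move=> us0 f0 e e0; exists s0 => s us ss.
suff -> : \sum_(u <- s) f u = \sum_(u <- s0) f u by rewrite subrr normr0 ltW.
rewrite (bigID (fun u => u \in s0)) /= [X in _ + X]big1 ?addr0; last by move=> u /f0.
rewrite -big_filter; apply: perm_big; apply: uniq_perm => //; first exact: filter_uniq.
by move=> u; rewrite mem_filter; case us0u : (u \in s0) => //=; exact: ss.
Qed.

Lemma ler_sum_subseq f s t : uniq s -> uniq t -> {subset s <= t} ->
  (forall u, u \in t -> 0 <= f u) -> \sum_(u <- s) f u <= \sum_(u <- t) f u.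
Proof.
move=> us ut st f0.
rewrite [leRHS](bigID (fun u => u \in s)) /= -[leLHS]addr0 lerD//.
  rewrite le_eqVlt; apply/orP; left; apply/eqP.
  rewrite -[RHS]big_filter; apply: perm_big; apply: uniq_perm => //; first exact: filter_uniq.
  by move=> u; rewrite mem_filter; case usu : (u \in s) => //=; rewrite st.
by rewrite big_seq_cond sumr_ge0// => u /andP[/f0].
Qed.

(** The sum is the supremum of the finite partial sums. *)
Lemma ge0_has_sum f (A : R) : (forall u, 0 <= f u) ->
  (forall s, uniq s -> \sum_(u <- s) f u <= A) -> exists2 a, has_sum f a & a <= A.
Proof.
move=> f0 fA.
pose S := [set x | exists2 s, uniq s & x = \sum_(u <- s) f u].
have hS : has_sup S.
  split; first by exists 0; exists [::]; rewrite ?big_nil.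
  by exists A => x [s us ->]; exact: fA.
exists (sup S); last first.
  by apply: ge_sup => //; [case: hS|move=> x [s us ->]; exact: fA].
move=> e e0; have [x [s0 us0 xE] hx] := sup_adherent e0 hS.
exists s0 => s us ss.
have h1 : \sum_(u <- s0) f u <= \sum_(u <- s) f u by apply: ler_sum_subseq.
have h2 : \sum_(u <- s) f u <= sup S.
  by apply: ub_le_sup; [case: hS|exists s].
rewrite ler_norml; apply/andP; split; last by rewrite lerBlDr (le_trans h2)// lerDr ltW.
by move: hx; rewrite xE; lra.
Qed.

Lemma dominated_summable f g : (forall u, `|f u| <= g u) -> abs_summable g -> abs_summable f.
Proof.
move=> fg [A hA]; exists A => s us; apply: le_trans (hA s us).
by apply: ler_sum => u _; rewrite (le_trans (fg u))// ler_norm.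
Qed.

(** Apply the nonnegative case to [f + |f|] and to [|f|], and subtract. *)
Lemma has_hsum f : abs_summable f -> has_sum f (hsum f).
Proof.
case=> A hA; have [b hb _] := ge0_has_sum (fun u => normr_ge0 (f u)) hA.
have [u|s us|a ha _] := @ge0_has_sum (fun u => f u + `|f u|) (A + A).
- by have := ler_norm (- f u); rewrite normrN; lra.
- rewrite big_split /=; apply: lerD (hA s us); apply: le_trans (hA s us).
  by apply: ler_sum => u _; exact: ler_norm.
have := has_sumD ha (has_sumZ (-1) hb).
have -> : (fun u => f u + `|f u| + -1 * `|f u|) = f by apply/funext => u; ring.
by move=> h; rewrite (hsumE h).
Qed.

Lemma abs_summableD f g : abs_summable f -> abs_summable g ->
  abs_summable (fun u => f u + g u).
Proof.
move=> [A hA] [B hB]; exists (A + B) => s us; rewrite (le_trans _ (lerD (hA s us) (hB s us)))//.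
by rewrite -big_split; apply: ler_sum => u _; exact: ler_normD.
Qed.

Lemma abs_summableZ f (k : R) : abs_summable f -> abs_summable (fun u => k * f u).
Proof.
move=> [A hA]; exists (`|k| * A) => s us.
rewrite (le_trans _ (ler_wpM2l (normr_ge0 k) (hA s us)))// mulr_sumr.
by apply: ler_sum => u _; rewrite normrM.
Qed.

Lemma abs_summable_finite f s0 : (forall u, u \notin s0 -> f u = 0) -> abs_summable f.
Proof.
move=> f0; exists (\sum_(u <- undup s0) `|f u|) => s us.
rewrite (bigID (fun u => u \in s0)) /= [X in _ + X]big1 ?addr0; last first.
  by move=> u /f0 ->; rewrite normr0.
rewrite -big_filter ler_sum_subseq// ?filter_uniq ?undup_uniq//.
by move=> u; rewrite mem_filter mem_undup => /andP[].
Qed.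

Lemma hsumD f g : abs_summable f -> abs_summable g ->
  hsum (fun u => f u + g u) = hsum f + hsum g.
Proof. by move=> Hf Hg; apply: hsumE; apply: has_sumD; exact: has_hsum. Qed.

Lemma hsumZ f (k : R) : abs_summable f -> hsum (fun u => k * f u) = k * hsum f.
Proof. by move=> Hf; apply: hsumE; apply: has_sumZ; exact: has_hsum. Qed.

Lemma hsumB f g : abs_summable f -> abs_summable g ->
  hsum (fun u => f u - g u) = hsum f - hsum g.
Proof.
move=> Hf Hg; rewrite -[- hsum g]mulN1r -hsumZ// -hsumD//; last exact: abs_summableZ.
by congr hsum; apply/funext => u; rewrite mulN1r.
Qed.

Lemma abs_summableB f g : abs_summable f -> abs_summable g ->
  abs_summable (fun u => f u - g u).
Proof.
move=> Hf Hg; have := abs_summableD Hf (abs_summableZ (-1) Hg).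
by congr abs_summable; apply/funext => u; rewrite mulN1r.
Qed.

Lemma le_hsum f g : abs_summable f -> abs_summable g -> (forall u, f u <= g u) ->
  hsum f <= hsum g.
Proof. by move=> Hf Hg; apply: has_sum_le; exact: has_hsum. Qed.

Lemma hsum_ge0 f : abs_summable f -> (forall u, 0 <= f u) -> 0 <= hsum f.
Proof.
move=> Hf f0; rewrite -(mul0r (hsum f)) -hsumZ//; apply: le_hsum => //.
  exact: abs_summableZ.
by move=> u; rewrite mul0r.
Qed.

Lemma hsum_finite f s0 : uniq s0 -> (forall u, u \notin s0 -> f u = 0) ->
  hsum f = \sum_(u <- s0) f u.
Proof. by move=> us0 f0; apply: hsumE; exact: has_sum_finite. Qed.

Lemma hsum_ge_finite f s : uniq s -> abs_summable f -> (forall u, u \notin s -> 0 <= f u) ->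
  \sum_(u <- s) f u <= hsum f.
Proof.
move=> us Hf f0; pose g u := if u \in s then f u else 0.
have g0 u : u \notin s -> g u = 0 by rewrite /g => /negbTE ->.
have -> : \sum_(u <- s) f u = hsum g.
  by rewrite (hsum_finite us g0) big_seq [RHS]big_seq; apply: eq_bigr => u us'; rewrite /g us'.
apply: le_hsum => //; first exact: abs_summable_finite g0.
by move=> u; rewrite /g; case: ifPn => // /f0.
Qed.

Lemma hsum_le_bound f (A : R) : abs_summable f ->
  (forall s, uniq s -> \sum_(u <- s) f u <= A) -> hsum f <= A.
Proof.
move=> Hf fA; apply/ler_addgt0Pr => e e0.
have [s [us _ hs]] := has_sum_eval [::] (has_hsum Hf) e0.
by have := fA s us; move: hs; rewrite ler_norml; lra.
Qed.

(** A partial sum of [|f|] within [e / 2] of the total leaves only [e] to the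
  indices outside it. *)
Lemma summable_tail f (e : R) : abs_summable f -> 0 < e -> exists s0 : seq T,
  forall s, uniq s -> (forall u, u \in s -> u \notin s0) -> \sum_(u <- s) `|f u| <= e.
Proof.
case=> A hA e0; have [b hb _] := ge0_has_sum (fun u => normr_ge0 (f u)) hA.
have e20 : 0 < e / 2 by rewrite divr_gt0.
have [s0 h0] := hb _ e20; exists (undup s0) => s us sd.
have h2 : uniq (undup s0 ++ s).
  rewrite cat_uniq undup_uniq us andbT /=; apply/hasPn => u /sd; by [].
have k1 : {subset s0 <= undup s0} by move=> x; rewrite mem_undup.
have k2 : {subset s0 <= undup s0 ++ s} by move=> x /k1; rewrite mem_cat => ->.
have /andP[a1 a2] : (- (e / 2) <= \sum_(u <- undup s0) `|f u| - b <= e / 2).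
  by rewrite -ler_norml; apply: h0; [exact: undup_uniq|exact: k1].
have := h0 _ h2 k2; rewrite big_cat /= ler_norml => /andP[a3 a4].
lra.
Qed.

(** Outside a finite set the dominating family is small, and on the finite set
  termwise convergence is enough. *)
Lemma dominated_hsum_cvg (fn : nat -> T -> R) f g : abs_summable g ->
  (forall n u, `|fn n u| <= g u) -> (forall u, fn n u @[n --> \oo] --> f u) ->
  hsum (fn n) @[n --> \oo] --> hsum f.
Proof.
move=> Hg fng fnf.
have fg u : `|f u| <= g u.
  have h : `|fn n u| @[n --> \oo] --> `|f u| by apply: cvg_norm; exact: fnf.
  rewrite -(cvg_lim _ h)//.
  by apply: limr_le; [apply/cvg_ex; eexists; exact: h|near=> n; exact: fng].
have Hn n := dominated_summable (fng n) Hg; have Hf := dominated_summable fg Hg.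
apply/cvgrPdist_le => e e0.
have e40 : 0 < e / 4 by rewrite divr_gt0.
have [s0 h0] := summable_tail Hg e40.
have hfin (t : seq T) : \sum_(u <- t) (f u - fn n u) @[n --> \oo] --> (0 : R).
  elim: t => [|x t IH]; first by under eq_fun do rewrite big_nil; exact: cvg_cst.
  under eq_fun do rewrite big_cons.
  have h : f x - fn n x @[n --> \oo] --> f x - f x.
    by apply: cvgB; [exact: cvg_cst|exact: fnf].
  have : f x - fn n x + \sum_(u <- t) (f u - fn n u) @[n --> \oo] --> f x - f x + 0.
    by apply: cvgD; [exact: h|exact: IH].
  by rewrite subrr addr0.
near=> n.
have hB := abs_summableB Hf (Hn n).
rewrite -hsumB//.
have [s [us ss hs]] := has_sum_eval (undup s0) (has_hsum hB) e40.
have : \sum_(u <- s) (f u - fn n u) = \sum_(u <- undup s0) (f u - fn n u) +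
    \sum_(u <- s | u \notin s0) (f u - fn n u).
  rewrite (bigID (fun u => u \in s0)) /=; congr (_ + _).
  rewrite -big_filter; apply: perm_big; apply: uniq_perm; rewrite ?undup_uniq ?filter_uniq//.
  move=> u; rewrite mem_filter mem_undup; case us0 : (u \in s0) => //=.
  by apply: ss; rewrite mem_undup.
have h1 : `|\sum_(u <- undup s0) (f u - fn n u)| <= e / 4.
  by near: n; apply: cvgr0_norm_le => //; exact: hfin.
have h2 : `|\sum_(u <- s | u \notin s0) (f u - fn n u)| <= e / 4 + e / 4.
  rewrite (le_trans (ler_norm_sum _ _ _))// -big_filter.
  have k : \sum_(u <- [seq u <- s | u \notin s0]) `|g u| <= e / 4.
    by apply: h0; [exact: filter_uniq|move=> u; rewrite mem_filter => /andP[]].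
  rewrite (le_trans _ (lerD k k))// -big_split /=; apply: ler_sum => u _.
  have := fg u; have := fng n u; have := ler_norm (g u); have := ler_normB (f u) (fn n u); lra.
move: hs h1 h2; rewrite !ler_norml; lra.
Unshelve. all: by end_near.
Qed.

End OneIndex.

Lemma hsum_reindex (T T' : eqType) (h : T' -> T) (h' : T -> T') (f : T -> R) :
  cancel h h' -> cancel h' h -> abs_summable f ->
  abs_summable (f \o h) /\ hsum (f \o h) = hsum f.
Proof.
move=> hK h'K Hf.
have im s : uniq s -> uniq (map h s) by rewrite map_inj_uniq//; exact: can_inj hK.
split.
  case: Hf => A hA; exists A => s us; have := hA _ (im _ us); by rewrite big_map.
apply: hsumE => e e0; have [s0 h0] := has_hsum Hf e0.
exists (map h' s0) => s us ss; have := h0 _ (im _ us); rewrite big_map; apply.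
by move=> u us0; rewrite -(h'K u) map_f// ss// map_f.
Qed.

Lemma sum_allpairs (T T' : eqType) (s : seq T) (s' : seq T') (f : T -> T' -> R) :
  \sum_(u <- [seq (x, y) | x <- s, y <- s']) f u.1 u.2 =
  \sum_(x <- s) \sum_(y <- s') f x y.
Proof.
elim: s => [|x s IH]; first by rewrite !big_nil.
by rewrite allpairs_cons big_cat /= IH big_map big_cons.
Qed.

Lemma sub_allpairs (T T' : eqType) (s : seq (T * T')) :
  {subset s <= [seq (x, y) | x <- undup (map fst s), y <- undup (map snd s)]}.
Proof.
by move=> [x y] us; apply: allpairs_f; rewrite mem_undup;
  [exact: (map_f fst us)|exact: (map_f snd us)].
Qed.

(** Any finite set of pairs lies in a rectangle, on which the double sum
  factors. *)
Lemma hsum_prod (T T' : eqType) (f : T -> R) (g : T' -> R) :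
  abs_summable f -> abs_summable g ->
  abs_summable (fun u : T * T' => f u.1 * g u.2) /\
  hsum (fun u : T * T' => f u.1 * g u.2) = hsum f * hsum g.
Proof.
move=> Hf Hg.
have Hfg : abs_summable (fun u : T * T' => f u.1 * g u.2).
  case: (Hf) (Hg) => A hA [B hB]; exists (A * B) => s us.
  have ul : uniq (undup (map fst s)) := undup_uniq _.
  have ur : uniq (undup (map snd s)) := undup_uniq _.
  have hl := hA _ ul; have hr := hB _ ur.
  rewrite (@le_trans _ _ (\sum_(u <- [seq (x, y) | x <- undup (map fst s), y <- undup (map snd s)])
     `|f u.1 * g u.2|))//.
    apply: ler_sum_subseq => //; first by apply: allpairs_uniq => // -[? ?] [? ?].
    exact: sub_allpairs.
  rewrite (sum_allpairs _ _ (fun x y => `|f x * g y|)).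
  under eq_bigr do under eq_bigr do rewrite normrM.
  under eq_bigr do rewrite -mulr_sumr.
  by rewrite -mulr_suml ler_pM// sumr_ge0.
split=> //; set S := hsum (fun u : T * T' => f u.1 * g u.2).
apply/eqP; rewrite -subr_eq0 -normr_le0; apply/ler_addgt0Pr => e e0.
rewrite add0r.
pose K : R := 3 + `|hsum f| + `|hsum g|.
have K0 : 0 < K by rewrite ltr_wpDr// ltr_wpDr.
pose d := Num.min 1 (e / K).
have d0 : 0 < d by rewrite lt_min ltr01 divr_gt0.
have d1 : d <= 1 by rewrite ge_min lexx.
have dK : d * K <= e by rewrite -ler_pdivlMr// ge_min lexx orbT.
have [s1 h1] := has_hsum Hf d0; have [s2 h2] := has_hsum Hg d0.
have [s0 h0] := has_hsum Hfg d0.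
pose l := undup (s1 ++ map fst s0); pose r := undup (s2 ++ map snd s0).
have hl : `|\sum_(u <- l) f u - hsum f| <= d.
  by apply: h1; [exact: undup_uniq|move=> x xs; rewrite mem_undup mem_cat xs].
have hr : `|\sum_(u <- r) g u - hsum g| <= d.
  by apply: h2; [exact: undup_uniq|move=> x xs; rewrite mem_undup mem_cat xs].
have : `|\sum_(u <- [seq (x, y) | x <- l, y <- r]) f u.1 * g u.2 -
    S| <= d.
  apply: h0; first by apply: allpairs_uniq; rewrite ?undup_uniq// => -[? ?] [? ?].
  move=> [x y] us; apply: allpairs_f; rewrite mem_undup mem_cat.
    by rewrite (map_f fst us) orbT.
  by rewrite (map_f snd us) orbT.
rewrite (sum_allpairs _ _ (fun x y => f x * g y)).
under eq_bigr do rewrite -mulr_sumr.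
rewrite -mulr_suml; move: hl hr.
set a := \sum_(_ <- _) _; set b := \sum_(_ <- _) _.
move=> ha hb hS.
have -> : S - hsum f * hsum g = - (a * b - S) + (a - hsum f) * (b - hsum g) +
   (a - hsum f) * hsum g + hsum f * (b - hsum g) by ring.
have na : `|a - hsum f| * `|b - hsum g| <= d * 1 by rewrite ler_pM// (le_trans hb).
have nb : `|a - hsum f| * `|hsum g| <= d * `|hsum g| by rewrite ler_wpM2r.
have nc : `|hsum f| * `|b - hsum g| <= `|hsum f| * d by rewrite ler_wpM2l.
rewrite (le_trans (ler_normD _ _))// (le_trans (lerD (ler_normD _ _) (lexx _)))//.
rewrite (le_trans (lerD (lerD (ler_normD _ _) (lexx _)) (lexx _)))// normrN !normrM.
move: dK; rewrite /K; lra.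
Qed.

Lemma hsum_inj (T T' : eqType) (h : T' -> T) (d : T -> T') (f : T -> R) :
  cancel h d -> (forall u, h (d u) != u -> f u = 0) -> abs_summable f ->
  abs_summable (f \o h) /\ hsum f = hsum (f \o h).
Proof.
move=> hK f0 Hf; split.
  case: Hf => A hA; exists A => s us.
  have u' : uniq (map h s) by rewrite map_inj_uniq//; exact: can_inj hK.
  by have := hA _ u'; rewrite big_map.
symmetry; apply: hsumE => e e0; have [s0 k0] := has_hsum Hf e0.
exists (map d s0) => s us ss.
have ut : uniq (map h s ++ [seq u <- undup s0 | u \notin map h s]).
  rewrite cat_uniq map_inj_uniq ?us; last exact: can_inj hK.
  rewrite filter_uniq ?undup_uniq// andbT /=; apply/hasPn => u.
  by rewrite mem_filter => /andP[].
have := k0 _ ut; rewrite big_cat /= big_map [X in _ + X - _]big_seq [X in _ + X - _]big1 ?addr0; last first.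
  move=> u; rewrite mem_filter mem_undup => /andP[us' u0]; apply: f0.
  apply: contra us' => /eqP <-; apply: map_f; apply: ss; exact: map_f.
apply=> u u0; rewrite mem_cat mem_filter mem_undup u0 andbT; exact: orbN.
Qed.

Lemma hsum_split (T T' : eqType) (h1 h2 : T' -> T) (d : T -> T') (f : T -> R) :
  cancel h1 d -> cancel h2 d -> (forall x y, h1 x != h2 y) ->
  (forall u, u = h1 (d u) \/ u = h2 (d u)) -> abs_summable f ->
  [/\ abs_summable (f \o h1), abs_summable (f \o h2) &
    hsum f = hsum (f \o h1) + hsum (f \o h2)].
Proof.
move=> h1K h2K dis cov Hf.
have S h : cancel h d -> abs_summable (f \o h).
  move=> hK; case: Hf => A hA; exists A => s us.
  have u' : uniq (map h s) by rewrite map_inj_uniq//; exact: can_inj hK.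
  by have := hA _ u'; rewrite big_map.
have H1 := S h1 h1K; have H2 := S h2 h2K; split=> //.
apply/eqP; rewrite -subr_eq0 -normr_le0; apply/ler_addgt0Pr => e e0; rewrite add0r.
have e30 : 0 < e / 3 by rewrite divr_gt0.
have [s0 k0] := has_hsum Hf e30; have [s1 k1] := has_hsum H1 e30.
have [s2 k2] := has_hsum H2 e30.
pose t := undup (map d s0 ++ s1 ++ s2).
have ut : uniq t := undup_uniq _.
have l1 := k1 t ut _; have l2 := k2 t ut _.
have := k0 (map h1 t ++ map h2 t) _ _; rewrite big_cat /= !big_map /=.
have -> : uniq (map h1 t ++ map h2 t).
  rewrite cat_uniq !map_inj_uniq ?ut; [|exact: can_inj h2K|exact: can_inj h1K].
  rewrite andbT /=; apply/hasPn => _ /mapP[x _ ->]; apply/negP => /mapP[y _ xy].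
  by have := dis y x; rewrite xy eqxx.
move=> /(_ erefl) l0.
have {l0} := l0 _; have {l1} := l1 _; have {l2} := l2 _.
have c0 : {subset s0 <= map h1 t ++ map h2 t}.
  move=> u us; rewrite mem_cat; have ud : d u \in t.
    by rewrite mem_undup mem_cat map_f.
  by case: (cov u) => ->; rewrite map_f ?orbT.
have c1 : {subset s1 <= t} by move=> u us; rewrite mem_undup !mem_cat us orbT.
have c2 : {subset s2 <= t} by move=> u us; rewrite mem_undup !mem_cat us !orbT.
move=> /(_ c2) l2 /(_ c1) l1 /(_ c0) l0; move: l0 l1 l2; rewrite !ler_norml /=; lra.
Qed.

Lemma geom_int_sum (rho : R) (s : seq int) : 0 <= rho < 1 -> uniq s ->
  \sum_(a <- s) rho ^+ `|a|%N <= (1 + rho) / (1 - rho).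
Proof.
move=> /andP[r0 r1] us.
pose M := (\sum_(a <- s) `|a|%N)%N.
pose z := [seq Posz i | i <- iota 0 M.+1] ++ [seq Negz i | i <- iota 0 M.+1].
have sz : {subset s <= z}.
  move=> a sa; have aM : (`|a| <= M)%N.
    by rewrite /M (big_rem a)//= leq_addr.
  rewrite mem_cat; case: a sa aM => n _ nM.
    by apply/orP; left; apply: map_f; rewrite mem_iota add0n ltnS.
  by apply/orP; right; apply: map_f; rewrite mem_iota add0n ltnS (ltnW (nM : (n < M)%N)).
have uz : uniq z.
  rewrite cat_uniq !map_inj_uniq ?iota_uniq => [|? ? []//|? ? []//].
  by rewrite andbT; apply/hasPn => _ /mapP[x _ ->]; apply/negP => /mapP[].
apply: (@le_trans _ _ (\sum_(a <- z) rho ^+ `|a|%N)).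
  by apply: ler_sum_subseq => // u _; rewrite exprn_ge0.
rewrite /z big_cat !big_map ler_pdivlMr ?subr_gt0//.
have -> : \sum_(j <- iota 0 M.+1) rho ^+ `|Negz j| = rho * \sum_(j <- iota 0 M.+1) rho ^+ j.
  by rewrite mulr_sumr; apply: eq_bigr => i _; rewrite -exprS.
have -> : \sum_(j <- iota 0 M.+1) rho ^+ `|Posz j| = \sum_(j <- iota 0 M.+1) rho ^+ j by [].
have H : (\sum_(j <- iota 0 M.+1) rho ^+ j) * (1 - rho) = 1 - rho ^+ M.+1.
  have -> : iota 0 M.+1 = index_iota 0 M.+1 by rewrite /index_iota subn0.
  rewrite big_mkord mulrC -opprB mulNr -subrX1; ring.
have : 0 <= rho ^+ M.+1 by rewrite exprn_ge0.
set S := \sum_(_ <- _) _ in H *; move=> P0.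
have -> : (S + rho * S) * (1 - rho) = (1 + rho) * (S * (1 - rho)) by ring.
by rewrite H mulrBr mulr1 gerBl mulr_ge0// addr_ge0.
Qed.

Lemma geom_summable (C rho : R) (f : int -> R) : 0 <= rho < 1 ->
  (forall a, `|f a| <= C * rho ^+ `|a|%N) -> abs_summable f.
Proof.
move=> r01 fC; apply: (dominated_summable fC); apply: abs_summableZ.
exists ((1 + rho) / (1 - rho)) => s us.
have /andP[r0 _] := r01; under eq_bigr do rewrite ger0_norm ?exprn_ge0//.
exact: geom_int_sum.
Qed.

Lemma geom2_summable (C rho : R) (f : int * int -> R) : 0 <= rho < 1 ->
  (forall u, `|f u| <= C * (rho ^+ `|u.1|%N * rho ^+ `|u.2|%N)) -> abs_summable f.
Proof.
move=> r01 fC; apply: (dominated_summable fC); apply: abs_summableZ.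
have H : abs_summable (fun a : int => rho ^+ `|a|%N).
  apply: (@geom_summable 1 rho) => // a; rewrite mul1r ger0_norm ?exprn_ge0//.
  by case/andP: r01.
by case: (hsum_prod H H).
Qed.

End UnconditionalSums.

(** * Taylor bounds for the exponential, the sine and the cosine *)
Section Taylor.
Context {R : realType}.
Implicit Types x y : R.

Lemma ge0_of_derive (f f' : R -> R) : (forall x, is_derive x 1 f (f' x)) ->
  (forall x, 0 <= x -> 0 <= f' x) -> f 0 = 0 -> forall x, 0 <= x -> 0 <= f x.
Proof.
move=> df f'0 f0 x; rewrite le_eqVlt => /predU1P[<-|x0]; first by rewrite f0.
have [|c] := @MVT _ f f' _ _ x0 (fun y _ => df y).
  apply: continuous_subspaceT => y; apply: differentiable_continuous.
  by apply/derivable1_diffP; case: (df y).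
rewrite in_itv/= f0 subr0 subr0 => /andP[c0 _] ->.
by rewrite mulr_ge0 ?(ltW x0)// f'0// ltW.
Qed.

(** Each inequality is integrated from the previous one: both sides agree at 0
  and the derivative of the difference is the expression already shown to be
  nonnegative. *)
Ltac dgoal := by rewrite ?scaler0 /GRing.scale /=; field.
Ltac chain L := apply: (ge0_of_derive _ L);
  [move=> ?; apply: is_derive_eq; dgoal | rewrite ?(expR0,sin0,cos0,oppr0,expr0n)/=; lra].

Lemma expR_taylor_pos x : 0 <= x ->
  [/\ 0 <= expR x - (1 + x + x ^+ 2 / 2),
      0 <= expR x - (1 + x + x ^+ 2 / 2 + x ^+ 3 / 6) &
      0 <= expR x - (1 + x + x ^+ 2 / 2 + x ^+ 3 / 6 + x ^+ 4 / 24 + x ^+ 5 / 120)].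
Proof.
have h0 y : 0 <= y -> 0 <= expR y - (1 + y) by have := expR_ge1Dx y; lra.
have h1 : forall y, 0 <= y -> 0 <= expR y - (1 + y + y ^+ 2 / 2) by chain h0.
have h2 : forall y, 0 <= y -> 0 <= expR y - (1 + y + y ^+ 2 / 2 + y ^+ 3 / 6) by chain h1.
have h3 : forall y, 0 <= y ->
  0 <= expR y - (1 + y + y ^+ 2 / 2 + y ^+ 3 / 6 + y ^+ 4 / 24) by chain h2.
have h4 : forall y, 0 <= y -> 0 <= expR y -
  (1 + y + y ^+ 2 / 2 + y ^+ 3 / 6 + y ^+ 4 / 24 + y ^+ 5 / 120) by chain h3.
by move=> x0; split; [exact: h1|exact: h2|exact: h4].
Qed.

Lemma expRN_taylor_pos x : 0 <= x ->
  [/\ 0 <= (1 - x + x ^+ 2 / 2) - expR (- x),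
      0 <= expR (- x) - (1 - x + x ^+ 2 / 2 - x ^+ 3 / 6) &
      0 <= expR (- x) - (1 - x + x ^+ 2 / 2 - x ^+ 3 / 6 + x ^+ 4 / 24 - x ^+ 5 / 120)].
Proof.
have h0 y : 0 <= y -> 0 <= expR (- y) - (1 - y) by have := expR_ge1Dx (- y); lra.
have h1 : forall y, 0 <= y -> 0 <= (1 - y + y ^+ 2 / 2) - expR (- y) by chain h0.
have h2 : forall y, 0 <= y -> 0 <= expR (- y) - (1 - y + y ^+ 2 / 2 - y ^+ 3 / 6) by chain h1.
have h3 : forall y, 0 <= y ->
  0 <= (1 - y + y ^+ 2 / 2 - y ^+ 3 / 6 + y ^+ 4 / 24) - expR (- y) by chain h2.
have h4 : forall y, 0 <= y -> 0 <= expR (- y) -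
  (1 - y + y ^+ 2 / 2 - y ^+ 3 / 6 + y ^+ 4 / 24 - y ^+ 5 / 120) by chain h3.
by move=> x0; split; [exact: h1|exact: h2|exact: h4].
Qed.

(** Taylor polynomials of odd degree bound the exponential from below on the
  whole line, because the Lagrange remainder has an even power. *)
Lemma expR_ge_taylor3 y : 1 + y + y ^+ 2 / 2 + y ^+ 3 / 6 <= expR y.
Proof.
have [y0|y0] := leP 0 y; first by have [_ + _] := expR_taylor_pos y0; lra.
have [|_ + _] := @expRN_taylor_pos (- y); first lra.
rewrite opprK; set E := expR y; nra.
Qed.

Lemma expR_ge_taylor5 y : 1 + y + y ^+ 2 / 2 + y ^+ 3 / 6 + y ^+ 4 / 24 + y ^+ 5 / 120 <= expR y.
Proof.
have [y0|y0] := leP 0 y; first by have [_ _ +] := expR_taylor_pos y0; lra.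
have [|_ _ +] := @expRN_taylor_pos (- y); first lra.
rewrite opprK; set E := expR y.
have -> : (- y) ^+ 2 = y ^+ 2 by ring.
have -> : (- y) ^+ 3 = - y ^+ 3 by ring.
have -> : (- y) ^+ 4 = y ^+ 4 by ring.
have -> : (- y) ^+ 5 = - y ^+ 5 by ring.
lra.
Qed.

Lemma trig_taylor x : 0 <= x ->
  [/\ 0 <= sin x - (x - x ^+ 3 / 6),
      0 <= cos x - (1 - x ^+ 2 / 2),
      0 <= (1 - x ^+ 2 / 2 + x ^+ 4 / 24) - cos x &
      0 <= x - sin x].
Proof.
have h0 y : 0 <= y -> 0 <= 1 - cos y by have := cos_le1 y; lra.
have h1 : forall y, 0 <= y -> 0 <= y - sin y.
  by apply: (ge0_of_derive _ h0); rewrite sin0 subr0.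
have h2 : forall y, 0 <= y -> 0 <= cos y - (1 - y ^+ 2 / 2) by chain h1.
have h3 : forall y, 0 <= y -> 0 <= sin y - (y - y ^+ 3 / 6) by chain h2.
have h4 : forall y, 0 <= y -> 0 <= (1 - y ^+ 2 / 2 + y ^+ 4 / 24) - cos y by chain h3.
by move=> x0; split; auto.
Qed.

Lemma cos_taylor2 x : `|cos x - (1 - x ^+ 2 / 2)| <= x ^+ 4 / 24.
Proof.
have H y : 0 <= y -> `|cos y - (1 - y ^+ 2 / 2)| <= y ^+ 4 / 24.
  move=> y0; have [_ h1 h2 _] := trig_taylor y0.
  have y4 : 0 <= y ^+ 4 by rewrite exprn_ge0.
  by rewrite ler_norml; apply/andP; split; lra.
have := H _ (normr_ge0 x); rewrite cos_norm real_normK ?num_real//.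
by have -> : `|x| ^+ 4 = x ^+ 4 by rewrite -[4%N]/(2 * 2)%N !exprM real_normK ?num_real.
Qed.

Lemma pi_ge31 : 31 / 10 <= pi :> R.
Proof.
rewrite leNgt; apply/negP => pi31.
have p2 : 0 <= pi / 2 :> R by rewrite divr_ge0// pi_ge0.
have pi2 : pi / 2 < 31 / 20 :> R by lra.
have c0 : cos (31 / 20) <= 0 :> R.
  rewrite -(cos_pihalf R); have := @ltr_cos R (pi / 2) (31 / 20).
  rewrite !in_itv /= p2 /= => H.
  have p1 := @pihalf_ge1 R.
  have h1 : pi / 2 <= pi :> R by lra.
  have h2 : 31 / 20 <= pi :> R by have := @pi_ge2 R; lra.
  rewrite le_eqVlt H ?pi2 ?orbT ?h1 ?h2//.
  by apply/andP; split; [lra|].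
(* two angle doublings turn the parabola below the cosine into a bound at 31/20 *)
have [|_ k0 _ _] := @trig_taylor (31 / 80); first lra.
have k1 : 71 / 100 <= cos ((31 / 80) *+ 2) :> R by rewrite cos_mulr2n; nra.
have : 0 < cos ((31 / 80) *+ 2 *+ 2) :> R by rewrite cos_mulr2n; nra.
have -> : (31 / 80) *+ 2 *+ 2 = 31 / 20 :> R by field.
lra.
Qed.

(** The exponential on the right makes the error uniform in [y], as needed to
  dominate second differences over the whole lattice. *)
Lemma expR_taylor2_bound y : `|expR y - (1 + y + y ^+ 2 / 2)| <= `|y| ^+ 3 * expR `|y|.
Proof.
have [y0|y0] := leP 0 y; last first.
  rewrite (ltr0_norm y0); have x0 : 0 <= - y by lra.
  have [h1 h2 _] := expRN_taylor_pos x0; rewrite opprK in h1 h2.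
  have h3 : 1 <= expR (- y) by have := expR_ge1Dx (- y); lra.
  have x3 : 0 <= (- y) ^+ 3 by rewrite exprn_ge0.
  have h4 : (- y) ^+ 3 <= (- y) ^+ 3 * expR (- y) by rewrite ler_peMr.
  move: h1 h2; have -> : (- y) ^+ 2 = y ^+ 2 by ring.
  by rewrite ler_norml => h1 h2; apply/andP; split; lra.
have [h1 _ _] := expR_taylor_pos y0.
rewrite !ger0_norm//.
have [y1|y1] := leP 1 y.
  have : 1 <= y ^+ 3 by rewrite exprn_ege1.
  have := expR_gt0 y; have := sqr_ge0 y; nra.
have [_ h2 _] := expRN_taylor_pos y0.
have T0 : 0 <= 1 + y + y ^+ 2 / 2 by have := sqr_ge0 y; lra.
have h3 : 1 - y ^+ 3 <= (1 + y + y ^+ 2 / 2) * expR (- y).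
  rewrite (@le_trans _ _ ((1 + y + y ^+ 2 / 2) * (1 - y + y ^+ 2 / 2 - y ^+ 3 / 6)))//.
    rewrite -subr_ge0.
    have -> : (1 + y + y ^+ 2 / 2) * (1 - y + y ^+ 2 / 2 - y ^+ 3 / 6) - (1 - y ^+ 3) =
      y ^+ 3 * (5 / 6 + y * (1 - y) / 12) by field.
    by rewrite mulr_ge0 ?exprn_ge0// addr_ge0 ?divr_ge0 ?mulr_ge0//; lra.
  by rewrite ler_wpM2l//; lra.
have := ler_wpM2r (expR_ge0 y) h3.
rewrite -mulrA (mulrC (expR (- y))) expRxMexpNx_1; lra.
Qed.

End Taylor.

(** * Poisson summation for the Gaussian on the integers *)
Section RootsOfUnity.
Context {R : realType}.
Implicit Types x y z : R.

Lemma cosD2piz x (n : int) : cos (x + 2 * pi * n%:~R) = cos x.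
Proof.
have P (k : nat) y : cos (y + 2 * pi * k%:R) = cos y.
  rewrite -(periodicn (@cosD2pi R) k y) -mulr_natl; congr cos; rewrite -mulr_natl; ring.
case: n => n; first exact: P.
rewrite -(P n.+1 (x + _)) NegzE; congr cos; rewrite mulrNz /intmul; ring.
Qed.

Lemma sin_pi_neq0 (N : nat) (a : int) : (0 < N)%N -> ~~ (N %| `|a|)%N ->
  sin (pi * a%:~R / N%:R) != 0 :> R.
Proof.
move=> N0 Na.
suff H : sin (pi * `|a|%:R / N%:R) != 0 :> R.
  case: a Na H => n Na //; rewrite NegzE mulrNz !(mulrN,mulNr) sinN oppr_eq0.
  by [].
have Nr : N%:R != 0 :> R by rewrite pnatr_eq0 -lt0n.
rewrite (divn_eq `|a| N) natrD natrM.
have -> : pi * ((`|a| %/ N)%:R * N%:R + (`|a| %% N)%:R) / N%:R =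
  pi * (`|a| %% N)%:R / N%:R + pi *+ (`|a| %/ N) :> R.
  by rewrite -[pi *+ _]mulr_natr; field.
rewrite (alternatingn (@sinDpi R)) mulf_neq0 ?signr_eq0// gt_eqF//.
apply: sin_gt0_pi; apply/andP; split.
  by rewrite divr_gt0 ?mulr_gt0 ?pi_gt0 ?ltr0n// lt0n.
rewrite ltr_pdivrMr ?ltr0n// ltr_pM2l ?pi_gt0//.
by rewrite ltr_nat ltn_mod.
Qed.

(** When [N] does not divide [a], multiplying by [sin (pi a / N)], which is
  not zero, makes the sum telescope over a full period. *)
Lemma sum_cos_roots (N : nat) (a : int) (y : R) : (0 < N)%N ->
  \sum_(j < N) cos (2 * pi * a%:~R * (j%:R + y) / N%:R) =
  if (N %| `|a|)%N then N%:R * cos (2 * pi * a%:~R * y / N%:R) else 0.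
Proof.
move=> N0; have Nr : N%:R != 0 :> R by rewrite pnatr_eq0 -lt0n.
case: ifPn => [|Na].
  move=> /dvdnP[k ak].
  have [q aq] : exists q : int, a = q * N%:Z.
    by case: a ak => n /= nE; [exists k%:Z|exists (- k%:Z)]; lia.
  rewrite (eq_bigr (fun=> cos (2 * pi * a%:~R * y / N%:R))); last first.
    move=> j _; rewrite -[RHS](cosD2piz _ (q * j%:Z)) aq !intrM; congr cos.
    by rewrite -!pmulrn; field.
  by rewrite sumr_const card_ord -[_ *+ N]mulr_natl.
set th := pi * a%:~R / N%:R : R.
have s0 : sin th != 0 by exact: sin_pi_neq0.
apply: (mulfI s0); rewrite mulr0 mulr_sumr.
rewrite (eq_bigr (fun j : 'I_N => sin (2 * th * (j.+1%:R + y) - th) / 2 -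
    sin (2 * th * (j%:R + y) - th) / 2)); last first.
  move=> j _; have -> : 2 * pi * a%:~R * (j%:R + y) / N%:R = 2 * th * (j%:R + y).
    by rewrite /th; field.
  have -> : 2 * th * (j.+1%:R + y) - th = 2 * th * (j%:R + y) + th.
    by rewrite -natr1; ring.
  by rewrite sinD sinB; field.
have := telescope_sumr (fun j => sin (2 * th * (j%:R + y) - th) / 2) (leq0n N).
rewrite big_mkord => ->.
have -> : 2 * th * (N%:R + y) - th = 2 * th * (0%:R + y) - th + 2 * pi * a%:~R.
  by rewrite /th; field.
have P x : sin (x + 2 * pi * a%:~R) = sin x.
  by rewrite -!cosBpihalf -addrAC cosD2piz.
by rewrite P subrr.
Qed.

Lemma cos_expn (n : nat) x :
  cos x ^+ n = 2^-1 ^+ n * \sum_(k < n.+1) 'C(n, k)%:R * cos ((n%:R - 2 * k%:R) * x).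
Proof.
elim: n => [|n IH].
  by rewrite big_ord_recl big_ord0 /= !expr0 bin0 !mulr0 subrr mul0r cos0 addr0 !mul1r.
rewrite exprSr IH [in RHS]exprSr -!mulrA; congr (_ * _).
rewrite [in RHS]big_ord_recl /= bin0 mul1r mulr0 subr0.
under [in RHS]eq_bigr => k _ do rewrite /bump add1n binS natrD mulrDl.
rewrite big_split /=.
rewrite [X in _ = _ * (_ + (X + _))]big_ord_recr /= bin_small// mul0r addr0.
have -> : cos (n.+1%:R * x) + (\sum_(i < n) 'C(n, i.+1)%:R * cos ((n.+1%:R - 2 * i.+1%:R) * x) +
     \sum_(i < n.+1) 'C(n, i)%:R * cos ((n.+1%:R - 2 * i.+1%:R) * x)) =
   \sum_(i < n.+1) 'C(n, i)%:R * (cos ((n.+1%:R - 2 * i%:R) * x) +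
      cos ((n.+1%:R - 2 * i.+1%:R) * x)).
  under [RHS]eq_bigr do rewrite mulrDr.
  rewrite big_split /= [X in _ = X + _]big_ord_recl /= bin0 mul1r mulr0 subr0 -addrA.
  by [].
rewrite mulr_sumr mulr_suml; apply: eq_bigr => k _.
have -> : (n.+1%:R - 2 * k%:R) * x = (n%:R - 2 * k%:R) * x + x by rewrite -natr1; ring.
have -> : (n.+1%:R - 2 * k.+1%:R) * x = (n%:R - 2 * k%:R) * x - x by rewrite -!natr1; ring.
by rewrite cosD cosB; field.
Qed.

(** The ratio of consecutive binomial coefficients, [(m - i) / (m + i + 1)],
  is at most [exp (- (2 i + 1) / (m + L))], and the odd numbers add up to [i ^
  2]. *)
Lemma central_bin_le (m L i : nat) : (0 < m)%N -> (i <= L)%N -> (L <= m)%N ->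
  'C(m.*2, m + i)%:R <= 'C(m.*2, m)%:R * expR (- (i%:R ^+ 2 / (m + L)%:R)) :> R.
Proof.
move=> m0; elim: i => [|i IH] iL Lm; first by rewrite addn0 expr0n mul0r oppr0 expR0 mulr1.
have d0 : 0 < (m + i.+1)%:R :> R by rewrite ltr0n addnS.
have dL : 0 < (m + L)%:R :> R by rewrite ltr0n addn_gt0 m0.
rewrite -(ler_pM2l d0) -natrM addnS mul_bin_left -addnn subnDl natrM.
have e1 : (m - i)%:R <= (m + i.+1)%:R * expR (- ((2 * i%:R + 1) / (m + L)%:R)) :> R.
  apply: (@le_trans _ _ ((m + i.+1)%:R * (1 - (2 * i%:R + 1) / (m + L)%:R))); last first.
    by rewrite ler_pM2l// expR_ge1Dx.
  have : (m + i.+1)%:R <= (m + L)%:R :> R by rewrite ler_nat leq_add2l.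
  move=> h; have h2 : (m + i.+1)%:R / (m + L)%:R <= 1 :> R by rewrite ler_pdivrMr// mul1r.
  have -> : (m - i)%:R = (m + i.+1)%:R - (2 * i%:R + 1) :> R.
    rewrite natrB; last lia.
    rewrite natrD -natr1; ring.
  rewrite mulrBr mulr1 lerD2l lerN2.
  have -> : (m + i.+1)%:R * ((2 * i%:R + 1) / (m + L)%:R) =
    ((m + i.+1)%:R / (m + L)%:R) * (2 * i%:R + 1) :> R by rewrite mulrA [RHS]mulrAC.
  by rewrite ler_piMl// addr_ge0// mulr_ge0.
have IH' := IH (ltnW iL) Lm.
rewrite addnn.
apply: le_trans (ler_pM _ _ e1 IH') _ => //.
rewrite mulrACA -expRD -mulrA -addnS; apply: ler_wpM2l => //; apply: ler_wpM2l => //.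
have -> : i.+1%:R ^+ 2 = (2 * i%:R + 1) + i%:R ^+ 2 :> R by rewrite -natr1; ring.
by rewrite ler_expR -opprD -mulrDl.
Qed.

(** The same comparison of consecutive ratios from below, with [m - L] in
  place of [m + L]. *)
Lemma central_bin_ge (m L i : nat) : (i <= L)%N -> (L < m)%N ->
  'C(m.*2, m)%:R * expR (- (i%:R ^+ 2 / (m - L)%:R)) <= 'C(m.*2, m + i)%:R :> R.
Proof.
elim: i => [|i IH] iL Lm; first by rewrite addn0 expr0n mul0r oppr0 expR0 mulr1.
have d0 : 0 < (m + i.+1)%:R :> R by rewrite ltr0n addnS.
have dL : 0 < (m - L)%:R :> R by rewrite ltr0n subn_gt0.
rewrite -(ler_pM2l d0) -natrM addnS mul_bin_left -addnn subnDl natrM addnn.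
have e1 : (m + i.+1)%:R * expR (- ((2 * i%:R + 1) / (m - L)%:R)) <= (m - i)%:R :> R.
  rewrite expRN ler_pdivrMr ?expR_gt0//.
  have mi : (m - L)%:R <= (m - i)%:R :> R by rewrite ler_nat; lia.
  apply: (@le_trans _ _ ((m - i)%:R * (1 + (2 * i%:R + 1) / (m - L)%:R))); last first.
    by rewrite ler_wpM2l ?expR_ge1Dx.
  have -> : (m + i.+1)%:R = (m - i)%:R + (2 * i%:R + 1) :> R.
    rewrite natrB; last lia.
    rewrite natrD -natr1; ring.
  rewrite mulrDr mulr1 lerD2l mulrCA; apply: ler_peMr.
    by rewrite addr_ge0// mulr_ge0.
  by rewrite ler_pdivlMr// mul1r.
have IH' := IH (ltnW iL) Lm.
apply: (le_trans _ (ler_pM _ _ e1 IH')) => //; rewrite ?mulr_ge0 ?expR_ge0//.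
rewrite mulrACA -expRD -[leRHS]mulrA -addnS; apply: ler_wpM2l => //; apply: ler_wpM2l => //.
have -> : i.+1%:R ^+ 2 = (2 * i%:R + 1) + i%:R ^+ 2 :> R by rewrite -natr1; ring.
by rewrite ler_expR -opprD -mulrDl.
Qed.

End RootsOfUnity.

Section Poisson.
Context {R : realType}.
Implicit Types x y z : R.

Lemma cvg_expRN (f : nat -> R) (l : R) : f n @[n --> \oo] --> l ->
  expR (- f n) @[n --> \oo] --> expR (- l).
Proof.
move=> fl; have h : - f n @[n --> \oo] --> - l by exact: cvgN.
exact: (cvg_comp _ _ h (@continuous_expR R _)).
Qed.

Lemma cvg_compound (x : nat -> R) (m : nat -> nat) (L : R) :
  (forall n, 0 <= x n <= 1) -> x n @[n --> \oo] --> (0 : R) ->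
  (m n)%:R * x n @[n --> \oo] --> L ->
  (1 - x n) ^+ m n @[n --> \oo] --> expR (- L).
Proof.
move=> x01 x0 mxL.
apply: (@squeeze_cvgr _ _ _ _ (fun n => expR (- ((m n)%:R * x n * (1 - x n)^-1)))
    (fun n => expR (- ((m n)%:R * x n)))).
- near=> n.
  have x12 : x n <= 1 / 2.
    by near: n; apply: (cvgr_le 0) => //; lra.
  have /andP[xn0 xn1] := x01 n.
  have d0 : 0 < 1 - x n by lra.
  have up : 1 - x n <= expR (- x n) by have := expR_ge1Dx (- x n); lra.
  have lo : expR (- (x n / (1 - x n))) <= 1 - x n.
    rewrite expRN invf_ple ?posrE ?expR_gt0//.
    have e : (1 - x n)^-1 = 1 + x n / (1 - x n) by field; apply/eqP => e; lra.
    by rewrite [leLHS]e expR_ge1Dx.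
  have E y : expR (- ((m n)%:R * y)) = expR (- y) ^+ m n by rewrite -expRM_natl mulrN.
  rewrite -mulrA !E !lerXn2r// ?nnegrE ?expR_ge0//; exact: ltW.
- have -> : L = L * (1 - 0)^-1 by rewrite subr0 invr1 mulr1.
  apply: cvg_expRN; apply: cvgM => //; apply: cvgV; first by rewrite subr0 oner_eq0.
  by apply: cvgB => //; exact: cvg_cst.
- exact: cvg_expRN.
Unshelve. all: by end_near.
Qed.

Lemma gauss_geom_bound (kappa : R) z : 0 < kappa -> forall j : int,
  expR (- (kappa * (j%:~R + z) ^+ 2)) <=
  expR ((4 * kappa)^-1 + `|z|) * expR (-1) ^+ `|j|%N.
Proof.
move=> k0 j.
rewrite -expRM_natl -expRD ler_expR mulrN1.
have jE : `|j|%N%:R = `|j%:~R| :> R by rewrite natr_absz intr_norm.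
rewrite jE.
have h : `|j%:~R| <= `|j%:~R + z| + `|z| :> R.
  by have := ler_normB (j%:~R + z) z; rewrite addrK.
suff : `|j%:~R + z| <= kappa * (j%:~R + z) ^+ 2 + (4 * kappa)^-1 by lra.
rewrite -[(j%:~R + z) ^+ 2]real_normK ?num_real//; set t := `|_|.
rewrite -subr_ge0.
have -> : kappa * t ^+ 2 + (4 * kappa)^-1 - t = kappa * (t - (2 * kappa)^-1) ^+ 2.
  by field; rewrite gt_eqF.
by rewrite mulr_ge0 ?sqr_ge0// ltW.
Qed.

Lemma expN1_itv : 0 <= expR (-1 : R) < 1.
Proof. by rewrite expR_ge0 expR_lt1 oppr_lt0 ltr01. Qed.

Lemma gauss_summable (kappa : R) z : 0 < kappa ->
  abs_summable (fun j : int => expR (- (kappa * (j%:~R + z) ^+ 2))).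
Proof.
move=> k0; apply: (@geom_summable R _ _ _ expN1_itv) => j.
by rewrite ger0_norm ?expR_ge0//; exact: gauss_geom_bound.
Qed.

Definition theta_cos (c z : R) : R :=
  hsum (fun n : int => expR (- (c * n%:~R ^+ 2)) * cos (2 * pi * n%:~R * z)).

Definition theta_gauss (d z : R) : R :=
  hsum (fun l : int => expR (- (d * (l%:~R + z) ^+ 2))).

Lemma theta_cos_dom (c z : R) (n : int) :
  `|expR (- (c * n%:~R ^+ 2)) * cos (2 * pi * n%:~R * z)| <= expR (- (c * (n%:~R + 0) ^+ 2)).
Proof. by rewrite addr0 normrM ger0_norm ?expR_ge0// ler_piMr ?expR_ge0 ?cos_max. Qed.

Lemma theta_cos_summable (c z : R) : 0 < c ->
  abs_summable (fun n : int => expR (- (c * n%:~R ^+ 2)) * cos (2 * pi * n%:~R * z)).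
Proof. by move=> c0; apply: dominated_summable (gauss_summable 0 c0); exact: theta_cos_dom. Qed.

Lemma theta_cos_shift (c z : R) (n : int) : theta_cos c (z + n%:~R) = theta_cos c z.
Proof.
congr hsum; apply/funext => k; congr (_ * _).
by rewrite mulrDr -[2 * pi * k%:~R * n%:~R]mulrA -intrM cosD2piz.
Qed.

Lemma theta_gauss_shift (d z : R) (n : int) : 0 < d -> theta_gauss d (z + n%:~R) = theta_gauss d z.
Proof.
move=> d0; rewrite /theta_gauss; have [_ <-] := @hsum_reindex R _ _ (fun l => l + n) (fun l => l - n) _
  (fun l => addrK n l) (fun l => subrK n l) (gauss_summable z d0).
by congr hsum; apply/funext => k /=; rewrite intrD addrAC addrA.
Qed.

Lemma theta_cos0_ge1 (c : R) : 0 < c -> 1 <= theta_cos c 0.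
Proof.
move=> c0; have := @hsum_ge_finite R _ _ [:: 0] isT (theta_cos_summable 0 c0).
rewrite big_seq1 expr0n /= !mulr0 cos0 oppr0 expR0 mulr1; apply.
by move=> n _; rewrite mulr0 cos0 mulr1 expR_ge0.
Qed.

(** Polya's derivation of the theta identity. The sum of the power [2 m] of
  the cosine at [N] equally spaced points is evaluated in two ways. Near the
  maxima the power of the cosine is a Gaussian; expanded in frequencies, only
  the binomial coefficients at distance a multiple of [N] from the centre
  survive, and these are Gaussian too. Both limits are taken along [m ~ N ^ 2
  / c]. *)
Section Polya.
Variable c : R.
Hypothesis c0 : 0 < c.

(* starting beyond [c] makes [N ^ 2 / c] at least 2 for every [n] *)
Let h n := ((Num.truncn c).+1 + n)%N.
Let N n := (h n).*2.+1.
Let m n := Num.truncn ((N n)%:R ^+ 2 / c).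

Let N0 n : 0 < (N n)%:R :> R. Proof. by rewrite ltr0n. Qed.

Let N_large n : 2 <= (N n)%:R ^+ 2 / c :> R.
Proof.
rewrite ler_pdivlMr//.
have h1 : c <= (h n)%:R.
  by rewrite (le_trans (ltW (truncnS_gt c)))// ler_nat leq_addr.
have h2 : (N n)%:R = 2 * (h n)%:R + 1 :> R by rewrite /N -natr1 -muln2 natrM mulrC.
by rewrite h2; nra.
Qed.

Let m_le n : (m n)%:R <= (N n)%:R ^+ 2 / c :> R.
Proof. by rewrite truncn_le; have := N_large n; lra. Qed.

Let m_gt n : (N n)%:R ^+ 2 / c < (m n)%:R + 1 :> R.
Proof. by rewrite natr1 truncnS_gt. Qed.

Let m_half n : (N n)%:R ^+ 2 / c / 2 <= (m n)%:R :> R.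
Proof. have := N_large n; have := m_gt n; lra. Qed.

Let m_gt0 n : (0 < m n)%N.
Proof. by rewrite truncn_gt0; have := N_large n; lra. Qed.

Let cvg_invN : (N n)%:R^-1 @[n --> \oo] --> (0 : R).
Proof.
apply: (@squeeze_cvgr _ _ _ _ (fun=> 0) (@harmonic R)); [|exact: cvg_cst|exact: cvg_harmonic].
near=> n; rewrite invr_ge0 ler0n/= /harmonic /= lef_pV2 ?posrE ?ltr0n// ler_nat /N /h.
by rewrite -muln2; lia.
Unshelve. all: by end_near.
Qed.

Let cvg_mu : (m n)%:R / (N n)%:R ^+ 2 @[n --> \oo] --> c^-1.
Proof.
apply: (@squeeze_cvgr _ _ _ _ (fun n => c^-1 - (N n)%:R^-1 * (N n)%:R^-1) (fun=> c^-1)).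
- near=> n; have N2 : 0 < (N n)%:R ^+ 2 :> R by rewrite exprn_gt0.
  rewrite ler_pdivrMr// ler_pdivlMr// mulrBl -expr2 exprVn mulVf ?gt_eqF//.
  by rewrite [c^-1 * _]mulrC; have := m_le n; have := m_gt n => *; apply/andP; split; lra.
- have H : c^-1 - (N n)%:R^-1 * (N n)%:R^-1 @[n --> \oo] --> c^-1 - 0 * 0.
    by apply: cvgB; [exact: cvg_cst|exact: cvgM].
  by move: H; rewrite mulr0 subr0.
- exact: cvg_cst.
Unshelve. all: by end_near.
Qed.

Let K n : R := (N n)%:R * 2^-1 ^+ (m n).*2 * 'C((m n).*2, m n)%:R.

Section Phase.
Variable z : R.

(* the points are centred, so that the maximum of the cosine is at the middle *)
Let A n : R := \sum_(j < N n) cos (pi * (j%:R + (z - (h n)%:R)) / (N n)%:R) ^+ (m n).*2.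

Let G n : R := hsum (fun a : int =>
  ('C((m n).*2, m n + `|a| * N n)%:R / 'C((m n).*2, m n)%:R) * cos (2 * pi * a%:~R * z)).

Let G_dom n (a : int) :
  `|('C((m n).*2, m n + `|a| * N n)%:R / 'C((m n).*2, m n)%:R) * cos (2 * pi * a%:~R * z)|
  <= expR (- (c / 2 * (a%:~R + 0) ^+ 2)).
Proof.
have b0 : 0 < 'C((m n).*2, m n)%:R :> R by rewrite ltr0n bin_gt0 -addnn leq_addr.
rewrite addr0 normrM ger0_norm ?divr_ge0//.
apply: (@le_trans _ _ ('C((m n).*2, m n + `|a| * N n)%:R / 'C((m n).*2, m n)%:R)).
  by rewrite ler_piMr ?divr_ge0 ?cos_max.
rewrite ler_pdivrMr//.
have [Lm|Lm] := leqP (`|a| * N n) (m n); last first.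
  by rewrite bin_small ?mulr_ge0 ?expR_ge0// -addnn ltn_add2l.
apply: le_trans (central_bin_le (m_gt0 n) (leqnn _) Lm) _.
rewrite mulrC ler_pM2r// ler_expR lerN2.
have m0 : 0 < (m n)%:R :> R by rewrite ltr0n.
have d1 : (m n + `|a| * N n)%:R <= 2 * (m n)%:R :> R by rewrite -natrM ler_nat; lia.
have d0 : 0 < (m n + `|a| * N n)%:R :> R by rewrite ltr0n addn_gt0 m_gt0.
rewrite ler_pdivlMr//.
have aE : a%:~R ^+ 2 = `|a|%N%:R ^+ 2 :> R by rewrite natr_absz intr_norm real_normK ?num_real.
rewrite aE natrM exprMn.
have mN : (m n)%:R * c <= (N n)%:R ^+ 2 by rewrite -ler_pdivlMr.
have a2 : 0 <= `|a|%N%:R ^+ 2 :> R by rewrite sqr_ge0.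
apply: (@le_trans _ _ (c / 2 * `|a|%N%:R ^+ 2 * (2 * (m n)%:R))).
  by apply: ler_wpM2l => //; rewrite mulr_ge0// divr_ge0// ltW.
by have := ler_wpM2l a2 mN; lra.
Qed.

(* shifting the phase [z] by the integer [h n] has no effect at the
   frequencies that survive *)
Let polya_identity n : A n = K n * G n.
Proof.
rewrite /A /K /G.
pose f (a : int) : R := 'C((m n).*2, m n + `|a|)%:R *
  (if (N n %| `|a|)%N then (N n)%:R * cos (2 * pi * a%:~R * (z - (h n)%:R) / (N n)%:R) else 0).
have S1 (j : nat) : cos (pi * (j%:R + (z - (h n)%:R)) / (N n)%:R) ^+ (m n).*2 =
  2^-1 ^+ (m n).*2 * \sum_(k < (m n).*2.+1) 'C((m n).*2, k)%:R *
    cos (2 * pi * ((m n)%:Z - k%:Z)%:~R * (j%:R + (z - (h n)%:R)) / (N n)%:R).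
  rewrite cos_expn; congr (_ * _); apply: eq_bigr => k _; congr (_ * cos _).
  have -> : (m n).*2%:R = 2 * (m n)%:R :> R by rewrite -muln2 natrM mulrC.
  by rewrite intrD mulrNz -!pmulrn; field; rewrite gt_eqF.
under eq_bigr do rewrite S1.
rewrite -mulr_sumr exchange_big /=.
under eq_bigr => k _ do rewrite -mulr_sumr sum_cos_roots//.
have S2 : \sum_(k < (m n).*2.+1) 'C((m n).*2, k)%:R *
   (if (N n %| `|(m n)%:Z - k%:Z|)%N then (N n)%:R *
     cos (2 * pi * ((m n)%:Z - k%:Z)%:~R * (z - (h n)%:R) / (N n)%:R) else 0) = hsum f.
  pose s0 := [seq (m n)%:Z - k%:Z | k <- iota 0 (m n).*2.+1].
  rewrite (@hsum_finite R _ f s0).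
  - rewrite /s0 big_map -[iota 0 _]/(iota 0 ((m n).*2.+1 - 0)) -/(index_iota 0 _) big_mkord.
    apply: eq_bigr => k _; rewrite /f; congr (_%:R * _).
    have k2 := ltn_ord k; have [km|mk] := leqP k (m n).
      have -> : `|(m n)%:Z - k%:Z|%N = (m n - k)%N by lia.
      have -> : (m n + (m n - k))%N = ((m n).*2 - k)%N by lia.
      by rewrite bin_sub.
    by congr 'C(_, _); lia.
  - by rewrite map_inj_uniq ?iota_uniq// => x y; lia.
  - move=> a na; rewrite /f bin_small ?mul0r//.
    rewrite ltnNge; apply: contra na => am.
    apply/mapP; exists `|(m n)%:Z - a|%N; last lia.
    by rewrite mem_iota; lia.
rewrite S2.
have Sf : abs_summable f.
  apply: (@abs_summable_finite _ _ _ [seq (m n)%:Z - k%:Z | k <- iota 0 (m n).*2.+1]).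
  move=> a na; rewrite /f bin_small ?mul0r//.
  rewrite ltnNge; apply: contra na => am.
  apply/mapP; exists `|(m n)%:Z - a|%N; last lia.
  by rewrite mem_iota; lia.
have NZ : (N n)%:Z != 0 by [].
have [||Sh ->] := @hsum_inj _ _ _ (fun a : int => a * (N n)%:Z) (fun a => (a %/ (N n)%:Z)%Z) f _ _ Sf.
- by move=> a; rewrite mulzK.
- move=> a; rewrite /f; case: ifPn => [Na|_]; last by rewrite mulr0.
  by rewrite divzK ?eqxx.
have b0 : 'C((m n).*2, m n)%:R != 0 :> R.
  by rewrite pnatr_eq0 -lt0n bin_gt0 -addnn leq_addr.
rewrite -hsumZ// -hsumZ; last first.
  by apply: dominated_summable (gauss_summable 0 (divr_gt0 c0 (ltr0n _ 2))); exact: G_dom.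
congr hsum; apply/funext => a /=; rewrite /f abszM /= dvdn_mull//.
have -> : 2 * pi * (a * (N n)%:Z)%:~R * (z - (h n)%:R) / (N n)%:R =
  2 * pi * a%:~R * z + 2 * pi * (- (a * (h n)%:Z))%:~R :> R.
  by rewrite mulrNz !intrM -!pmulrn; field; rewrite gt_eqF.
by rewrite cosD2piz; field.
Qed.

Let cvg_ratio (a : int) :
  'C((m n).*2, m n + `|a| * N n)%:R / 'C((m n).*2, m n)%:R @[n --> \oo] -->
  expR (- (c * a%:~R ^+ 2)).
Proof.
set l : R := `|a|%N%:R.
have aE : a%:~R ^+ 2 = l ^+ 2 :> R by rewrite /l natr_absz intr_norm real_normK ?num_real.
have lim (sg : R) : l ^+ 2 / ((m n)%:R / (N n)%:R ^+ 2 + sg * (l * (N n)%:R^-1))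
    @[n --> \oo] --> c * a%:~R ^+ 2.
  have -> : c * a%:~R ^+ 2 = l ^+ 2 / (c^-1 + sg * (l * 0)).
    by rewrite aE !mulr0 addr0 invrK mulrC.
  apply: cvgM; first exact: cvg_cst.
  apply: cvgV; first by rewrite !mulr0 addr0 invr_eq0 gt_eqF.
  apply: cvgD; first exact: cvg_mu.
  by apply: cvgM; [exact: cvg_cst|apply: cvgM; [exact: cvg_cst|exact: cvg_invN]].
have evL : \forall n \near \oo, (`|a| * N n < m n)%N.
  have h1 : (m n)%:R / (N n)%:R ^+ 2 - l * (N n)%:R^-1 @[n --> \oo] --> c^-1 - l * 0.
    apply: cvgB; first exact: cvg_mu.
    by apply: cvgM; [exact: cvg_cst|exact: cvg_invN].
  have : \forall n \near \oo, 0 < (m n)%:R / (N n)%:R ^+ 2 - l * (N n)%:R^-1.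
    by apply: (cvgr_gt _ h1); rewrite mulr0 subr0 invr_gt0.
  apply: filterS => n; rewrite subr_gt0 ltr_pdivlMr ?exprn_gt0// -(ltr_nat R) natrM -/l.
  have N0n := N0 n; suff -> : l / (N n)%:R * (N n)%:R ^+ 2 = l * (N n)%:R by [].
  by field; rewrite gt_eqF.
apply: (@squeeze_cvgr _ _ _ _
  (fun n => expR (- (l ^+ 2 / ((m n)%:R / (N n)%:R ^+ 2 + -1 * (l * (N n)%:R^-1)))))
  (fun n => expR (- (l ^+ 2 / ((m n)%:R / (N n)%:R ^+ 2 + 1 * (l * (N n)%:R^-1)))))).
- near=> n.
  have Lm : (`|a| * N n < m n)%N by near: n.
  have b0 : 0 < 'C((m n).*2, m n)%:R :> R by rewrite ltr0n bin_gt0 -addnn leq_addr.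
  have N0n := N0 n.
  rewrite ler_pdivlMr// ler_pdivrMr//; apply/andP; split.
    apply: le_trans (central_bin_ge (leqnn _) Lm); rewrite mulrC ler_pM2l// ler_expR lerN2.
    rewrite natrB ?(ltnW Lm)// natrM -/l le_eqVlt; apply/orP; left; apply/eqP.
    have -> : (m n)%:R / (N n)%:R ^+ 2 + -1 * (l / (N n)%:R) =
      ((m n)%:R - l * (N n)%:R) / (N n)%:R ^+ 2 by field; rewrite gt_eqF.
    by rewrite invf_div exprMn [RHS]mulrA.
  apply: (le_trans (central_bin_le (m_gt0 n) (leqnn _) (ltnW Lm))).
  rewrite mulrC ler_pM2r// ler_expR lerN2.
  rewrite natrD natrM -/l le_eqVlt; apply/orP; left; apply/eqP.
  have -> : (m n)%:R / (N n)%:R ^+ 2 + 1 * (l / (N n)%:R) =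
    ((m n)%:R + l * (N n)%:R) / (N n)%:R ^+ 2 by field; rewrite gt_eqF.
  by rewrite invf_div exprMn [LHS]mulrA.
- exact: cvg_expRN.
- exact: cvg_expRN.
Unshelve. all: by end_near.
Qed.

Let cvg_G : G n @[n --> \oo] --> theta_cos c z.
Proof.
apply: (@dominated_hsum_cvg _ _ _ _ (fun a : int => expR (- (c / 2 * (a%:~R + 0) ^+ 2)))).
- by apply: gauss_summable; rewrite divr_gt0.
- exact: G_dom.
- by move=> a; apply: cvgM; [exact: cvg_ratio|exact: cvg_cst].
Qed.

Hypothesis z12 : `|z| <= 1 / 2.

Let sin2_bounds x : x ^+ 2 - x ^+ 4 / 3 <= sin x ^+ 2 <= x ^+ 2.
Proof.
have H y : 0 <= y -> y ^+ 2 - y ^+ 4 / 3 <= sin y ^+ 2 <= y ^+ 2.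
  move=> y0; have [h1 _ _ h2] := trig_taylor y0; apply/andP; split; last first.
    have [s0|s0] := leP 0 (sin y); first by rewrite ler_sqr ?nnegrE//; lra.
    have y1 : 1 <= y.
      rewrite leNgt; apply/negP => y1; suff: 0 <= sin y by lra.
      have y2 : y ^+ 2 <= 1 by rewrite expr_le1// ltW.
      have y3 : y ^+ 3 <= y by rewrite exprS ler_piMr.
      by lra.
    apply: le_trans (_ : 1 <= _); last by rewrite exprn_ege1.
    by rewrite -[sin y ^+ 2]real_normK ?num_real// expr_le1 ?sin_max.
  have [y3|y3] := leP 3 (y ^+ 2).
    apply: le_trans (sqr_ge0 _); have -> : y ^+ 4 = y ^+ 2 * y ^+ 2 by ring.
    by have := sqr_ge0 y; nra.
  have t0 : 0 <= y - y ^+ 3 / 6 by have -> : y ^+ 3 = y * y ^+ 2 by []; nra.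
  apply: (@le_trans _ _ ((y - y ^+ 3 / 6) ^+ 2)); last by rewrite ler_sqr ?nnegrE//; lra.
  have -> : (y - y ^+ 3 / 6) ^+ 2 = y ^+ 2 - y ^+ 4 / 3 + (y ^+ 3 / 6) ^+ 2 by field.
  by rewrite lerDl sqr_ge0.
have [x0|x0] := leP 0 x; first exact: H.
have -> : x ^+ 4 = (- x) ^+ 4 by ring.
by rewrite -(sqrrN x) -(sqrrN (sin x)) -sinN; apply: H; lra.
Qed.

Let theta n (j : int) : R := pi * (j%:~R + z) / (N n)%:R.

Let A_hsum n : A n = hsum (fun j : int =>
  if (`|j| <= h n)%N then (1 - sin (theta n j) ^+ 2) ^+ m n else 0).
Proof.
rewrite (@hsum_finite R _ _ [seq j%:Z - (h n)%:Z | j <- iota 0 (N n)]).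
- rewrite big_map -[iota 0 _]/(iota 0 (N n - 0)) -/(index_iota 0 _) big_mkord /A.
  apply: eq_bigr => j _; have jN := ltn_ord j.
  have -> : (`|(j : nat)%:Z - (h n)%:Z| <= h n)%N by move: jN; rewrite /N; lia.
  rewrite -cos2sin2 -exprM mul2n /theta intrD mulrNz -!pmulrn.
  by congr (cos (pi * _ / _) ^+ _); ring.
- by rewrite map_inj_uniq ?iota_uniq// => x y; lia.
- move=> j na; rewrite ifF//; apply/negP => jh; move/negP: na; apply.
  by apply/mapP; exists `|(j + (h n)%:Z)%R|%N; [rewrite mem_iota /N|]; lia.
Qed.

Let A_dom n (j : int) :
  `|if (`|j| <= h n)%N then (1 - sin (theta n j) ^+ 2) ^+ m n else 0| <=
  expR (- (pi ^+ 2 / (18 * c) * (j%:~R + z) ^+ 2)).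
Proof.
case: ifPn => [jh|_]; last by rewrite normr0 expR_ge0.
have x1 : 0 <= 1 - sin (theta n j) ^+ 2 by rewrite -cos2sin2 sqr_ge0.
rewrite ger0_norm ?exprn_ge0//.
apply: (@le_trans _ _ (expR (- sin (theta n j) ^+ 2) ^+ m n)).
  by rewrite lerXn2r ?nnegrE ?expR_ge0// expR_ge1Dx.
rewrite -expRM_natl ler_expR mulrN lerN2.
have t2 : `|theta n j| <= 2.
  have [_ p2] := andP (@pihalf_02 R).
  apply: le_trans (ltW p2); rewrite /theta normrM normfV (gtr0_norm (N0 n)).
  rewrite ler_pdivrMr// normrM (gtr0_norm (@pi_gt0 R)).
  have : `|j%:~R + z| <= (h n)%:R + 1 / 2.
    apply: le_trans (ler_normD _ _) _; apply: lerD => //.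
    by rewrite -intr_norm -natr_absz ler_nat.
  have -> : (N n)%:R = 2 * (h n)%:R + 1 :> R by rewrite /N -natr1 -muln2 natrM mulrC.
  by have := @pi_gt0 R; nra.
have s9 : theta n j ^+ 2 / 9 <= sin (theta n j) ^+ 2.
  have : sin `|theta n j| ^+ 2 = sin (theta n j) ^+ 2.
    by have [?|?] := leP 0 (theta n j); [rewrite ger0_norm|rewrite ltr0_norm// sinN sqrrN].
  move=> <-; rewrite -[theta n j ^+ 2]real_normK ?num_real//.
  have y0 := normr_ge0 (theta n j); move: t2 y0; set y := `|_| => y2 y0.
  have [h1 _ _ _] := trig_taylor y0.
  have h3 : y / 3 <= sin y.
    have : y ^+ 3 / 6 <= y * (2 / 3) by rewrite exprS; nra.
    lra.
  have -> : y ^+ 2 / 9 = (y / 3) ^+ 2 by field.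
  by rewrite ler_sqr ?nnegrE//; lra.
apply: (@le_trans _ _ ((m n)%:R * (theta n j ^+ 2 / 9))); last by rewrite ler_wpM2l.
rewrite /theta; set y := j%:~R + z.
have -> : (m n)%:R * ((pi * y / (N n)%:R) ^+ 2 / 9) =
  ((m n)%:R / ((N n)%:R ^+ 2)) * ((pi * y) ^+ 2 / 9) by field; rewrite gt_eqF.
have -> : pi ^+ 2 / (18 * c) * y ^+ 2 = (c^-1 / 2) * ((pi * y) ^+ 2 / 9).
  by field; rewrite gt_eqF.
rewrite ler_wpM2r ?divr_ge0 ?sqr_ge0// ler_pdivlMr ?exprn_gt0//.
by have := m_half n; rewrite -[_ / c / 2]mulrA mulrC.
Qed.

Let cvg_A_term (j : int) :
  (if (`|j| <= h n)%N then (1 - sin (theta n j) ^+ 2) ^+ m n else 0) @[n --> \oo] -->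
  expR (- (pi ^+ 2 / c * (j%:~R + z) ^+ 2)).
Proof.
set y := j%:~R + z.
have th0 : theta n j @[n --> \oo] --> (0 : R).
  have -> : (0 : R) = pi * y * 0 by rewrite mulr0.
  by apply: cvgM; [exact: cvg_cst|exact: cvg_invN].
have mth : (m n)%:R * theta n j ^+ 2 @[n --> \oo] --> pi ^+ 2 / c * y ^+ 2.
  have -> : (fun n => (m n)%:R * theta n j ^+ 2) =
    (fun n => ((m n)%:R / (N n)%:R ^+ 2) * (pi * y) ^+ 2).
    by apply/funext => n; rewrite /theta -/y; field; rewrite gt_eqF.
  have -> : pi ^+ 2 / c * y ^+ 2 = c^-1 * (pi * y) ^+ 2 by field; rewrite gt_eqF.
  by apply: cvgM; [exact: cvg_mu|exact: cvg_cst].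
have th2 : theta n j ^+ 2 @[n --> \oo] --> (0 : R).
  have h2 : theta n j * theta n j @[n --> \oo] --> (0 : R) * 0 by exact: cvgM.
  by move: h2; rewrite mulr0.
have H : (1 - sin (theta n j) ^+ 2) ^+ m n @[n --> \oo] --> expR (- (pi ^+ 2 / c * y ^+ 2)).
  apply: cvg_compound.
  - move=> n; rewrite sqr_ge0/= sin2cos2; have := sqr_ge0 (cos (theta n j)); lra.
  - apply: (@squeeze_cvgr _ _ _ _ (fun=> 0) (fun n => theta n j ^+ 2)) => //.
      near=> n; rewrite sqr_ge0 /=; have /andP[] // := sin2_bounds (theta n j).
    exact: cvg_cst.
  - apply: (@squeeze_cvgr _ _ _ _
      (fun n => (m n)%:R * theta n j ^+ 2 * (1 - theta n j ^+ 2 * 3^-1))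
      (fun n => (m n)%:R * theta n j ^+ 2)) => //.
      near=> n; have /andP[h1 h2] := sin2_bounds (theta n j).
      rewrite -mulrA; apply/andP; split; apply: ler_wpM2l => //.
      by apply: le_trans h1; rewrite le_eqVlt; apply/orP; left; apply/eqP; field.
    have -> : pi ^+ 2 / c * y ^+ 2 = pi ^+ 2 / c * y ^+ 2 * (1 - 0 * 3^-1).
      by rewrite mul0r subr0 mulr1.
    apply: cvgM => //; apply: cvgB; first exact: cvg_cst.
    by apply: cvgM => //; exact: cvg_cst.
apply: cvg_trans H; apply: near_eq_cvg; near=> n.
rewrite ifT//; apply: (@leq_trans n); last by rewrite /h leq_addl.
by near: n; exists `|j|%N.
Unshelve. all: by end_near.
Qed.

Let cvg_A : A n @[n --> \oo] --> theta_gauss (pi ^+ 2 / c) z.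
Proof.
under eq_fun do rewrite A_hsum.
apply: (dominated_hsum_cvg _ A_dom cvg_A_term).
by apply: gauss_summable; rewrite divr_gt0 ?exprn_gt0 ?pi_gt0 ?mulr_gt0.
Qed.

Lemma phase_limit : exists2 Gn : nat -> R, Gn n @[n --> \oo] --> theta_cos c z &
  K n * Gn n @[n --> \oo] --> theta_gauss (pi ^+ 2 / c) z.
Proof.
exists G; first exact: cvg_G.
by under eq_fun do rewrite -polya_identity; exact: cvg_A.
Qed.

End Phase.

Lemma polya_limit : exists Kn : nat -> R, forall z, `|z| <= 1 / 2 ->
  exists2 Gn : nat -> R, Gn n @[n --> \oo] --> theta_cos c z &
  Kn n * Gn n @[n --> \oo] --> theta_gauss (pi ^+ 2 / c) z.
Proof. by exists K => z z12; exact: phase_limit. Qed.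

End Polya.

(** Poisson summation for the Gaussian, up to the value of the constant: the
  normalisations of the two sides of the finite identity are eliminated by
  comparing with the phase 0. *)
Lemma theta_poisson (c : R) : 0 < c -> exists2 C : R, 0 < C &
  forall z, theta_cos c z = C * theta_gauss (pi ^+ 2 / c) z.
Proof.
move=> c0; have [K H] := polya_limit c0.
have d0 : 0 < pi ^+ 2 / c by rewrite divr_gt0 ?exprn_gt0 ?pi_gt0.
have S0 := theta_cos0_ge1 c0.
have S1 : theta_cos c 0 != 0 by rewrite gt_eqF//; lra.
have [|G0 G0S G0P] := H 0; first by rewrite normr0; lra.
have P0 : 0 < theta_gauss (pi ^+ 2 / c) 0.
  have := @hsum_ge_finite R _ _ [:: 0] isT (gauss_summable 0 d0).
  rewrite big_seq1 addr0 expr0n /= mulr0 oppr0 expR0 => h.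
  by apply: (lt_le_trans ltr01); apply: h => u _; exact: expR_ge0.
have KP : K n @[n --> \oo] --> theta_gauss (pi ^+ 2 / c) 0 / theta_cos c 0.
  have h : K n * G0 n / G0 n @[n --> \oo] --> theta_gauss (pi ^+ 2 / c) 0 / theta_cos c 0.
    by apply: cvgM => //; exact: cvgV.
  apply: cvg_trans h; apply: near_eq_cvg; near=> n.
  rewrite mulfK// gt_eqF//; near: n.
  by apply: (cvgr_gt _ G0S); lra.
exists (theta_cos c 0 / theta_gauss (pi ^+ 2 / c) 0); first by rewrite divr_gt0//; lra.
move=> z.
have [z' z'12 [n zE]] : exists2 z', `|z'| <= 1 / 2 & exists n : int, z = z' + n%:~R :> R.
  exists (z - (Num.floor (z + 1 / 2))%:~R); last by exists (Num.floor (z + 1 / 2)); ring.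
  have := floor_itv (z + 1 / 2); rewrite intrD => /andP[h1 h2].
  by rewrite ler_norml; apply/andP; split; lra.
rewrite zE theta_cos_shift theta_gauss_shift//.
have [G GS GP] := H z' z'12.
have h : K n * G n @[n --> \oo] --> theta_gauss (pi ^+ 2 / c) 0 / theta_cos c 0 * theta_cos c z'.
  by exact: cvgM.
have := cvg_unique _ GP h; move=> ->//; field.
by rewrite S1 gt_eqF.
Unshelve. all: by end_near.
Qed.

End Poisson.

(** * Poisson summation for the Gaussian on the hexagonal lattice *)
Section HexPoisson.
Context {R : realType}.
Implicit Types x y z w : R.
Implicit Types (u : int * int).

Definition habs u : R := `|u.1%:~R| + `|u.2%:~R|.

Lemma habs_ge0 u : 0 <= habs u. Proof. by rewrite addr_ge0. Qed.

Lemma gauss_lin_bound (kappa L z : R) (j : int) : 0 < kappa -> 0 <= L ->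
  expR (L * `|j%:~R|) * expR (- (kappa * (j%:~R + z) ^+ 2)) <=
  expR ((L + 1) ^+ 2 / (4 * kappa) + (L + 1) * `|z|) * expR (-1) ^+ `|j|%N.
Proof.
move=> k0 L0.
rewrite -expRM_natl -!expRD ler_expR mulrN1 natr_absz intr_norm.
have h : `|j%:~R| <= `|j%:~R + z| + `|z| :> R.
  by have := ler_normB (j%:~R + z) z; rewrite addrK.
suff : (L + 1) * `|j%:~R + z| <= kappa * (j%:~R + z) ^+ 2 + (L + 1) ^+ 2 / (4 * kappa).
  have := ler_wpM2l (addr_ge0 L0 ler01) h; lra.
rewrite -[(j%:~R + z) ^+ 2]real_normK ?num_real//; set t := `|_|.
rewrite -subr_ge0.
have -> : kappa * t ^+ 2 + (L + 1) ^+ 2 / (4 * kappa) - (L + 1) * t =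
  kappa * (t - (L + 1) / (2 * kappa)) ^+ 2.
  by field; rewrite gt_eqF.
by rewrite mulr_ge0 ?sqr_ge0// ltW.
Qed.

Lemma gauss2_bound (kappa L z w : R) u : 0 < kappa -> 0 <= L ->
  expR (L * habs u) * expR (- (kappa * ((u.1%:~R + z) ^+ 2 + (u.2%:~R + w) ^+ 2))) <=
  (expR ((L + 1) ^+ 2 / (4 * kappa) + (L + 1) * `|z|) *
   expR ((L + 1) ^+ 2 / (4 * kappa) + (L + 1) * `|w|)) *
  (expR (-1) ^+ `|u.1|%N * expR (-1) ^+ `|u.2|%N).
Proof.
move=> k0 L0; rewrite /habs mulrDr expRD mulrDr opprD expRD [leLHS]mulrACA [leRHS]mulrACA.
by apply: ler_pM; rewrite ?mulr_ge0 ?expR_ge0//; exact: gauss_lin_bound.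
Qed.

Lemma gauss2_summable (C kappa L z w : R) (f : int * int -> R) : 0 < kappa -> 0 <= L ->
  (forall u, `|f u| <= C * (expR (L * habs u) *
     expR (- (kappa * ((u.1%:~R + z) ^+ 2 + (u.2%:~R + w) ^+ 2))))) -> abs_summable f.
Proof.
move=> k0 L0 fC; apply: (dominated_summable fC); apply: abs_summableZ.
apply: (@geom2_summable R _ _ _ expN1_itv) => u.
by rewrite ger0_norm ?mulr_ge0 ?expR_ge0//; exact: gauss2_bound.
Qed.

(** The indicator of [u.1 + u.2] even, in the form of an average of two
  characters: this is what makes the sum over the sublattice a combination of
  two sums over the full lattice, one of them with shifted phases. *)
Definition par u : R := (1 + (-1) ^+ `|(u.1 + u.2)%R|%N) / 2.

Lemma parE u : par u = (~~ odd `|(u.1 + u.2)%R|%N)%:R.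
Proof. by rewrite /par -signr_odd; case: odd; rewrite /= ?expr1 ?expr0 ?subrr ?mul0r//; field. Qed.

Lemma par01 u : 0 <= par u <= 1.
Proof. by rewrite parE; case: odd; rewrite /= !(lexx, ler01). Qed.

Lemma norm_par_le u x : `|par u * x| <= `|x|.
Proof.
have /andP[p0 p1] := par01 u.
by rewrite normrM ger0_norm// ler_piMl.
Qed.

Lemma cosD_pi_int x (n : int) : cos (x + pi * n%:~R) = (-1) ^+ `|n|%N * cos x.
Proof.
case: n => n.
  by rewrite -(alternatingn (@cosDpi R)) /= -mulr_natr.
rewrite -[X in _ * cos X](subrK (pi * (n.+1)%:R)) mulr_natr (alternatingn (@cosDpi R)) /=.
by rewrite mulrA -exprD addnn -mul2n exprM sqrrN !expr1n mul1r -mulr_natr NegzE mulrNz mulrN.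
Qed.

(** With [a + b] even, [(a, sqrt 3 b)] runs over a hexagonal lattice, and the
  exponent is the squared norm. *)
Definition hgauss (la : R) u : R := expR (- (la * (u.1%:~R ^+ 2 + 3 * u.2%:~R ^+ 2))).

Lemma hgaussE la u : hgauss la u = expR (- (la * u.1%:~R ^+ 2)) * expR (- (3 * la * u.2%:~R ^+ 2)).
Proof. by rewrite /hgauss -expRD; congr expR; ring. Qed.

Lemma hgauss_le la u : 0 < la ->
  hgauss la u <= expR (- (la * ((u.1%:~R + 0) ^+ 2 + (u.2%:~R + 0) ^+ 2))).
Proof.
move=> la0; rewrite ler_expR lerN2 !addr0 ler_pM2l// lerD2l.
by have := sqr_ge0 (u.2%:~R : R); lra.
Qed.

(** Completing the square leaves a geometric bound, whatever the exponential
  growth of [f]. *)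
Lemma hgauss_summable (C L la : R) (f : int * int -> R) : 0 < la -> 0 <= L ->
  (forall u, `|f u| <= C * expR (L * habs u)) ->
  abs_summable (fun u => f u * hgauss la u).
Proof.
move=> la0 L0 fC; apply: (@gauss2_summable C la L 0 0) => // u.
rewrite normrM [X in _ * X]ger0_norm ?expR_ge0// mulrA.
by apply: ler_pM => //; [exact: expR_ge0|exact: hgauss_le].
Qed.

Definition angle z w u : R := 2 * pi * (u.1%:~R * z + u.2%:~R * w).

Lemma theta_sin_eq0 (c z : R) : 0 < c ->
  abs_summable (fun n : int => expR (- (c * n%:~R ^+ 2)) * sin (2 * pi * n%:~R * z)) /\
  hsum (fun n : int => expR (- (c * n%:~R ^+ 2)) * sin (2 * pi * n%:~R * z)) = 0.
Proof.
move=> c0; set f := fun n : int => _.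
have Sf : abs_summable f.
  apply: dominated_summable (gauss_summable 0 c0) => n.
  by rewrite addr0 /f normrM ger0_norm ?expR_ge0// ler_piMr ?expR_ge0 ?sin_max.
split=> //; have [_] := @hsum_reindex R _ _ (fun n : int => - n) (fun n => - n) f
  (@opprK _) (@opprK _) Sf.
have -> : f \o (fun n : int => - n) = (fun n => -1 * f n).
  apply/funext => n; rewrite /f /= mulrNz sqrrN.
  have -> : 2 * pi * - n%:~R * z = - (2 * pi * n%:~R * z) by ring.
  by rewrite sinN mulrN mulN1r.
rewrite hsumZ//; lra.
Qed.

Lemma full_cos_sum (la z w : R) : 0 < la ->
  hsum (fun u => hgauss la u * cos (angle z w u)) = theta_cos la z * theta_cos (3 * la) w.
Proof.
move=> la0; have la3 : 0 < 3 * la by rewrite mulr_gt0.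
have [Sc Ec] := hsum_prod (theta_cos_summable z la0) (theta_cos_summable w la3).
have [Ss1 Es1] := theta_sin_eq0 z la0; have [Ss2 _] := theta_sin_eq0 w la3.
have [Ss Es] := hsum_prod Ss1 Ss2.
rewrite /theta_cos -Ec -[RHS]subr0.
have -> : (0 : R) = hsum (fun u : int * int =>
   expR (- (la * u.1%:~R ^+ 2)) * sin (2 * pi * u.1%:~R * z) *
   (expR (- (3 * la * u.2%:~R ^+ 2)) * sin (2 * pi * u.2%:~R * w))).
  by rewrite Es Es1 mul0r.
rewrite -hsumB//; congr hsum; apply/funext => u.
have -> : angle z w u = 2 * pi * u.1%:~R * z + 2 * pi * u.2%:~R * w by rewrite /angle; ring.
by rewrite cosD hgaussE; ring.
Qed.

Lemma hexp_summable (la : R) (f : int * int -> R) : 0 < la ->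
  (forall u, `|f u| <= 1) -> abs_summable (fun u => f u * hgauss la u).
Proof.
move=> la0 f1; apply: (@hgauss_summable 1 0) => // u.
by rewrite mul0r expR0 mulr1.
Qed.

Lemma par_cos_sum (la z w : R) : 0 < la ->
  hsum (fun u => par u * hgauss la u * cos (angle z w u)) =
  (theta_cos la z * theta_cos (3 * la) w +
   theta_cos la (z + 1 / 2) * theta_cos (3 * la) (w + 1 / 2)) / 2.
Proof.
move=> la0.
have Sm z' w' : abs_summable (fun u => hgauss la u * cos (angle z' w' u)).
  have := @hexp_summable la (fun u => cos (angle z' w' u)) la0 (fun u => cos_max _).
  by congr abs_summable; apply/funext => u; rewrite mulrC.
rewrite -!full_cos_sum// mulrC -hsumD// -hsumZ; last exact: abs_summableD.
congr hsum; apply/funext => u.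
have -> : angle (z + 1 / 2) (w + 1 / 2) u = angle z w u + pi * (u.1 + u.2)%:~R.
  by rewrite /angle intrD; field.
by rewrite cosD_pi_int /par; field.
Qed.

Definition dualX z u : R := z + u.1%:~R / 2.
Definition dualY w u : R := w + u.2%:~R / 2.

Definition dgauss (B z w : R) u : R := expR (- (B * (3 * dualX z u ^+ 2 + dualY w u ^+ 2))).

Lemma dgauss_le B z w u : 0 < B ->
  dgauss B z w u <= expR (- (B / 4 * ((u.1%:~R + 2 * z) ^+ 2 + (u.2%:~R + 2 * w) ^+ 2))).
Proof.
move=> B0; rewrite ler_expR lerN2 /dualX /dualY.
have -> : (u.1%:~R + 2 * z) ^+ 2 = 4 * (z + u.1%:~R / 2) ^+ 2 by field.
have -> : (u.2%:~R + 2 * w) ^+ 2 = 4 * (w + u.2%:~R / 2) ^+ 2 by field.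
have := sqr_ge0 (z + u.1%:~R / 2); set X := _ ^+ 2 => X0.
have := sqr_ge0 (w + u.2%:~R / 2); set Y := _ ^+ 2 => Y0.
by have := mulr_ge0 (ltW B0) X0; lra.
Qed.

Lemma dgauss_summable (C L B z w : R) (f : int * int -> R) : 0 < B -> 0 <= L ->
  (forall u, `|f u| <= C * expR (L * habs u)) ->
  abs_summable (fun u => f u * dgauss B z w u).
Proof.
move=> B0 L0 fC; apply: (@gauss2_summable C (B / 4) L (2 * z) (2 * w)) => //.
  by rewrite divr_gt0.
move=> u; rewrite normrM [X in _ * X]ger0_norm ?expR_ge0// mulrA.
by apply: ler_pM => //; [exact: expR_ge0|exact: dgauss_le].
Qed.

Lemma full_dual_sum (B z w : R) : 0 < B ->
  theta_gauss (3 * B) z * theta_gauss B w =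
  hsum (fun u => dgauss B z w (2 * u.1, 2 * u.2)).
Proof.
move=> B0; have B3 : 0 < 3 * B by rewrite mulr_gt0.
have [_ <-] := hsum_prod (gauss_summable z B3) (gauss_summable w B0).
congr hsum; apply/funext => u; rewrite -expRD /dgauss /dualX /dualY /= !intrM; congr expR.
by field.
Qed.

(** The even sublattice is the union of the pairs of even and of the pairs of
  odd integers. *)
Lemma par_dual_sum (B z w : R) : 0 < B ->
  hsum (fun u => par u * dgauss B z w u) =
  theta_gauss (3 * B) z * theta_gauss B w +
  theta_gauss (3 * B) (z + 1 / 2) * theta_gauss B (w + 1 / 2).
Proof.
move=> B0; rewrite !full_dual_sum//.
set f := fun u => _.
have Sf : abs_summable f.
  apply: (@dgauss_summable 1 0) => // u.
  by have /andP[p0 p1] := par01 u; rewrite ger0_norm// mul0r expR0 mulr1.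
have d2 (a : int) : ((2 * a) %/ 2)%Z = a by rewrite mulrC mulzK.
have d3 (a : int) : ((2 * a + 1) %/ 2)%Z = a by rewrite mulrC divzMDl// divz_small ?addr0.
have [||||S1 S2 ->] := @hsum_split R _ _ (fun u => (2 * u.1, u.2)) (fun u => (2 * u.1 + 1, u.2))
   (fun u => ((u.1 %/ 2)%Z, u.2)) f _ _ _ _ Sf.
- by move=> [a b] /=; rewrite d2.
- by move=> [a b] /=; rewrite d3.
- by move=> [a b] [a' b'] /=; apply/eqP => -[]; lia.
- move=> [a b] /=; have h1 := divz_eq a 2; have h2 := modz_ge0 a (isT : 2 != 0 :> int).
  have h3 := ltz_pmod a (isT : 0 < 2 :> int).
  have [e|e] : (a %% 2)%Z = 0 \/ (a %% 2)%Z = 1 by lia.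
    by left; congr (_, _); lia.
  by right; congr (_, _); lia.
have pe (a b : int) : par (2 * a, 2 * b) = 1.
  by rewrite parE /= -mulrDr abszM oddM.
have po (a b : int) : par (2 * a + 1, 2 * b + 1) = 1.
  rewrite parE /=; have -> : 2 * a + 1 + (2 * b + 1) = 2 * (a + b + 1) :> int by ring.
  by rewrite abszM oddM.

congr (_ + _).
- have [||_ ->] := @hsum_inj R _ _ (fun u => (u.1, 2 * u.2)) (fun u => (u.1, (u.2 %/ 2)%Z)) _ _ _ S1.
  + by move=> [a b] /=; rewrite d2.
  + move=> [a b] /= H; rewrite /f /= parE /=.
    have -> : odd `|(2 * a + b)%R|%N.
      have hb : (2 * (b %/ 2)%Z)%R != b by apply: contra H => /eqP ->.
      by have := divz_eq b 2; have := modz_ge0 b (isT : 2 != 0 :> int);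
         have := ltz_pmod b (isT : 0 < 2 :> int); move/eqP: hb; lia.
    by rewrite mul0r.
  + by congr hsum; apply/funext => u; rewrite /f /= pe mul1r.
- have [||_ ->] := @hsum_inj R _ _ (fun u => (u.1, 2 * u.2 + 1)) (fun u => (u.1, (u.2 %/ 2)%Z)) _ _ _ S2.
  + by move=> [a b] /=; rewrite d3.
  + move=> [a b] /= H; rewrite /f /= parE /=.
    have -> : odd `|(2 * a + 1 + b)%R|%N.
      have hb : (2 * (b %/ 2)%Z + 1)%R != b by apply: contra H => /eqP ->.
      by have := divz_eq b 2; have := modz_ge0 b (isT : 2 != 0 :> int);
         have := ltz_pmod b (isT : 0 < 2 :> int); move/eqP: hb; lia.
    by rewrite mul0r.
  + congr hsum; apply/funext => u; rewrite /f /= po mul1r /dgauss /dualX /dualY /= !intrD !intrM.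
    by congr expR; field.
Qed.

(** Both sides are products of one-dimensional sums, up to the parity
  condition, which is the half shift in the phases on one side and the union
  of two cosets on the other. *)
Lemma hex_poisson (la : R) : 0 < la -> exists2 C : R, 0 < C & forall z w,
  hsum (fun u => par u * hgauss la u * cos (angle z w u)) =
  C * hsum (fun u => par u * dgauss (pi ^+ 2 / (3 * la)) z w u).
Proof.
move=> la0; have la3 : 0 < 3 * la by rewrite mulr_gt0.
have [C1 C10 H1] := theta_poisson la0; have [C3 C30 H3] := theta_poisson la3.
exists (C1 * C3 / 2); first by rewrite divr_gt0 ?mulr_gt0.
move=> z w; rewrite par_cos_sum// par_dual_sum ?divr_gt0 ?exprn_gt0 ?pi_gt0//.
rewrite !H1 !H3.
have -> : 3 * (pi ^+ 2 / (3 * la)) = pi ^+ 2 / la by field; rewrite gt_eqF.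
by field.
Qed.

End HexPoisson.

(** * The symbol of the Hessian and its dual form *)
Section SecondDifference.
Context {R : realType}.
Implicit Types x y z w : R.
Implicit Types (u : int * int).

Lemma habs_sqr_le u : habs u ^+ 2 <= 2 * expR (1 * habs u) :> R.
Proof.
by rewrite mul1r; have [+ _ _] := expR_taylor_pos (@habs_ge0 R u); have := @habs_ge0 R u; lra.
Qed.

Lemma lin_le_habs (x y : R) u : `|u.1%:~R * x + u.2%:~R * y| <= (`|x| + `|y|) * habs u.
Proof.
apply: le_trans (ler_normD _ _) _; rewrite !normrM /habs.
have := normr_ge0 x; have := normr_ge0 y.
have := normr_ge0 (u.1%:~R : R); have := normr_ge0 (u.2%:~R : R); nra.
Qed.

Lemma cvg_harm : @harmonic R n @[n --> \oo] --> (0 : R).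
Proof. exact: cvg_harmonic. Qed.

Lemma harm_gt0 n : 0 < @harmonic R n. Proof. by rewrite invr_gt0. Qed.

Lemma harm_le1 n : @harmonic R n <= 1.
Proof. by rewrite /harmonic /= invf_le1// ler1n. Qed.

Section CosineSide.
Variables (la z w e1 e2 : R).
Hypothesis la0 : 0 < la.

Definition speed e1 e2 u : R := 2 * pi * (u.1%:~R * e1 + u.2%:~R * e2).

Lemma speed_sqr_le u : speed e1 e2 u ^+ 2 <=
  8 * pi ^+ 2 * (`|e1| + `|e2|) ^+ 2 * expR (1 * habs u).
Proof.
rewrite -[speed _ _ _ ^+ 2]real_normK ?num_real// /speed normrM exprMn.
have h := lin_le_habs e1 e2 u.
have h2 : `|u.1%:~R * e1 + u.2%:~R * e2| ^+ 2 <= (`|e1| + `|e2|) ^+ 2 * (2 * expR (1 * habs u)).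
  apply: (@le_trans _ _ (((`|e1| + `|e2|) * habs u) ^+ 2)).
    by rewrite ler_sqr ?nnegrE ?mulr_ge0 ?addr_ge0.
  by rewrite exprMn ler_wpM2l ?sqr_ge0// habs_sqr_le.
have p0 := @pi_ge0 R; rewrite ger0_norm ?mulr_ge0//.
have := ler_wpM2l (sqr_ge0 (2 * pi : R)) h2; lra.
Qed.

Lemma speed_summable (f : int * int -> R) : (forall u, `|f u| <= 1) ->
  abs_summable (fun u => speed e1 e2 u ^+ 2 * f u * hgauss la u).
Proof.
move=> f1; apply: (@hgauss_summable R (8 * pi ^+ 2 * (`|e1| + `|e2|) ^+ 2) 1) => // u.
rewrite normrM ger0_norm ?sqr_ge0//; apply: le_trans (speed_sqr_le u).
by rewrite ler_piMr ?sqr_ge0.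
Qed.

Lemma cos_second_quotient p (s : R) : 0 < s ->
  - p ^+ 2 <= (2 * cos (s * p) - 2) / s ^+ 2 <= - p ^+ 2 + s ^+ 2 * (p ^+ 4 / 12).
Proof.
move=> s0.
have := cos_taylor2 (s * p); rewrite ler_norml => /andP[h1 h2].
have q0 : 0 <= 2 * cos (s * p) - 2 + (s * p) ^+ 2.
  have := cos_taylor2 (s * p).
  have [y0|y0] := leP 0 (s * p).
    by have [_ h _ _] := trig_taylor y0; lra.
  have [|_ h _ _] := @trig_taylor R (- (s * p)); first lra.
  by rewrite cosN sqrrN in h; lra.
have s2 : 0 < s ^+ 2 by rewrite exprn_gt0.
rewrite ler_pdivlMr// ler_pdivrMr//; apply/andP; split.
  by rewrite exprMn in q0; lra.
have -> : (- p ^+ 2 + s ^+ 2 * (p ^+ 4 / 12)) * s ^+ 2 = - (s * p) ^+ 2 + (s * p) ^+ 4 / 12 by field.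
lra.
Qed.

Let U z' w' := hsum (fun u => par u * hgauss la u * cos (angle z' w' u)).

Lemma par_hcos_summable z' w' :
  abs_summable (fun u => par u * hgauss la u * cos (angle z' w' u)).
Proof.
have := @hexp_summable R la (fun u => par u * cos (angle z' w' u)) la0.
have H u : `|par u * cos (angle z' w' u)| <= 1 :> R.
  by apply: le_trans (norm_par_le _ _) _; exact: cos_max.
by move=> /(_ H); congr abs_summable; apply/funext => u; rewrite mulrAC.
Qed.

(** Differentiating twice in the phase through second difference quotients:
  only the limit along [1 / (n + 1)] is needed, and each quotient is dominated
  termwise. *)
Lemma cos_second_difference :
  (U (z + @harmonic R n * e1) (w + @harmonic R n * e2) +
   U (z - @harmonic R n * e1) (w - @harmonic R n * e2) - 2 * U z w) / @harmonic R n ^+ 2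
   @[n --> \oo] -->
  - hsum (fun u => speed e1 e2 u ^+ 2 * (par u * cos (angle z w u)) * hgauss la u).
Proof.
pose F n u := (par u * cos (angle z w u)) *
  ((2 * cos (@harmonic R n * speed e1 e2 u) - 2) / @harmonic R n ^+ 2) * hgauss la u.
have pc u : `|par u * cos (angle z w u)| <= 1 :> R.
  by apply: le_trans (norm_par_le _ _) _; exact: cos_max.
have -> : (fun n => (U (z + @harmonic R n * e1) (w + @harmonic R n * e2) +
   U (z - @harmonic R n * e1) (w - @harmonic R n * e2) - 2 * U z w) / @harmonic R n ^+ 2) =
   (fun n => hsum (F n)).
  apply/funext => n; set s := harmonic n; rewrite /U.
  rewrite -hsumD; [|exact: par_hcos_summable..].
  rewrite -hsumZ; last exact: par_hcos_summable.
  rewrite -hsumB; last 2 first.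
  - by apply: abs_summableD; exact: par_hcos_summable.
  - by apply: abs_summableZ; exact: par_hcos_summable.
  rewrite mulrC -hsumZ; last first.
    apply: abs_summableB; last by apply: abs_summableZ; exact: par_hcos_summable.
    by apply: abs_summableD; exact: par_hcos_summable.
  congr hsum; apply/funext => u; rewrite /F.
  have -> : angle (z + s * e1) (w + s * e2) u = angle z w u + s * speed e1 e2 u.
    by rewrite /angle /speed; ring.
  have -> : angle (z - s * e1) (w - s * e2) u = angle z w u - s * speed e1 e2 u.
    by rewrite /angle /speed; ring.
  by rewrite cosB cosD -/s; ring.
have -> : - hsum (fun u => speed e1 e2 u ^+ 2 * (par u * cos (angle z w u)) * hgauss la u) =
  hsum (fun u => (par u * cos (angle z w u)) * (- speed e1 e2 u ^+ 2) * hgauss la u).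
  rewrite -mulN1r -hsumZ; last exact: speed_summable.
  by congr hsum; apply/funext => u; ring.
apply: (@dominated_hsum_cvg _ _ _ _ (fun u => speed e1 e2 u ^+ 2 * 1 * hgauss la u)).
- by apply: speed_summable => u; rewrite normr1.
- move=> n u; rewrite /F normrM [X in _ * X]ger0_norm ?expR_ge0//.
  apply: ler_wpM2r; first exact: expR_ge0.
  rewrite normrM mulrC; apply: ler_pM => //.
  have /andP[h1 h2] := cos_second_quotient (speed e1 e2 u) (harm_gt0 n).
  rewrite ler_norml h1 /=; apply: (@le_trans _ _ 0); last exact: sqr_ge0.
  apply: mulr_le0_ge0; last by rewrite invr_ge0 sqr_ge0.
  by have := cos_le1 (n.+1%:R^-1 * speed e1 e2 u); lra.
- move=> u; apply: cvgM; last exact: cvg_cst.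
  apply: cvgM; first exact: cvg_cst.
  set p := speed e1 e2 u.
  apply: (@squeeze_cvgr _ _ _ _ (fun=> - p ^+ 2)
    (fun n => - p ^+ 2 + @harmonic R n * @harmonic R n * (p ^+ 4 / 12))).
  + near=> n.
    by apply: cos_second_quotient; exact: harm_gt0.
  + exact: cvg_cst.
  + have H : - p ^+ 2 + @harmonic R n * @harmonic R n * (p ^+ 4 / 12) @[n --> \oo] -->
      - p ^+ 2 + 0 * 0 * (p ^+ 4 / 12).
      apply: cvgD; first exact: cvg_cst.
      apply: cvgM; last exact: cvg_cst.
      by apply: cvgM; exact: cvg_harm.
    by move: H; rewrite !mul0r addr0.
Unshelve. all: by end_near.
Qed.

End CosineSide.

Section GaussSide.
Variables (B z w e1 e2 : R).
Hypothesis B0 : 0 < B.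

Definition dslope u : R := 2 * B * (3 * dualX z u * e1 + dualY w u * e2).
Definition dcurv : R := B * (3 * e1 ^+ 2 + e2 ^+ 2).

Lemma dcurv_ge0 : 0 <= dcurv.
Proof.
apply: mulr_ge0; first exact: ltW.
by apply: addr_ge0; [apply: mulr_ge0 => //|]; exact: sqr_ge0.
Qed.

(** The logarithm of the Gaussian is exactly quadratic in the displacement. *)
Lemma dgauss_shift (s : R) u : dgauss B (z + s * e1) (w + s * e2) u =
  dgauss B z w u * expR (- (s * dslope u) - s ^+ 2 * dcurv).
Proof. by rewrite /dgauss -expRD; congr expR; rewrite /dslope /dcurv /dualX /dualY; field. Qed.

Let M u := `|dslope u| + dcurv.

Lemma dslope_bound : exists c0 c1 : R, [/\ 0 <= c0, 0 <= c1 & forall u, M u <= c0 + c1 * habs u].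
Proof.
exists (2 * B * (3 * `|z| * `|e1| + `|w| * `|e2|) + dcurv),
  (2 * B * (3 * `|e1| + `|e2|)).
have B0' := ltW B0.
split.
- by apply: addr_ge0 dcurv_ge0; do ?[apply: mulr_ge0|apply: addr_ge0].
- by do ?[apply: mulr_ge0|apply: addr_ge0].
move=> u; rewrite /M addrAC lerD2r /dslope normrM ger0_norm ?mulr_ge0//.
rewrite -(mulrA (2 * B) _ (habs u)) -mulrDr; apply: ler_wpM2l; first by rewrite mulr_ge0.
apply: le_trans (ler_normD _ _) _; rewrite !normrM (@ger0_norm _ 3)//.
have hX : `|dualX z u| <= `|z| + `|u.1%:~R|.
  apply: le_trans (ler_normD _ _) _; rewrite lerD2l normrM normfV (@ger0_norm _ 2)//.
  by have := normr_ge0 (u.1%:~R : R); lra.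
have hY : `|dualY w u| <= `|w| + `|u.2%:~R|.
  apply: le_trans (ler_normD _ _) _; rewrite lerD2l normrM normfV (@ger0_norm _ 2)//.
  by have := normr_ge0 (u.2%:~R : R); lra.
have h1 := ler_wpM2r (normr_ge0 e1) hX; have h2 := ler_wpM2r (normr_ge0 e2) hY.
rewrite /habs; have := mulr_ge0 (normr_ge0 e1) (normr_ge0 (u.2%:~R : R)).
have := mulr_ge0 (normr_ge0 e2) (normr_ge0 (u.1%:~R : R)).
lra.
Qed.

Let Q (s : R) u := (expR (- (s * dslope u) - s ^+ 2 * dcurv) +
   expR (s * dslope u - s ^+ 2 * dcurv) - 2) / s ^+ 2.

(** The quadratic approximation of the exponential at both signs of [s]: the
  odd terms cancel. *)
Lemma exp_second_quotient (s : R) u : 0 < s <= 1 ->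
  `|Q s u - (dslope u ^+ 2 - 2 * dcurv)| <= s * (dcurv ^+ 2 + 2 * (M u ^+ 3 * expR (M u))).
Proof.
move=> /andP[s0 s1]; set b := dslope u; set g := dcurv; have g0 : 0 <= g := dcurv_ge0.
have M0 : 0 <= M u by rewrite addr_ge0.
pose rem E : R := expR E - (1 + E + E ^+ 2 / 2).
have remb E : `|E| <= s * M u -> `|rem E| <= s ^+ 3 * (M u ^+ 3 * expR (M u)).
  move=> EM; apply: le_trans (expR_taylor2_bound E) _.
  rewrite mulrA -exprMn; apply: ler_pM; rewrite ?exprn_ge0 ?expR_ge0//.
    by rewrite lerXn2r ?nnegrE ?mulr_ge0// ltW.
  by rewrite ler_expR (le_trans EM)// ler_piMl.
have s2g : s ^+ 2 * g <= s * g by rewrite ler_wpM2r// expr2 ler_piMr// ltW.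
have e1b : `|- (s * b) - s ^+ 2 * g| <= s * M u.
  apply: le_trans (ler_normB _ _) _; rewrite normrN (normrM s b) (normrM (s ^+ 2) g).
  by rewrite (gtr0_norm s0) (ger0_norm (sqr_ge0 s)) (ger0_norm g0) /M -/b -/g mulrDr lerD2l.
have e2b : `|s * b - s ^+ 2 * g| <= s * M u.
  apply: le_trans (ler_normB _ _) _; rewrite (normrM s b) (normrM (s ^+ 2) g).
  by rewrite (gtr0_norm s0) (ger0_norm (sqr_ge0 s)) (ger0_norm g0) /M -/b -/g mulrDr lerD2l.
have r1 := remb _ e1b; have r2 := remb _ e2b.
have -> : Q s u - (b ^+ 2 - 2 * g) = s ^+ 2 * g ^+ 2 +
   (rem (- (s * b) - s ^+ 2 * g) + rem (s * b - s ^+ 2 * g)) / s ^+ 2.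
  by rewrite /Q /rem -/b -/g; field; rewrite gt_eqF.
apply: le_trans (ler_normD _ _) _; rewrite mulrDr; apply: lerD.
  rewrite ger0_norm; last by apply: mulr_ge0; exact: sqr_ge0.
  by rewrite ler_wpM2r ?sqr_ge0// expr2 ler_piMr// ltW.
rewrite normrM normfV [X in _ / X]gtr0_norm ?exprn_gt0// ler_pdivrMr ?exprn_gt0//.
apply: le_trans (ler_normD _ _) _; apply: le_trans (lerD r1 r2) _.
by rewrite le_eqVlt; apply/orP; left; apply/eqP; ring.
Qed.

Let pow_le_exp (x : R) : 0 <= x -> [/\ x <= expR x, x ^+ 2 <= 2 * expR x & x ^+ 3 <= 6 * expR x].
Proof.
move=> x0; have [h1 h2 _] := expR_taylor_pos x0; have := expR_ge1Dx x.
have := sqr_ge0 x; have := exprn_ge0 3 x0; split; lra.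
Qed.

Lemma exp_second_dom (s : R) u : 0 < s <= 1 ->
  `|Q s u| <= 20 * expR (2 * M u) /\
  `|dslope u ^+ 2 - 2 * dcurv| <= 20 * expR (2 * M u).
Proof.
move=> s01; have /andP[s0 s1] := s01; have g0 := dcurv_ge0.
have M0 : 0 <= M u by rewrite addr_ge0.
have [m1 m2 m3] := pow_le_exp M0.
have E1 : 1 <= expR (M u) by have := expR_ge1Dx (M u); lra.
have EE : expR (2 * M u) = expR (M u) * expR (M u) by rewrite -expRD; congr expR; ring.
have gM : dcurv <= M u by rewrite lerDr.
have bM : dslope u ^+ 2 <= M u ^+ 2.
  by rewrite -[dslope u ^+ 2]real_normK ?num_real// ler_sqr ?nnegrE// lerDl.
have g2 : dcurv ^+ 2 <= M u ^+ 2 by rewrite ler_sqr ?nnegrE.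
have E2 : expR (M u) <= expR (2 * M u) by rewrite EE ler_peMr ?expR_ge0.
have h3 : M u ^+ 3 * expR (M u) <= 6 * expR (2 * M u).
  by rewrite EE mulrA ler_wpM2r ?expR_ge0.
have k : `|dslope u ^+ 2 - 2 * dcurv| <= M u ^+ 2 + 2 * M u.
  by have := sqr_ge0 (dslope u); rewrite ler_norml => ?; apply/andP; split; lra.
split; last lra.
have := exp_second_quotient u s01.
have T0 : 0 <= dcurv ^+ 2 + 2 * (M u ^+ 3 * expR (M u)).
  by rewrite addr_ge0 ?sqr_ge0 ?mulr_ge0 ?exprn_ge0 ?expR_ge0.
have T1 := ler_piMl T0 s1.
have := ler_normD (Q s u - (dslope u ^+ 2 - 2 * dcurv)) (dslope u ^+ 2 - 2 * dcurv).
rewrite subrK; lra.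
Qed.

Let V z' w' := hsum (fun u => par u * dgauss B z' w' u).

Lemma par_dgauss_summable z' w' : abs_summable (fun u => par u * dgauss B z' w' u).
Proof.
apply: (@dgauss_summable R 1 0) => // u.
by have /andP[p0 p1] := @par01 R u; rewrite ger0_norm// mul0r expR0 mulr1.
Qed.

Lemma gauss_second_difference :
  (V (z + @harmonic R n * e1) (w + @harmonic R n * e2) +
   V (z - @harmonic R n * e1) (w - @harmonic R n * e2) - 2 * V z w) / @harmonic R n ^+ 2
   @[n --> \oo] -->
  hsum (fun u => par u * (dslope u ^+ 2 - 2 * dcurv) * dgauss B z w u).
Proof.
have -> : (fun n => (V (z + @harmonic R n * e1) (w + @harmonic R n * e2) +
   V (z - @harmonic R n * e1) (w - @harmonic R n * e2) - 2 * V z w) / @harmonic R n ^+ 2) =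
   (fun n => hsum (fun u => par u * Q (@harmonic R n) u * dgauss B z w u)).
  apply/funext => n; set s := harmonic n; rewrite /V.
  rewrite -hsumD; [|exact: par_dgauss_summable..].
  rewrite -hsumZ; last exact: par_dgauss_summable.
  rewrite -hsumB; last 2 first.
  - by apply: abs_summableD; exact: par_dgauss_summable.
  - by apply: abs_summableZ; exact: par_dgauss_summable.
  rewrite mulrC -hsumZ; last first.
    apply: abs_summableB; last by apply: abs_summableZ; exact: par_dgauss_summable.
    by apply: abs_summableD; exact: par_dgauss_summable.
  congr hsum; apply/funext => u; rewrite dgauss_shift -!mulNr dgauss_shift /Q sqrrN !mulNr opprK.
  by ring.
have [c0 [c1 [c00 c10 Mb]]] := dslope_bound.
have dom (x : R) u : `|x| <= 20 * expR (2 * M u) ->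
  `|par u * x| <= (20 * expR (2 * c0)) * expR (2 * c1 * habs u).
  move=> hx; apply: le_trans (norm_par_le _ _) _; apply: le_trans hx _.
  rewrite -mulrA -expRD ler_pM2l// ler_expR; have := Mb u; lra.
apply: (@dominated_hsum_cvg _ _ _ _
  (fun u => (20 * expR (2 * c0)) * expR (2 * c1 * habs u) * dgauss B z w u)).
- apply: (@dgauss_summable R (20 * expR (2 * c0)) (2 * c1)) => //; first by rewrite mulr_ge0.
  by move=> u; rewrite ger0_norm// ?mulr_ge0 ?expR_ge0.
- move=> n u; rewrite normrM [X in _ * X]ger0_norm ?expR_ge0//.
  apply: ler_wpM2r; first exact: expR_ge0.
  by apply: dom; have [] := @exp_second_dom (harmonic n) u; rewrite ?harm_gt0 ?harm_le1.
- move=> u; apply: cvgM; last exact: cvg_cst.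
  apply: cvgM; first exact: cvg_cst.
  set l := _ - _; set T := dcurv ^+ 2 + 2 * (M u ^+ 3 * expR (M u)).
  have hT k : k * 0 = 0 :> R by rewrite mulr0.
  apply: (@squeeze_cvgr _ _ _ _ (fun n => l - @harmonic R n * T) (fun n => l + @harmonic R n * T)).
  + near=> n; have := @exp_second_quotient (harmonic n) u; rewrite harm_gt0 harm_le1.
    by move=> /(_ isT); rewrite -/l -/T ler_norml => /andP[h1 h2]; apply/andP; split; lra.
  + have H : l - @harmonic R n * T @[n --> \oo] --> l - 0 * T.
      apply: cvgB; first exact: cvg_cst.
      by apply: cvgM; [exact: cvg_harm|exact: cvg_cst].
    by move: H; rewrite mul0r subr0.
  + have H : l + @harmonic R n * T @[n --> \oo] --> l + 0 * T.
      apply: cvgD; first exact: cvg_cst.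
      by apply: cvgM; [exact: cvg_harm|exact: cvg_cst].
    by move: H; rewrite mul0r addr0.
Unshelve. all: by end_near.
Qed.

End GaussSide.
End SecondDifference.

Section DualSymbol.
Context {R : realType}.
Implicit Types z w : R.
Implicit Types (u : int * int).

Definition s3 : R := Num.sqrt 3.

Lemma s3_sqr : s3 ^+ 2 = 3. Proof. by rewrite sqr_sqrtr. Qed.

Lemma s3_gt0 : 0 < s3. Proof. by rewrite sqrtr_gt0. Qed.

Definition dirv (v1 v2 : R) u : R := u.1%:~R * v1 + s3 * u.2%:~R * v2.

(** Up to a constant factor, the Hessian of the Gaussian at the lattice point
  of coordinates [u], evaluated twice at [(v1, v2)]. *)
Definition stiff (la : R) (v1 v2 : R) u : R :=
  par u * (2 * la * dirv v1 v2 u ^+ 2 - (v1 ^+ 2 + v2 ^+ 2)) * hgauss la u.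

Definition dualv z w (v1 v2 : R) u : R := s3 * dualX z u * v1 + dualY w u * v2.

(** The term of [u] in [F (k) = sum of (v . (xi + k)) ^ 2 exp (- B |xi + k| ^
  2)] over the dual lattice, at [k = (sqrt 3 z, w)] and [xi = (sqrt 3 u.1,
  u.2) / 2]. *)
Definition dual_term (B z w : R) (v1 v2 : R) u : R :=
  par u * dualv z w v1 v2 u ^+ 2 * dgauss B z w u.

Lemma speed_dirv v1 v2 u : speed v1 (s3 * v2) u ^+ 2 = 4 * pi ^+ 2 * dirv v1 v2 u ^+ 2.
Proof. by rewrite /speed /dirv; ring. Qed.

Lemma dirv_summable (la : R) v1 v2 (f : int * int -> R) : 0 < la -> (forall u, `|f u| <= 1) ->
  abs_summable (fun u => dirv v1 v2 u ^+ 2 * f u * hgauss la u).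
Proof.
move=> la0 f1; have p2 : 0 < 4 * pi ^+ 2 :> R by rewrite mulr_gt0// exprn_gt0// pi_gt0.
have := abs_summableZ (4 * pi ^+ 2)^-1 (speed_summable v1 (s3 * v2) la0 f1).
congr abs_summable; apply/funext => u; rewrite speed_dirv.
by move: p2; set k := 4 * pi ^+ 2 => k0; field; rewrite gt_eqF.
Qed.

Lemma norm_parcos_le1 z w u : `|par u * cos (angle z w u)| <= 1 :> R.
Proof. by apply: le_trans (norm_par_le _ _) _; exact: cos_max. Qed.

Lemma dualv_dom z w v1 v2 : exists2 C, 0 <= C & forall u,
  `|par u * dualv z w v1 v2 u ^+ 2| <= C * expR (2 * habs u).
Proof.
pose c0 := s3 * `|z| * `|v1| + `|w| * `|v2|; pose c1 := s3 * `|v1| + `|v2|.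
have s30 := ltW s3_gt0.
have c00 : 0 <= c0 by rewrite /c0; do ?[apply: addr_ge0|apply: mulr_ge0].
have c10 : 0 <= c1 by rewrite /c1; do ?[apply: addr_ge0|apply: mulr_ge0].
exists ((c0 + c1) ^+ 2); first exact: sqr_ge0.
move=> u; apply: le_trans (norm_par_le _ _) _.
rewrite normrX.
have hX : `|dualX z u| <= `|z| + `|u.1%:~R|.
  apply: le_trans (ler_normD _ _) _; rewrite lerD2l normrM normfV (@ger0_norm _ 2)//.
  by have := normr_ge0 (u.1%:~R : R); lra.
have hY : `|dualY w u| <= `|w| + `|u.2%:~R|.
  apply: le_trans (ler_normD _ _) _; rewrite lerD2l normrM normfV (@ger0_norm _ 2)//.
  by have := normr_ge0 (u.2%:~R : R); lra.
have hD : `|dualv z w v1 v2 u| <= (c0 + c1) * expR (habs u).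
  apply: le_trans (ler_normD _ _) _; rewrite !normrM (ger0_norm s30).
  have hX2 := ler_wpM2l s30 (ler_wpM2r (normr_ge0 v1) hX).
  have hY2 := ler_wpM2r (normr_ge0 v2) hY.
  have E1 := expR_ge1Dx (@habs R u).
  have h0 := @habs_ge0 R u.
  apply: (@le_trans _ _ (c0 + c1 * habs u)).
    rewrite /c0 /c1 /habs; have := mulr_ge0 s30 (mulr_ge0 (normr_ge0 v1) (normr_ge0 (u.2%:~R : R))).
    have := mulr_ge0 (normr_ge0 v2) (normr_ge0 (u.1%:~R : R)); lra.
  have := ler_wpM2l (addr_ge0 c00 c10) E1.
  by have := mulr_ge0 c00 h0; lra.
apply: (@le_trans _ _ (((c0 + c1) * expR (habs u)) ^+ 2)).
  by rewrite ler_sqr ?nnegrE//; apply: mulr_ge0; [exact: addr_ge0|exact: expR_ge0].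
by rewrite exprMn -expRM_natl.
Qed.

Lemma dual_summable (B z w : R) v1 v2 : 0 < B -> abs_summable (dual_term B z w v1 v2).
Proof.
move=> B0; have [C _ HC] := dualv_dom z w v1 v2.
exact: (@dgauss_summable R C 2 B z w _ B0 _ HC).
Qed.

Lemma stiff_cos_summable (la : R) z w v1 v2 : 0 < la ->
  abs_summable (fun u => stiff la v1 v2 u * cos (angle z w u)).
Proof.
move=> la0; have h1 := abs_summableZ (2 * la) (dirv_summable v1 v2 la0 (norm_parcos_le1 z w)).
have h2 := abs_summableZ (v1 ^+ 2 + v2 ^+ 2) (hexp_summable la0 (norm_parcos_le1 z w)).
have := abs_summableB h1 h2; congr abs_summable; apply/funext => u.
by rewrite /stiff; ring.
Qed.

Lemma angle00 u : angle 0 0 u = 0 :> R. Proof. by rewrite /angle !mulr0 addr0 mulr0. Qed.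

Lemma stiff_summable (la : R) v1 v2 : 0 < la -> abs_summable (stiff la v1 v2).
Proof.
move=> la0; have := stiff_cos_summable 0 0 v1 v2 la0.
by congr abs_summable; apply/funext => u; rewrite angle00 cos0 mulr1.
Qed.

(** The stiffness symbol in dual form.  The second derivative of the Poisson
  identity in the phase produces the quadratic weights; the terms
  proportional to the unweighted sums cancel. *)
Lemma dual_symbol (la : R) : 0 < la -> exists2 C : R,
  0 < C /\ (4 <= pi ^+ 2 / (3 * la) -> 1 / 9 <= C) & forall z w v1 v2,
  hsum (fun u => stiff la v1 v2 u * (1 - cos (angle z w u))) =
  2 * (pi ^+ 2 / (3 * la)) * C * (hsum (dual_term (pi ^+ 2 / (3 * la)) z w v1 v2) -
    hsum (dual_term (pi ^+ 2 / (3 * la)) 0 0 v1 v2)).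
Proof.
move=> la0; have [C C0 HC] := hex_poisson la0.
have p2 : 0 < pi ^+ 2 :> R by rewrite exprn_gt0// pi_gt0.
set B := pi ^+ 2 / (3 * la) in HC *.
have B0 : 0 < B by rewrite divr_gt0// mulr_gt0.
exists C; first split=> //.
  move=> B4.
  have U1 : 1 <= hsum (fun u => par u * hgauss la u * cos (angle 0 0 u)).
    have := @hsum_ge_finite R _ _ [:: (0, 0)] isT (par_hcos_summable la0 0 0).
    rewrite big_seq1 angle00 cos0 parE /= /hgauss /= !expr0n /= !mulr0 addr0 mulr0 oppr0 expR0 !mulr1.
    apply=> u _; rewrite angle00 cos0 mulr1 mulr_ge0 ?expR_ge0//.
    by have /andP[] := @par01 R u.
  (* [C] is the quotient of the two sums at phase 0: the direct one is at least its central term, the dual one at most a product of geometric series *)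
  have V9 : hsum (fun u => par u * dgauss B 0 0 u) <= 9.
    pose g (a : int) : R := (1 / 2) ^+ `|a|%N.
    have r01 : 0 <= (1 / 2 : R) < 1 by apply/andP; split; lra.
    have gs s : uniq s -> \sum_(a <- s) g a <= 3.
      by move=> us; apply: le_trans (geom_int_sum r01 us) _; rewrite ler_pdivrMr; lra.
    have Sg : abs_summable g.
      exists 3 => s us; under eq_bigr do rewrite ger0_norm ?exprn_ge0//.
      exact: gs.
    have [Sgg Egg] := hsum_prod Sg Sg.
    have g3 : hsum g <= 3 by apply: hsum_le_bound.
    have g0 : 0 <= hsum g by apply: hsum_ge0 => // a; rewrite exprn_ge0.
    apply: (@le_trans _ _ (hsum g * hsum g)); last by nra.
    rewrite -Egg; apply: le_hsum => //; first exact: par_dgauss_summable.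
    move=> u; have /andP[p0 p1] := @par01 R u.
    apply: (@le_trans _ _ (dgauss B 0 0 u)); first by rewrite ler_piMl ?expR_ge0.
    apply: le_trans (dgauss_le _ _ _ B0) _; rewrite !mulr0 !addr0 mulrDr opprD expRD.
    have one (a : int) : expR (- (B / 4 * a%:~R ^+ 2)) <= g a.
      have aE : a%:~R ^+ 2 = `|a|%N%:R ^+ 2 :> R by rewrite natr_absz intr_norm real_normK ?num_real.
      apply: (@le_trans _ _ (expR (`|a|%N%:R * -1))).
        rewrite ler_expR mulrN1 lerN2 aE.
        have n1 : `|a|%N%:R <= `|a|%N%:R ^+ 2 :> R by rewrite -natrX ler_nat -mulnn; case: `|a|%N => // k; exact: leq_pmulr.
        have := ler_wpM2r (sqr_ge0 (`|a|%N%:R : R)) B4; lra.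
      rewrite expRM_natl /g lerXn2r ?nnegrE ?expR_ge0//.
      by rewrite expRN invf_ple ?posrE ?expR_gt0//; have := expR_ge1Dx (1 : R); lra.
    by apply: ler_pM; rewrite ?expR_ge0.
  have V0 : 0 <= hsum (fun u => par u * dgauss B 0 0 u).
    apply: hsum_ge0 => [|u]; first exact: par_dgauss_summable.
    by rewrite mulr_ge0 ?expR_ge0//; have /andP[] := @par01 R u.
  rewrite HC in U1; nra.
move=> z w v1 v2.
have key z' w' : hsum (fun u => stiff la v1 v2 u * cos (angle z' w' u)) =
    - (2 * B * C) * hsum (dual_term B z' w' v1 v2).
  have lim1 := @cos_second_difference R la z' w' v1 (s3 * v2) la0.
  have lim2 := @gauss_second_difference R B z' w' v1 (s3 * v2) B0.
  have lim3 : (hsum (fun u => par u * hgauss la u * cos (angle (z' + @harmonic R n * v1) (w' + @harmonic R n * (s3 * v2)) u)) +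
   hsum (fun u => par u * hgauss la u * cos (angle (z' - @harmonic R n * v1) (w' - @harmonic R n * (s3 * v2)) u)) -
   2 * hsum (fun u => par u * hgauss la u * cos (angle z' w' u))) / @harmonic R n ^+ 2
   @[n --> \oo] --> C * hsum (fun u => par u * (dslope B z' w' v1 (s3 * v2) u ^+ 2 - 2 * dcurv B v1 (s3 * v2)) * dgauss B z' w' u).
    under eq_fun do rewrite !HC.
    have -> : (fun n => (C * hsum (fun u => par u * dgauss B (z' + @harmonic R n * v1) (w' + @harmonic R n * (s3 * v2)) u) +
      C * hsum (fun u => par u * dgauss B (z' - @harmonic R n * v1) (w' - @harmonic R n * (s3 * v2)) u) -
      2 * (C * hsum (fun u => par u * dgauss B z' w' u))) / @harmonic R n ^+ 2) =
      (fun n => C * ((hsum (fun u => par u * dgauss B (z' + @harmonic R n * v1) (w' + @harmonic R n * (s3 * v2)) u) +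
      hsum (fun u => par u * dgauss B (z' - @harmonic R n * v1) (w' - @harmonic R n * (s3 * v2)) u) -
      2 * hsum (fun u => par u * dgauss B z' w' u)) / @harmonic R n ^+ 2)).
      by apply/funext => n; ring.
    by apply: cvgM; [exact: cvg_cst|exact: lim2].
  (* the second derivatives of the two sides of Poisson summation *)
  have E := cvg_unique _ lim1 lim3; move: E => /(_ (@norm_hausdorff _ _)) E.
  have Sd := dirv_summable v1 v2 la0 (norm_parcos_le1 z' w').
  have Su := hexp_summable la0 (norm_parcos_le1 z' w').
  have -> : (fun u => stiff la v1 v2 u * cos (angle z' w' u)) =
     (fun u => 2 * la * (dirv v1 v2 u ^+ 2 * (par u * cos (angle z' w' u)) * hgauss la u) -
        (v1 ^+ 2 + v2 ^+ 2) * (par u * cos (angle z' w' u) * hgauss la u)).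
    by apply/funext => u; rewrite /stiff; ring.
  rewrite hsumB ?hsumZ//; try exact: abs_summableZ.
  have E1 : hsum (fun u => speed v1 (s3 * v2) u ^+ 2 * (par u * cos (angle z' w' u)) * hgauss la u) =
     4 * pi ^+ 2 * hsum (fun u => dirv v1 v2 u ^+ 2 * (par u * cos (angle z' w' u)) * hgauss la u).
    by rewrite -hsumZ//; congr hsum; apply/funext => u; rewrite speed_dirv !mulrA.
  have E2 : hsum (fun u => par u * cos (angle z' w' u) * hgauss la u) =
     C * hsum (fun u => par u * dgauss B z' w' u).
    by rewrite -HC; congr hsum; apply/funext => u; rewrite mulrAC.
  have E3 : hsum (fun u => par u * (dslope B z' w' v1 (s3 * v2) u ^+ 2 - 2 * dcurv B v1 (s3 * v2)) * dgauss B z' w' u) =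
    12 * B ^+ 2 * hsum (dual_term B z' w' v1 v2) - 6 * B * (v1 ^+ 2 + v2 ^+ 2) *
      hsum (fun u => par u * dgauss B z' w' u).
    rewrite -!hsumZ; [|exact: par_dgauss_summable|exact: dual_summable].
    rewrite -hsumB; last 2 first.
    - by apply: abs_summableZ; exact: dual_summable.
    - by apply: abs_summableZ; exact: par_dgauss_summable.
    congr hsum; apply/funext => u; rewrite /dual_term /dslope /dcurv /dualv.
    have s33 := s3_sqr; set X := dualX z' u; set Y := dualY w' u.
    have -> : (2 * B * (3 * X * v1 + Y * (s3 * v2))) ^+ 2 = 12 * B ^+ 2 * (s3 * X * v1 + Y * v2) ^+ 2.
      have -> : 3 * X * v1 + Y * (s3 * v2) = s3 * (s3 * X * v1 + Y * v2).
        by rewrite -[in LHS]s33; ring.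
      have -> : 12 * B ^+ 2 = (2 * B) ^+ 2 * s3 ^+ 2 by rewrite s33; ring.
      by ring.
    have -> : (s3 * v2) ^+ 2 = 3 * v2 ^+ 2 by rewrite exprMn s33.
    by ring.
  rewrite E1 E3 in E; rewrite E2.
  have E4 : hsum (fun u => dirv v1 v2 u ^+ 2 * (par u * cos (angle z' w' u)) * hgauss la u) =
    - (C * (12 * B ^+ 2 * hsum (dual_term B z' w' v1 v2) - 6 * B * (v1 ^+ 2 + v2 ^+ 2) *
      hsum (fun u => par u * dgauss B z' w' u))) / (4 * pi ^+ 2).
    by rewrite -E opprK mulrC mulKf// gt_eqF// mulr_gt0.
  have pB : pi ^+ 2 = 3 * la * B by rewrite mulrC divfK// gt_eqF// mulr_gt0.
  rewrite E4 pB; clearbody B; field.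
  by rewrite !gt_eqF.
have -> : (fun u => stiff la v1 v2 u * (1 - cos (angle z w u))) =
  (fun u => stiff la v1 v2 u * cos (angle 0 0 u) - stiff la v1 v2 u * cos (angle z w u)).
  by apply/funext => u; rewrite angle00 cos0; ring.
rewrite hsumB ?key; [ring|exact: stiff_cos_summable..].
Qed.

End DualSymbol.

(** * The first shell of the dual lattice *)
Section FirstShell.
Context {R : realType}.
Implicit Types x y : R.

Definition ch x : R := (expR x + expR (- x)) / 2.
Definition sh x : R := (expR x - expR (- x)) / 2.

Lemma ch_norm x : ch `|x| = ch x.
Proof.
have [x0|x0] := leP 0 x; first by rewrite ger0_norm.
by rewrite ltr0_norm// /ch opprK addrC.
Qed.

Lemma sh_sqr x : sh x ^+ 2 = ch x ^+ 2 - 1.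
Proof.
rewrite /sh /ch; have := expRxMexpNx_1 x; set E := expR x; set F := expR (- x) => EF.
have -> : ((E + F) / 2) ^+ 2 - 1 = ((E + F) / 2) ^+ 2 - E * F by rewrite EF.
by field.
Qed.

Lemma ch_ge x : 1 + x ^+ 2 / 2 + x ^+ 4 / 24 <= ch x.
Proof.
have h1 := expR_ge_taylor5 x; have h2 := expR_ge_taylor5 (- x); rewrite /ch.
move: h2; have -> : (- x) ^+ 2 = x ^+ 2 by ring.
have -> : (- x) ^+ 3 = - x ^+ 3 by ring.
have -> : (- x) ^+ 4 = x ^+ 4 by ring.
have -> : (- x) ^+ 5 = - x ^+ 5 by ring.
lra.
Qed.

Lemma ch_ge1 x : 1 <= ch x.
Proof.
apply: le_trans (ch_ge x).
have x4 : 0 <= x ^+ 4 by rewrite -[4%N]/(2 * 2)%N exprM sqr_ge0.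
by have := sqr_ge0 x; lra.
Qed.

Lemma ch_le x y : 0 <= x -> x <= y -> ch x <= ch y.
Proof.
move=> x0 xy; rewrite /ch ler_pM2r//.
have h : expR x <= expR y by rewrite ler_expR.
have := expRxMexpNx_1 x; have := expRxMexpNx_1 y.
have ex1 : 1 <= expR x by rewrite -expR0 ler_expR.
have ey1 : 1 <= expR y := le_trans ex1 h.
have le1 (E e : R) : 1 <= E -> E * e = 1 -> 0 <= e -> e <= 1 by clear; nra.
move: h ex1 ey1 (expR_ge0 (- x)) (expR_ge0 (- y)); clear -le1.
move: (expR y) (expR x) (expR (- y)) (expR (- x)) => E F e f h F1 E1 f0 e0 Ee Ff.
have e1 := le1 _ _ E1 Ee e0; have f1 := le1 _ _ F1 Ff f0.
have ef : e * f <= 1 by rewrite -[leRHS]mulr1 ler_pM.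
have k : 0 <= (E - F) * (1 - e * f) by apply: mulr_ge0; rewrite subr_ge0.
have -> : F + f = E + e - (E - F) * (1 - e * f).
  have -> : (E - F) * (1 - e * f) = E - F - (E * e) * f + e * (F * f) by ring.
  by rewrite Ee Ff; ring.
by rewrite lerBlDr lerDl.
Qed.

(** Convexity of the exponential between 0 and [c]. *)
Lemma expR_chord (c theta : R) : 0 <= theta <= 1 ->
  expR (theta * c) <= 1 + theta * (expR c - 1).
Proof.
move=> /andP[t0 t1]; set E := expR (theta * c).
have E0 : 0 < E := expR_gt0 _.
have h1 : E * (1 + (c - theta * c)) <= expR c.
  have -> : expR c = E * expR (c - theta * c).
    by rewrite -expRD; congr expR; ring.
  by rewrite ler_pM2l// expR_ge1Dx.
have h2 : E * (1 + (0 - theta * c)) <= 1.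
  have e : E * expR (0 - theta * c) = 1.
    by rewrite -expRD -[RHS]expR0; congr expR; ring.
  by rewrite -[leRHS]e ler_pM2l// expR_ge1Dx.
have h3 := ler_wpM2l t0 h1.
have t2 : 0 <= 1 - theta by lra.
have h4 := ler_wpM2l t2 h2.
lra.
Qed.

(** The Taylor polynomial is accurate at [y / n], so its power [n] is a good
  rational lower bound for [exp y]; all the numerical constants come from it. *)
Lemma expR_ge_pow (y : R) (n : nat) (b : R) : (0 < n)%N -> 0 <= b ->
  b <= 1 + y / n%:R + (y / n%:R) ^+ 2 / 2 + (y / n%:R) ^+ 3 / 6 + (y / n%:R) ^+ 4 / 24
    + (y / n%:R) ^+ 5 / 120 -> b ^+ n <= expR y.
Proof.
move=> n0 b0 h.
have -> : y = n%:R * (y / n%:R) by rewrite mulrC divfK// pnatr_eq0 -lt0n.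
by rewrite expRM_natl lerXn2r ?nnegrE ?expR_ge0//; apply: le_trans h (expR_ge_taylor5 _).
Qed.

Lemma expR_6375 : 540 <= expR (51 / 8) :> R.
Proof. by apply: (le_trans _ (@expR_ge_pow _ 8 (11 / 5) isT _ _)); lra. Qed.

Lemma expR_31875 : 234 / 10 <= expR (51 / 16) :> R.
Proof. by apply: (le_trans _ (@expR_ge_pow _ 4 (11 / 5) isT _ _)); lra. Qed.

Lemma expR_13725 : 394 / 100 <= expR (13725 / 10000) :> R.
Proof. by apply: (le_trans _ (@expR_ge_pow _ 2 (1986 / 1000) isT _ _)); lra. Qed.

Lemma expR_316 : 235 / 10 <= expR (316 / 100) :> R.
Proof. by apply: (le_trans _ (@expR_ge_pow _ 4 (22025 / 10000) isT _ _)); lra. Qed.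

Lemma expR_389 : 485 / 10 <= expR (389 / 100) :> R.
Proof. by apply: (le_trans _ (@expR_ge_pow _ 4 (2643 / 1000) isT _ _)); lra. Qed.

Lemma expR_92 : 5 / 2 <= expR (92 / 100) :> R.
Proof. by apply: (le_trans _ (@expR_ge_pow _ 1 (25 / 10) isT _ _)); lra. Qed.

Lemma expR_1_le : expR 1 <= 273 / 100 :> R.
Proof.
have [|_ _ h] := @expRN_taylor_pos R 1; first lra.
have := expRxMexpNx_1 (1 : R); have := expR_gt0 (1 : R).
set E := expR 1; move=> E0 EE; have : E * (1 - 1 + 1 ^+ 2 / 2 - 1 ^+ 3 / 6 + 1 ^+ 4 / 24 - 1 ^+ 5 / 120) <= 1.
  by rewrite -[leRHS]EE ler_pM2l//; lra.
lra.
Qed.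

Lemma expR_84_le : expR (84 / 100) <= 234 / 100 :> R.
Proof.
have [|_ _ h] := @expRN_taylor_pos R (84 / 100); first lra.
have := expRxMexpNx_1 (84 / 100 : R); have := expR_gt0 (84 / 100 : R).
set E := expR _; move=> E0 EE.
have : E * (1 - (84 / 100) + (84 / 100) ^+ 2 / 2 - (84 / 100) ^+ 3 / 6 + (84 / 100) ^+ 4 / 24 - (84 / 100) ^+ 5 / 120) <= 1.
  by rewrite -[leRHS]EE ler_pM2l//; lra.
lra.
Qed.

Lemma cauchy3 (a1 a2 a3 h1 h2 h3 g1 g2 g3 : R) : 0 < g1 -> 0 < g2 -> 0 < g3 ->
  (a1 * h1 + a2 * h2 + a3 * h3) ^+ 2 <=
  (a1 ^+ 2 * g1 + a2 ^+ 2 * g2 + a3 ^+ 2 * g3) * (h1 ^+ 2 / g1 + h2 ^+ 2 / g2 + h3 ^+ 2 / g3).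
Proof.
move=> g10 g20 g30; rewrite -subr_ge0.
have -> : (a1 ^+ 2 * g1 + a2 ^+ 2 * g2 + a3 ^+ 2 * g3) * (h1 ^+ 2 / g1 + h2 ^+ 2 / g2 + h3 ^+ 2 / g3)
  - (a1 * h1 + a2 * h2 + a3 * h3) ^+ 2 =
  (a1 * g1 * h2 - a2 * g2 * h1) ^+ 2 / (g1 * g2) +
  (a1 * g1 * h3 - a3 * g3 * h1) ^+ 2 / (g1 * g3) +
  (a2 * g2 * h3 - a3 * g3 * h2) ^+ 2 / (g2 * g3).
  by field; rewrite !gt_eqF.
by rewrite !addr_ge0// mulr_ge0 ?sqr_ge0// invr_ge0 mulr_ge0// ltW.
Qed.

Lemma quad_min (K L M m tau : R) : 0 < K -> L ^+ 2 <= K * (M - m) ->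
  m <= K * tau ^+ 2 - 2 * L * tau + M.
Proof.
move=> K0 h; rewrite -subr_ge0.
have : 0 <= K * (K * tau ^+ 2 - 2 * L * tau + M - m).
  have -> : K * (K * tau ^+ 2 - 2 * L * tau + M - m) =
    (K * tau - L) ^+ 2 + (K * (M - m) - L ^+ 2) by ring.
  by rewrite addr_ge0 ?sqr_ge0// subr_ge0.
by rewrite pmulr_rge0.
Qed.

(** The origin and the six points of the first shell contribute a quadratic
  polynomial in [tau], the component of the direction along the wave vector. *)
Lemma shell_form (q tau a1 a2 a3 c1 c2 c3 h1 h2 h3 : R) :
  tau ^+ 2 + 2 * q * ((a1 ^+ 2 + tau ^+ 2) * c1 - 2 * tau * a1 * h1 +
     ((a2 ^+ 2 + tau ^+ 2) * c2 - 2 * tau * a2 * h2) +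
     ((a3 ^+ 2 + tau ^+ 2) * c3 - 2 * tau * a3 * h3)) =
  (1 + 2 * q * (c1 + c2 + c3)) * tau ^+ 2 - 2 * (2 * q * (a1 * h1 + a2 * h2 + a3 * h3)) * tau
   + 2 * q * (a1 ^+ 2 * c1 + a2 ^+ 2 * c2 + a3 ^+ 2 * c3).
Proof. by ring. Qed.

(** The minimum over [tau] is bounded by the Cauchy-Schwarz inequality with
  the weights [c1, c2, c3]. At phase 0 the [c - 1 / c] vanish and nothing is
  lost. *)
Lemma shell_min1 (q tau a1 a2 a3 c1 c2 c3 h1 h2 h3 : R) : 0 < q ->
  1 <= c1 -> 1 <= c2 -> 1 <= c3 ->
  h1 ^+ 2 = c1 ^+ 2 - 1 -> h2 ^+ 2 = c2 ^+ 2 - 1 -> h3 ^+ 2 = c3 ^+ 2 - 1 ->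
  2 * q * (a1 ^+ 2 * c1 + a2 ^+ 2 * c2 + a3 ^+ 2 * c3) /
    (1 + 2 * q * ((c1 - c1^-1) + (c2 - c2^-1) + (c3 - c3^-1))) <=
  tau ^+ 2 + 2 * q * ((a1 ^+ 2 + tau ^+ 2) * c1 - 2 * tau * a1 * h1 +
     ((a2 ^+ 2 + tau ^+ 2) * c2 - 2 * tau * a2 * h2) +
     ((a3 ^+ 2 + tau ^+ 2) * c3 - 2 * tau * a3 * h3)).
Proof.
move=> q0 c11 c21 c31 H1 H2 H3.
have c10 : 0 < c1 by lra. have c20 : 0 < c2 by lra. have c30 : 0 < c3 by lra.
have i1 : 0 < c1^-1 by rewrite invr_gt0. have i2 : 0 < c2^-1 by rewrite invr_gt0.
have i3 : 0 < c3^-1 by rewrite invr_gt0.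
have j1 : c1^-1 <= 1 by rewrite invf_le1. have j2 : c2^-1 <= 1 by rewrite invf_le1.
have j3 : c3^-1 <= 1 by rewrite invf_le1.
set S := (c1 - c1^-1) + (c2 - c2^-1) + (c3 - c3^-1).
have S0 : 0 <= S by rewrite /S; lra.
set A := a1 ^+ 2 * c1 + a2 ^+ 2 * c2 + a3 ^+ 2 * c3.
have A0 : 0 <= A by rewrite /A !addr_ge0// mulr_ge0 ?sqr_ge0// ltW.
have cs := cauchy3 a1 a2 a3 h1 h2 h3 c10 c20 c30.
rewrite H1 H2 H3 in cs.
have e (c : R) : 0 < c -> (c ^+ 2 - 1) / c = c - c^-1.
  by move=> c0; field; rewrite gt_eqF.
rewrite !e// -/A -/S in cs.
have qS : 0 <= q * S by rewrite mulr_ge0// ltW.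
have D0 : 0 < 1 + 2 * q * S by rewrite -mulrA; lra.
rewrite shell_form -/A; apply: quad_min.
  rewrite -mulrA; have := mulr_gt0 q0 c10; have := mulr_gt0 q0 c20; have := mulr_gt0 q0 c30.
  rewrite !mulrDr; lra.
have -> : 2 * q * A - 2 * q * A / (1 + 2 * q * S) = 2 * q * A * (2 * q * S) / (1 + 2 * q * S).
  by field; rewrite gt_eqF.
set L := a1 * h1 + _ + _ in cs *.
apply: (@le_trans _ _ (2 * q * A * (2 * q * S))).
  have -> : (2 * q * L) ^+ 2 = (2 * q) ^+ 2 * L ^+ 2 by ring.
  have -> : 2 * q * A * (2 * q * S) = (2 * q) ^+ 2 * (A * S) by ring.
  by rewrite ler_wpM2l ?sqr_ge0.
set X := 2 * q * A * (2 * q * S).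
have X0 : 0 <= X.
  have -> : X = (2 * q) ^+ 2 * (A * S) by rewrite /X; ring.
  by rewrite mulr_ge0 ?sqr_ge0// mulr_ge0.
rewrite (mulrA _ X) ler_pdivlMr// mulrC ler_wpM2r//.
rewrite lerD2l ler_wpM2l ?mulr_ge0 ?(ltW q0)//; rewrite /S; lra.
Qed.

(** For large phases [c1] is of the order of [1 / q] near the boundary of the
  cell and dominates the others, and the weights [3 / 2 c1, c2, c3] in the
  Cauchy-Schwarz inequality are better: they leave a gain to the axes 2 and 3. *)
Lemma shell_min2 (q tau a1 a2 a3 c1 c2 c3 h1 h2 h3 : R) : 0 < q ->
  1 <= c1 -> 1 <= c2 -> 1 <= c3 ->
  h1 ^+ 2 = c1 ^+ 2 - 1 -> h2 ^+ 2 = c2 ^+ 2 - 1 -> h3 ^+ 2 = c3 ^+ 2 - 1 ->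
  2 * q * (a1 ^+ 2 * (c1 * (1 - q * (c2 + c3))) + a2 ^+ 2 * (c2 * (1 + 2 / 3 * q * c1)) +
    a3 ^+ 2 * (c3 * (1 + 2 / 3 * q * c1))) / (1 + 2 * q * (c1 + c2 + c3)) <=
  tau ^+ 2 + 2 * q * ((a1 ^+ 2 + tau ^+ 2) * c1 - 2 * tau * a1 * h1 +
     ((a2 ^+ 2 + tau ^+ 2) * c2 - 2 * tau * a2 * h2) +
     ((a3 ^+ 2 + tau ^+ 2) * c3 - 2 * tau * a3 * h3)).
Proof.
move=> q0 c11 c21 c31 H1 H2 H3.
have c10 : 0 < c1 by lra. have c20 : 0 < c2 by lra. have c30 : 0 < c3 by lra.
(* the factor 3 / 2 is the weight given to the first axis *)
have g10 : 0 < 3 / 2 * c1 by lra.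
have K0 : 0 < 1 + 2 * q * (c1 + c2 + c3).
  by rewrite addr_gt0// !mulr_gt0// !addr_gt0.
have cs := cauchy3 a1 a2 a3 h1 h2 h3 g10 c20 c30.
rewrite shell_form; apply: quad_min => //.
set L := a1 * h1 + _ + _ in cs *.
set A := a1 ^+ 2 * (3 / 2 * c1) + a2 ^+ 2 * c2 + a3 ^+ 2 * c3 in cs *.
have A0 : 0 <= A by rewrite /A !addr_ge0// mulr_ge0 ?sqr_ge0// ltW.
have G : h1 ^+ 2 / (3 / 2 * c1) + h2 ^+ 2 / c2 + h3 ^+ 2 / c3 <= 2 / 3 * c1 + c2 + c3.
  apply: lerD; first apply: lerD.
  - rewrite ler_pdivrMr// H1; have -> : 2 / 3 * c1 * (3 / 2 * c1) = c1 ^+ 2 by field. lra.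
  - by rewrite ler_pdivrMr// H2 -expr2; lra.
  - by rewrite ler_pdivrMr// H3 -expr2; lra.
have cs2 : L ^+ 2 <= A * (2 / 3 * c1 + c2 + c3).
  by apply: le_trans cs _; rewrite ler_wpM2l.
have -> : (1 + 2 * q * (c1 + c2 + c3)) * (2 * q * (a1 ^+ 2 * c1 + a2 ^+ 2 * c2 + a3 ^+ 2 * c3) -
   2 * q * (a1 ^+ 2 * (c1 * (1 - q * (c2 + c3))) + a2 ^+ 2 * (c2 * (1 + 2 / 3 * q * c1)) +
    a3 ^+ 2 * (c3 * (1 + 2 / 3 * q * c1))) / (1 + 2 * q * (c1 + c2 + c3))) =
   (2 * q) ^+ 2 * (A * (2 / 3 * c1 + c2 + c3)).
  by rewrite /A; field; rewrite gt_eqF.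
have -> : (2 * q * L) ^+ 2 = (2 * q) ^+ 2 * L ^+ 2 by ring.
by rewrite ler_wpM2l ?sqr_ge0.
Qed.

(** The worst direction is [a1 = a2], for which the third axis, with the
  smallest weight, carries two thirds of the total of the squares. *)
Lemma weights_min (a1 a2 a3 g1 g2 g3 m : R) : a1 + a2 + a3 = 0 ->
  m <= g1 -> m <= g2 -> g3 <= m ->
  (a1 ^+ 2 + a2 ^+ 2 + a3 ^+ 2) / 3 * (m + 2 * g3) <= a1 ^+ 2 * g1 + a2 ^+ 2 * g2 + a3 ^+ 2 * g3.
Proof.
move=> a0 m1 m2 m3; have a1E : a1 = - (a2 + a3) by lra.
have h1 := ler_wpM2l (sqr_ge0 a1) m1; have h2 := ler_wpM2l (sqr_ge0 a2) m2.
have k : 0 <= (a2 - a1) ^+ 2 * (m - g3) by rewrite mulr_ge0 ?sqr_ge0// subr_ge0.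
suff : (a1 ^+ 2 + a2 ^+ 2 + a3 ^+ 2) / 3 * (m + 2 * g3) <= a1 ^+ 2 * m + a2 ^+ 2 * m + a3 ^+ 2 * g3 by lra.
have -> : a3 = - (a1 + a2) by lra.
rewrite -subr_ge0.
have -> : a1 ^+ 2 * m + a2 ^+ 2 * m + (- (a1 + a2)) ^+ 2 * g3 -
  (a1 ^+ 2 + a2 ^+ 2 + (- (a1 + a2)) ^+ 2) / 3 * (m + 2 * g3) =
  (a2 - a1) ^+ 2 * (m - g3) / 3 by field.
by rewrite divr_ge0.
Qed.

End FirstShell.

Section ShellInequality.
Context {R : realType}.
Implicit Types x y B : R.

Lemma sqr_le (a b : R) : 0 <= a -> a <= b -> a ^+ 2 <= b ^+ 2.
Proof. by move=> a0 ab; rewrite ler_sqr ?nnegrE//; apply: le_trans ab. Qed.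

Lemma expRN_B B : 51 / 8 <= B -> 0 < expR (- B) /\ expR (- B) * B <= 119 / 10000
  /\ expR (- B) <= 1 / 540.
Proof.
move=> B0; have q0 : 0 < expR (- B) := expR_gt0 _; split=> //.
have h : 540 * (1 + (B - 51 / 8)) <= expR B.
  have -> : expR B = expR (51 / 8) * expR (B - 51 / 8) by rewrite -expRD; congr expR; ring.
  apply: ler_pM; [lra|lra|exact: expR_6375|exact: expR_ge1Dx].
have EE := expRxMexpNx_1 B.
have := ler_wpM2l (ltW q0) h; have := ler_wpM2l (ltW q0) B0; move: EE.
rewrite [expR B * _]mulrC; set E := expR B; set q := expR (- B) in q0 * => EE k1 k2.
split; lra.
Qed.

Lemma ch_le_quad (s : R) : 0 <= s <= 4 -> ch s - 1 <= 224 / 100 * s ^+ 2.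
Proof.
move=> /andP[s0 s4].
have e2 : expR 2 <= 746 / 100 :> R.
  have -> : 2 = 2%:R * 1 :> R by rewrite mulr1.
  rewrite expRM_natl; apply: (@le_trans _ _ ((273 / 100) ^+ 2)); last lra.
  by apply: sqr_le; [exact: expR_ge0|exact: expR_1_le].
have t01 : 0 <= s / 4 <= 1 by apply/andP; split; lra.
have h1 := @expR_chord R 2 _ t01.
have h2 := expR_ge1Dx (- (s / 4 * 2)).
have -> : s = s / 4 * 2 + s / 4 * 2 by field.
rewrite /ch opprD !expRD.
have := expRxMexpNx_1 (s / 4 * 2); set E := expR _ in h1 *; set F := expR _ in h2 * => EF.
have -> : (E * E + F * F) / 2 - 1 = (E - F) ^+ 2 / 2.
  have -> : (E * E + F * F) / 2 - 1 = (E * E + F * F) / 2 - E * F by rewrite EF.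
  by field.
have -> : s / 4 * 2 + s / 4 * 2 = s by field.
have F0 : 0 < F := expR_gt0 _. have E0 : 0 < E := expR_gt0 _.
have d1 : E - F <= 2115 / 1000 * s.
  have : s / 4 * (expR 2 - 1) <= s / 4 * (646 / 100) by apply: ler_wpM2l; lra.
  lra.
have d0 : 0 <= E - F.
  by rewrite subr_ge0 ler_expR; lra.
have : (E - F) ^+ 2 <= (2115 / 1000 * s) ^+ 2.
  by apply: sqr_le.
rewrite exprMn; have := sqr_ge0 s; lra.
Qed.

Lemma expR_le_chord (t : R) : 0 <= t -> t <= 84 / 100 -> expR t <= 1 + 8 / 5 * t.
Proof.
move=> t0 t84; have t01 : 0 <= t / (84 / 100) <= 1 by apply/andP; split; lra.
have := @expR_chord R (84 / 100) _ t01.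
have -> : t / (84 / 100) * (84 / 100) = t by field.
have := @expR_84_le R; move: (expR (84 / 100)) (expR t) => E T E84.
have : t / (84 / 100) * (E - 1) <= t / (84 / 100) * (134 / 100).
  by apply: ler_wpM2l; lra.
lra.
Qed.

Lemma sub_inv_ge0 (c : R) : 1 <= c -> 0 <= c - c^-1.
Proof.
move=> c1; have c0 : 0 < c by lra.
by rewrite subr_ge0 (le_trans _ c1)// invf_le1.
Qed.

Lemma ch_sub_inv_le (s : R) : 0 <= s -> s <= 4 -> ch s - (ch s)^-1 <= 448 / 100 * s ^+ 2.
Proof.
move=> s0 s4; have := @ch_le_quad s; rewrite s0 s4 => /(_ isT).
have := ch_ge1 s; move: (ch s) => c c1 cs; have c0 : 0 < c by lra.
suff : c - c^-1 <= 2 * (c - 1) by lra.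
rewrite -subr_ge0.
have -> : 2 * (c - 1) - (c - c^-1) = (c - 1) ^+ 2 / c by field; rewrite gt_eqF.
by rewrite divr_ge0 ?sqr_ge0// ltW.
Qed.

(** The quartic Taylor bound of the hyperbolic cosine, in terms of the
  quadratic form [La] that governs the squared norm of the wave vector. *)
Lemma ch_sum_ge (x y : R) : let La := x ^+ 2 + x * y + y ^+ 2 in
  0 <= La -> 3 + 42 / 100 * La + 123 / 10000 * La ^+ 2 <= ch x + 2 * ch y.
Proof.
move=> La La0; have c2 := ch_ge x; have c3 := ch_ge y.
have p1 : 42 / 100 * La <= x ^+ 2 / 2 + y ^+ 2.
  rewrite /La; have := sqr_ge0 (x - 21 / 8 * y); have := sqr_ge0 y; rewrite sqrrB exprMn.
  clear; move: (x ^+ 2) (y ^+ 2) => X Y; lra.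
have p2 : 123 / 10000 * La ^+ 2 <= x ^+ 4 / 24 + y ^+ 4 / 12.
  have -> : x ^+ 4 = (x ^+ 2) ^+ 2 by rewrite -exprM.
  have -> : y ^+ 4 = (y ^+ 2) ^+ 2 by rewrite -exprM.
  have h1 : La <= 3 / 2 * (x ^+ 2 + y ^+ 2).
    by rewrite /La; have := sqr_ge0 (x - y); rewrite sqrrB; clear; lra.
  have h2 := sqr_le La0 h1; move: h2; move: (La ^+ 2) (x ^+ 2) (y ^+ 2) => L X Y.
  have := sqr_ge0 (X - 2 * Y); have := sqr_ge0 X; have := sqr_ge0 Y; clear; nra.
move: p1 p2 c2 c3; clear; move: (La ^+ 2) (ch x) (ch y); clearbody La => L2 C1 C2.
lra.
Qed.

Lemma shell_small_poly (t La : R) : 0 <= t -> t <= 84 / 100 -> 153 / 8 * t <= La ->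
  (3 + 15 / 100 * t) * (1 + 8 / 5 * t) * (1 + 66 / 100 * t) <=
  3 + 42 / 100 * La + 123 / 10000 * La ^+ 2.
Proof.
move=> t0 t84 tL.
have La2 : (153 / 8 * t) ^+ 2 <= La ^+ 2 by apply: sqr_le => //; apply: mulr_ge0 => //; lra.
have t2 := mulr_ge0 t0 t0.
have t3 : t * (t * t) <= 84 / 100 * (t * t) by apply: ler_wpM2r.
move: La2 tL t3 t2; clear -t0; rewrite exprMn; move: (La ^+ 2) => L2.
have -> : t ^+ 2 = t * t by []. 
have -> : (3 + 15 / 100 * t) * (1 + 8 / 5 * t) * (1 + 66 / 100 * t) =
  3 + 693 / 100 * t + (24 / 100 + 99 / 1000 + 3168 / 1000) * (t * t) + 1584 / 10000 * (t * (t * t)).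
  by field.
move: (t * (t * t)) (t * t) => t3 t2; lra.
Qed.

(** Phases at most 4. Here [t] is at most 0.84, so that [exp t] and the
  denominator [D] are at most affine in [t], while [La = 3 B t] is at least
  [153 / 8 t]: the comparison becomes one of polynomials. *)
Lemma shell_small B x y (m : R) : 51 / 8 <= B -> 0 <= y -> y <= x -> x + y <= 4 ->
  let t := (x ^+ 2 + x * y + y ^+ 2) / (3 * B) in
  let D := 1 + 2 * expR (- B) * ((ch (x + y) - (ch (x + y))^-1) +
     (ch x - (ch x)^-1) + (ch y - (ch y)^-1)) in
  0 <= m -> m <= t -> (3 + 15 / 100 * m) * expR t * D <= ch x + 2 * ch y.
Proof.
move=> B0 y0 yx xy4 t D m0 mt.
have [q0 [qB q1]] := expRN_B B0.
have x0 : 0 <= x := le_trans y0 yx.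
have xy : 0 <= x * y := mulr_ge0 x0 y0.
have [x4 y4] : x <= 4 /\ y <= 4 by move: xy4 x0 y0; clear; lra.
have B30 : 0 < 3 * B by move: B0; clear; lra.
have La0 : 0 <= x ^+ 2 + x * y + y ^+ 2 by rewrite !addr_ge0// sqr_ge0.
have La16 : x ^+ 2 + x * y + y ^+ 2 <= 16.
  have h : (x + y) ^+ 2 <= 4 ^+ 2 by apply: sqr_le => //; exact: addr_ge0.
  by move: h xy; rewrite sqrrD; clear; move: (x ^+ 2) (y ^+ 2) (x * y) => X Y XY; lra.
have LaE : x ^+ 2 + x * y + y ^+ 2 = t * (3 * B) by rewrite /t divfK// gt_eqF.
have t0 : 0 <= t by rewrite /t divr_ge0// ltW.
have t84 : t <= 84 / 100.
  by rewrite /t ler_pdivrMr//; move: La16 B0; clear; move: (_ + y ^+ 2) => L; lra.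
have lhs := ch_sum_ge La0.
have k1 := ch_sub_inv_le (addr_ge0 x0 y0) xy4.
have k2 := ch_sub_inv_le x0 x4; have k3 := ch_sub_inv_le y0 y4.
have S0 : 0 <= (ch (x + y) - (ch (x + y))^-1) + (ch x - (ch x)^-1) + (ch y - (ch y)^-1).
  by apply: addr_ge0; [apply: addr_ge0|]; apply: sub_inv_ge0; exact: ch_ge1.
have S : (ch (x + y) - (ch (x + y))^-1) + (ch x - (ch x)^-1) + (ch y - (ch y)^-1) <=
    896 / 100 * (x ^+ 2 + x * y + y ^+ 2).
  move: k1 k2 k3; rewrite sqrrD; clear.
  by move: (_ - (ch (x + y))^-1) (_ - (ch x)^-1) (_ - (ch y)^-1) (x ^+ 2) (y ^+ 2) (x * y) =>
    A1 A2 A3 X Y Z; lra.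
have Dle : D <= 1 + 66 / 100 * t.
  have k := ler_wpM2l (ltW q0) S; move: t0 k (ler_wpM2l t0 qB); rewrite LaE /D -(mulrA 2); clear.
  by move: (_ + (ch y - (ch y)^-1)) (expR (- B)) => Z q; clearbody t; lra.
have D1 : 0 <= D.
  by rewrite /D addr_ge0// mulr_ge0// mulr_ge0// ltW.
apply: le_trans lhs.
(* [153 / 8 = 3 * 51 / 8] *)
have B19 : 153 / 8 * t <= x ^+ 2 + x * y + y ^+ 2.
  by rewrite LaE; move: (ler_wpM2l t0 B0); clear; clearbody t; lra.
apply: le_trans (shell_small_poly t0 t84 B19).
have E0 := expR_ge0 t; have Et := expR_le_chord t0 t84.
apply: ler_pM => //.
  by apply: mulr_ge0 => //; move: m0; clear; lra.
by apply: ler_pM => //; move: m0 mt; clear; clearbody t; lra.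
Qed.

End ShellInequality.

Section ShellLarge.
Context {R : realType}.
Implicit Types x y B : R.

Lemma exponent1 (X B : R) : 51 / 8 <= B -> 4 <= X -> X <= B ->
  13725 / 10000 + X ^+ 2 / (4 * B) <= X / 2.
Proof.
move=> B0 X4 XB; have B1 : 0 < 4 * B by lra.
rewrite -lerBrDl ler_pdivrMr//.
have [X6|X6] := leP X (51 / 8).
  have h1 : 0 <= (B - 51 / 8) * (2 * X - 549 / 100) by apply: mulr_ge0; lra.
  have h2 : 0 <= (X - 4) * (875 / 100 - X) by apply: mulr_ge0; lra.
  by move: h1 h2 X4; clear; nra.
have h1 : 0 <= (B - X) * (2 * X - 549 / 100) by apply: mulr_ge0; lra.
have h2 : 0 <= X * (X - 549 / 100) by apply: mulr_ge0; lra.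
by move: h1 h2; clear; nra.
Qed.

Lemma exponent2 (X B : R) : 51 / 8 <= B -> 4 <= X -> X <= B ->
  316 / 100 + X ^+ 2 / (3 * B) <= X.
Proof.
move=> B0 X4 XB; have B1 : 0 < 3 * B by lra.
rewrite -lerBrDl ler_pdivrMr//.
have [X6|X6] := leP X (51 / 8).
  have h1 : 0 <= (B - 51 / 8) * (3 * X - 948 / 100) by apply: mulr_ge0; lra.
  have h2 : 0 <= (X - 4) * (7 - X) by apply: mulr_ge0; lra.
  by move: h1 h2 X4; clear; nra.
have h1 : 0 <= (B - X) * (3 * X - 948 / 100) by apply: mulr_ge0; lra.
have h2 : 0 <= X * (X - 474 / 100) by apply: mulr_ge0; lra.
by move: h1 h2; clear; nra.
Qed.

Lemma exponent3 (X B : R) : 51 / 8 <= B -> B - 92 / 100 <= X -> X <= B ->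
  389 / 100 + X ^+ 2 / (3 * B) <= X.
Proof.
move=> B0 X4 XB; have B1 : 0 < 3 * B by lra.
rewrite -lerBrDl ler_pdivrMr//.
have [X6|X6] := leP X (51 / 8).
  have h1 : 0 <= (B - 51 / 8) * (3 * X - 1167 / 100) by apply: mulr_ge0; lra.
  have h2 : 0 <= (X - 5455 / 1000) * (7 - X) by apply: mulr_ge0; lra.
  by move: h1 h2 X4 B0; clear; nra.
have h1 : 0 <= (B - X) * (3 * X - 1167 / 100) by apply: mulr_ge0; lra.
have h2 : 0 <= X * (X - 585 / 100) by apply: mulr_ge0; lra.
by move: h1 h2 X6; clear; nra.
Qed.

(** The polynomial comparison when the weight of the second axis is the
  smaller of the first two; [w = exp ((x - y) / 2)], [p = exp (X - B)] and
  [eta = exp (X / 2 - B)] with [X = x + y]. *)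
Lemma poly_largeA (w p eta : R) : 1 <= w -> 0 <= p -> p <= 1 -> 0 <= eta -> eta <= 10 / 234 ->
  eta * w <= 1 ->
  315 / 100 * ((5 + w) / 6) * (w * (1 + p + 1 / 180) + eta * (w ^+ 2 + 1)) <=
  197 / 100 * (w ^+ 2 + 2) * (1 + p / 3).
Proof.
move=> w1 p0 p1 e0 e1 ew.
(* both sides are affine in p *)
suff [k0 k1] : 525 / 1000 * (5 + w) * (w * (1 + 1 / 180) + eta * (w ^+ 2 + 1)) <=
    197 / 100 * (w ^+ 2 + 2) /\
   525 / 1000 * (5 + w) * (w * (2 + 1 / 180) + eta * (w ^+ 2 + 1)) <=
    197 / 100 * (w ^+ 2 + 2) * (4 / 3).
  have q0 : 0 <= 1 - p by rewrite subr_ge0.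
  have := ler_wpM2l q0 k0; have := ler_wpM2l p0 k1; clear; lra.
have w0 : 0 <= w by apply: le_trans w1.
have [w3|w3] := leP w 3; [|have [w10|w10] := leP w 10].
- have E : 525 / 1000 * (5 + w) * (eta * (w ^+ 2 + 1)) <= 525 / 1000 * (5 + w) * (10 / 234 * (w ^+ 2 + 1)).
    apply: ler_wpM2l; first by move: w0; clear; lra.
    by apply: ler_wpM2r => //; rewrite addr_ge0 ?sqr_ge0.
  have w3' : w ^+ 2 * w <= w ^+ 2 * 3 by apply: ler_wpM2l => //; exact: sqr_ge0.
  have s1 := sqr_ge0 (w - 189 / 100); have s2 := sqr_ge0 (w - 1).
  by split; move: E w3' s1 s2 w1; clear; nra.
- have E : 525 / 1000 * (5 + w) * (eta * (w ^+ 2 + 1)) <= 525 / 1000 * (5 + w) * (10 / 234 * (w ^+ 2 + 1)).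
    apply: ler_wpM2l; first by move: w0; clear; lra.
    by apply: ler_wpM2r => //; rewrite addr_ge0 ?sqr_ge0.
  have w3' : w ^+ 2 * w <= w ^+ 2 * 10 by apply: ler_wpM2l => //; exact: sqr_ge0.
  have s1 : 0 <= (w - 3) * w by apply: mulr_ge0 => //; move: w3; clear; lra.
  by split; move: E w3' s1 w3; clear; nra.
- have E : 525 / 1000 * (5 + w) * (eta * (w ^+ 2 + 1)) <= 525 / 1000 * (5 + w) * (w + 1).
    apply: ler_wpM2l; first by move: w0; clear; lra.
    have -> : eta * (w ^+ 2 + 1) = eta * w * w + eta by ring.
    by have := ler_wpM2r w0 ew; move: e1; clear; lra.
  have s1 : 0 <= (w - 10) * w by apply: mulr_ge0 => //; move: w10; clear; lra.
  by split; move: E s1 w10; clear; nra.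
Qed.

(** When the weight of the first axis is the smaller one, [G = exp (X - t)]
  has to beat a factor close to 2 that is lost as [p] tends to 1; but [p] is
  then large, hence [X] is close to [B] and [G] is larger. *)
Lemma poly_largeB (p eta G : R) : 0 <= p -> p <= 1 -> 0 <= eta -> eta <= 10 / 234 ->
  (p <= 4 / 10 -> 235 / 10 <= G) -> (4 / 10 <= p -> 485 / 10 <= G) ->
  315 / 100 * (1 + 2 * p + eta + 3 / 540) <= G / 2 * (1 - (p + eta + 2 / 540) / 2).
Proof.
move=> p0 p1 e0 e1 H1 H2.
have k : 0 <= 1 - (p + eta + 2 / 540) / 2 by lra.
have [p4|p4] := leP p (4 / 10).
  have := ler_wpM2r k (H1 p4); lra.
have := ler_wpM2r k (H2 (ltW p4)); lra.
Qed.

(** Phases between 4 and [B]. The growth of the hyperbolic cosines wins over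
  [exp t], since [t] is at most [X ^ 2 / (3 B)] and [X] at most [B]. The two
  bounds serve according to which of the weights of the axes 1 and 2 is
  smaller. *)
Lemma shell_large B x y : 51 / 8 <= B -> 0 <= y -> y <= x -> 4 <= x + y -> x + y <= B ->
  let q := expR (- B) in
  let c1 := ch (x + y) in let c2 := ch x in let c3 := ch y in
  let t := (x ^+ 2 + x * y + y ^+ 2) / (3 * B) in
  let K := 1 + 2 * q * (c1 + c2 + c3) in
  [/\ 315 / 100 * expR t * K <= c2 * (1 + 2 / 3 * q * c1) + 2 * (c3 * (1 + 2 / 3 * q * c1)),
      315 / 100 * expR t * K <= c1 * (1 - q * (c2 + c3)) + 2 * (c3 * (1 + 2 / 3 * q * c1)),
      c3 * (1 + 2 / 3 * q * c1) <= c2 * (1 + 2 / 3 * q * c1) &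
      c3 * (1 + 2 / 3 * q * c1) <= c1 * (1 - q * (c2 + c3))].
Proof.
move=> B0 y0 yx X4 XB q c1 c2 c3 t K.
pose X := x + y; pose d := (x - y) / 2.
have [q0 [_ q1]] := expRN_B B0; rewrite -/q in q0 q1.
have x0 : 0 <= x := le_trans y0 yx.
pose p := expR (X - B); pose eta := expR (X / 2 - B); pose w := expR d.
have p0 : 0 < p := expR_gt0 _. have e0 : 0 < eta := expR_gt0 _. have w0 : 0 < w := expR_gt0 _.
have p1 : p <= 1 by rewrite /p expR_le1; move: XB; rewrite /X; clear; lra.
have w1 : 1 <= w by have := expR_ge1Dx d; move: yx; rewrite /w /d; clear; move: (expR _) => E; lra.
have e1 : eta <= 10 / 234.
  have h : eta <= expR (- (51 / 16)) by rewrite /eta ler_expR; move: XB B0; rewrite /X; clear; lra.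
  apply: le_trans h _; have := expRxMexpNx_1 (51 / 16 : R); have := @expR_31875 R.
  have := expR_gt0 (- (51 / 16) : R); clear.
  by move: (expR (51 / 16)) (expR (- (51 / 16))) => E F F0 E0 EF; nra.
have ew : eta * w <= 1.
  by rewrite /eta /w -expRD expR_le1; move: XB y0; rewrite /X /d; clear; lra.
have ex : expR x = expR (X / 2) * w by rewrite -expRD; congr expR; rewrite /X /d; field.
have ey : expR y = expR (X / 2) / w by rewrite -expRB; congr expR; rewrite /X /d; field.
have H0 : 0 < expR (X / 2) := expR_gt0 _.
have etaE : eta = q * expR (X / 2) by rewrite /eta /q -expRD addrC.
have pE : p = q * expR X by rewrite /p /q -expRD addrC.
have small (z : R) : 0 <= z -> 0 <= q * expR (- z) <= 1 / 540.
  move=> z0; rewrite mulr_ge0 ?expR_ge0 ?(ltW q0)//=; apply: le_trans q1.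
  by rewrite ler_piMr ?(ltW q0)// expR_le1 oppr_le0.
have X0 : 0 <= X by rewrite addr_ge0.
have /andP[n1 n1'] := small _ X0; have /andP[n2 n2'] := small _ x0; have /andP[n3 n3'] := small _ y0.
have qc1 : 2 * q * c1 = p + q * expR (- X) by rewrite pE /c1 /ch -/X; field.
have qc2 : 2 * q * c2 = eta * w + q * expR (- x) by rewrite etaE /c2 /ch ex; field.
have qc3 : 2 * q * c3 = eta / w + q * expR (- y) by rewrite etaE /c3 /ch ey; field; rewrite gt_eqF.
have c21 : 1 <= c2 := ch_ge1 _. have c31 : 1 <= c3 := ch_ge1 _. have c11 : 1 <= c1 := ch_ge1 _.
have iw : 0 < w^-1 by rewrite invr_gt0.
have iw1 : w^-1 <= 1 by rewrite invf_le1.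
have ew1 : eta / w <= eta by rewrite ler_piMr// ltW.
have ew0 : 0 <= eta / w by rewrite mulr_ge0// ltW.
have LaE : x ^+ 2 + x * y + y ^+ 2 = 3 / 4 * X ^+ 2 + d ^+ 2 by rewrite /X /d; field.
have B3 : 0 < 3 * B by move: B0; clear; lra.
have Bn : B != 0 by rewrite gt_eqF//; move: B0; clear; lra.
have tE : t = X ^+ 2 / (4 * B) + d ^+ 2 / (3 * B).
  by rewrite /t LaE; field.
have d0 : 0 <= d by move: yx; rewrite /d; clear; lra.
(* [d <= B / 2] as the largest phase is at most [B]; convexity then bounds the factor by a chord *)
have td : d ^+ 2 / (3 * B) <= d / 6.
  rewrite ler_pdivrMr// expr2; have dB : d <= B / 2 by move: XB y0; rewrite /X /d; clear; lra.
  by have := ler_wpM2l d0 dB; clear; lra.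
have tX : t <= X ^+ 2 / (3 * B).
  rewrite /t ler_wpM2r ?invr_ge0 ?(ltW B3)//.
  by have := mulr_ge0 x0 y0; rewrite /X sqrrD; clear; lra.
have E0 := expR_gt0 (X ^+ 2 / (4 * B)).
have Et : expR t <= expR (X ^+ 2 / (4 * B)) * ((5 + w) / 6).
  rewrite tE expRD ler_pM2l//.
  have s01 : 0 <= (1 / 6 : R) <= 1 by apply/andP; split; clear; lra.
  have := expR_chord d s01; rewrite -/w; have : expR (d ^+ 2 / (3 * B)) <= expR (1 / 6 * d).
    by rewrite ler_expR; move: td; clear; lra.
  by clear; move: (expR _) (expR _) => F G; lra.
have EX : 394 / 100 * expR (X ^+ 2 / (4 * B)) <= expR (X / 2).
  apply: (@le_trans _ _ (expR (13725 / 10000) * expR (X ^+ 2 / (4 * B)))).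
    by rewrite ler_pM2r//; exact: expR_13725.
  by rewrite -expRD ler_expR; apply: exponent1.
have nX := expR_ge0 (- X). have nx := expR_ge0 (- x). have ny := expR_ge0 (- y).
have KA : K <= 1 + p + eta * (w + w^-1) + 1 / 180.
  rewrite /K !mulrDr qc1 qc2 qc3; move: n1' n2' n3'; clear.
  by move: (eta / w) (eta * w) (q * expR (- X)) (q * expR (- x)) (q * expR (- y)) => *; lra.
have K0 : 0 < K by rewrite /K !mulrDr qc1 qc2 qc3; move: n1 n2 n3 p0 ew0 (mulr_gt0 e0 w0); clear;
  move: (eta / w) (eta * w) (q * expR (- X)) (q * expR (- x)) (q * expR (- y)) => *; lra.
have Cge (z : R) : expR z / 2 <= ch z by rewrite /ch; have := expR_ge0 (- z); clear; move: (expR _) (expR _) => F G; lra.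
have A1 : 315 / 100 * expR t * K <= (c2 + 2 * c3) * (1 + 2 / 3 * q * c1).
  have PA := poly_largeA w1 (ltW p0) p1 (ltW e0) e1 ew.
  apply: (@le_trans _ _ (expR (X ^+ 2 / (4 * B)) * (197 / 100 * (w ^+ 2 + 2) * (1 + p / 3) / w))).
    apply: (@le_trans _ _ (expR (X ^+ 2 / (4 * B)) * (315 / 100 * ((5 + w) / 6) * (w * (1 + p + 1 / 180) + eta * (w ^+ 2 + 1)) / w))); last first.
      by rewrite ler_pM2l// ler_pM2r.
    have -> : (w * (1 + p + 1 / 180) + eta * (w ^+ 2 + 1)) = (1 + p + eta * (w + w^-1) + 1 / 180) * w.
      by field; rewrite gt_eqF.
    have -> : 315 / 100 * ((5 + w) / 6) * ((1 + p + eta * (w + w^-1) + 1 / 180) * w) / w =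
      315 / 100 * ((5 + w) / 6) * (1 + p + eta * (w + w^-1) + 1 / 180).
      by rewrite mulrA mulfK// gt_eqF.
    have -> : expR (X ^+ 2 / (4 * B)) * (315 / 100 * ((5 + w) / 6) * (1 + p + eta * (w + w^-1) + 1 / 180)) =
      315 / 100 * (expR (X ^+ 2 / (4 * B)) * ((5 + w) / 6)) * (1 + p + eta * (w + w^-1) + 1 / 180) by ring.
    apply: ler_pM; [by apply: mulr_ge0; [clear; lra|exact: expR_ge0]|exact: ltW| |exact: KA].
    by apply: ler_wpM2l; [clear; lra|exact: Et].
  have c23 : expR (X / 2) * (w + 2 / w) / 2 <= c2 + 2 * c3.
    have := Cge x; have := Cge y; rewrite ex ey -/c2 -/c3; clear.
    have -> : expR (X / 2) * (w + 2 / w) / 2 = expR (X / 2) * w / 2 + 2 * (expR (X / 2) / w / 2) by ring.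
    by move: (expR (X / 2) * w) (expR (X / 2) / w) => F G; lra.
  have ww0 : 0 <= w + 2 / w by rewrite addr_ge0 ?(ltW w0)// mulr_ge0// ltW.
  have p30 : 0 <= 1 + p / 3 by move: p0; clear; lra.
  apply: (@le_trans _ _ (expR (X / 2) * (w + 2 / w) / 2 * (1 + p / 3))).
    have := ler_wpM2r (mulr_ge0 ww0 p30) EX.
    have -> : 197 / 100 * (w ^+ 2 + 2) * (1 + p / 3) / w = 197 / 100 * ((w + 2 / w) * (1 + p / 3)).
      by field; rewrite gt_eqF.
    have -> : expR (X / 2) * (w + 2 / w) / 2 * (1 + p / 3) =
      expR (X / 2) * ((w + 2 / w) * (1 + p / 3)) / 2 by ring.
    by clear; move: ((w + 2 / w) * (1 + p / 3)) (expR (X / 2)) (expR _) => *; lra.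
  apply: ler_pM => //.
    by rewrite mulr_ge0 ?invr_ge0// mulr_ge0// ltW.
  have -> : 2 / 3 * q * c1 = (2 * q * c1) / 3 by field.
  by rewrite qc1; move: n1; clear; move: (q * _) => *; lra.
have c1X : expR X / 2 <= c1 := Cge X.
have c2c1 : 2 * q * c2 <= p + 1 / 540.
  rewrite qc2 /eta /p /w -expRD; have h : expR (X / 2 - B + d) <= expR (X - B).
    by rewrite ler_expR; move: y0; rewrite /X /d; clear; lra.
  by move: h n2'; clear; move: (expR _) (expR _) (q * _) => *; lra.
have KB : K <= 1 + 2 * p + eta + 3 / 540.
  rewrite /K !mulrDr qc1 qc3; move: n1' n3' c2c1 ew1; clear.
  by move: (eta / w) (2 * q * c2) (q * expR (- X)) (q * expR (- y)) => *; lra.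
have N1 : 1 - (p + eta + 2 / 540) / 2 <= 1 - q * (c2 + c3).
  have -> : q * (c2 + c3) = (2 * q * c2 + 2 * q * c3) / 2 by field.
  rewrite qc3; move: n3' c2c1 ew1; clear.
  by move: (eta / w) (2 * q * c2) (q * expR (- y)) => *; lra.
pose G := expR (X - t).
have G1 : p <= 4 / 10 -> 235 / 10 <= G.
  move=> _; apply: (le_trans (@expR_316 R)); rewrite /G ler_expR.
  by have := exponent2 B0 X4 XB; move: tX; rewrite -/X; clear; lra.
have G2 : 4 / 10 <= p -> 485 / 10 <= G.
  move=> p4; apply: (le_trans (@expR_389 R)); rewrite /G ler_expR.
  have XB2 : B - 92 / 100 <= X.
    rewrite leNgt; apply/negP => XB2; have : p < expR (- (92 / 100)) by rewrite /p ltr_expR; move: XB2; clear; lra.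
    have := expRxMexpNx_1 (92 / 100 : R); have := @expR_92 R; have := expR_gt0 (- (92 / 100) : R).
    by move: p4; clear; move: (expR (- (92 / 100))) (expR (92 / 100)) => F E *; nra.
  by have := exponent3 B0 XB2 XB; move: tX; rewrite -/X; clear; lra.
have PB := poly_largeB (ltW p0) p1 (ltW e0) e1 G1 G2.
have k0 : 0 <= 1 - (p + eta + 2 / 540) / 2 by move: p1 e1; clear; lra.
have GE : expR t * (G / 2) = expR X / 2.
  by rewrite mulrA /G -expRD; congr (expR _ / 2); ring.
have A2 : 315 / 100 * expR t * K <= c1 * (1 - q * (c2 + c3)).
  apply: (@le_trans _ _ (expR X / 2 * (1 - (p + eta + 2 / 540) / 2))); last first.
    by apply: ler_pM => //; rewrite divr_ge0// expR_ge0.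
  rewrite -GE -[leRHS]mulrA.
  apply: le_trans (ler_wpM2l (expR_ge0 t) PB).
  have -> : 315 / 100 * expR t * K = expR t * (315 / 100 * K) by ring.
  by rewrite ler_pM2l ?expR_gt0//; apply: ler_wpM2l; [clear; lra|exact: KB].
have c32 : c3 <= c2 := ch_le y0 yx.
have c10 : 0 <= c1 by apply: le_trans c11.
have c30 : 0 <= c3 by apply: le_trans c31.
have l0 : 0 <= 1 + 2 / 3 * q * c1.
  apply: addr_ge0 => //; apply: mulr_ge0 => //; apply: mulr_ge0 (ltW q0); clear; lra.
split.
- by apply: le_trans A1 _; rewrite le_eqVlt; apply/orP; left; apply/eqP; ring.
- by apply: le_trans A2 _; rewrite lerDl; apply: mulr_ge0 => //; exact: mulr_ge0.
- exact: ler_wpM2r.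
- have h7 : 57 / 10 <= expR (X / 2).
    apply: (@le_trans _ _ (expR 2)); first by have := @expR_ge_taylor5 R 2; clear; lra.
    by rewrite ler_expR; move: X4; rewrite -/X; clear; lra.
  have c3X : c3 <= expR (X / 2).
    apply: (@le_trans _ _ (expR y)); last by rewrite ler_expR /X; move: yx; clear; lra.
    have : expR (- y) <= expR y by rewrite ler_expR; move: y0; clear; lra.
    by rewrite /c3 /ch; clear; move: (expR (- y)) (expR y) => *; lra.
  have XX : expR X = expR (X / 2) * expR (X / 2) by rewrite -expRD; congr expR; field.
  have l1 : 1 + 2 / 3 * q * c1 <= 134 / 100.
    have -> : 2 / 3 * q * c1 = (2 * q * c1) / 3 by field.
    by rewrite qc1; move: n1' p1; clear; move: (q * _) => *; lra.
  have l2 : 475 / 1000 <= 1 - q * (c2 + c3) by move: N1 p1 e1; clear; lra.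
  apply: (@le_trans _ _ (expR (X / 2) * (134 / 100))).
    exact: ler_pM.
  apply: (@le_trans _ _ (expR X / 2 * (475 / 1000))); last first.
    by apply: ler_pM; [rewrite divr_ge0// expR_ge0|clear; lra|exact: c1X|exact: l2].
  by rewrite XX; move: h7 H0; clear; move: (expR (X / 2)) => E *; nra.
Qed.

End ShellLarge.

Section ShellFinal.
Context {R : realType}.

(** [exp t] times the contribution to [F (k)] of the origin and the first
  shell, for [t = B |k| ^ 2]; the [a_j] are the components of the direction
  along the three axes and the [s_j] the phases of the wave vector along them. *)
Definition shell_energy (B tau a1 a2 a3 s1 s2 s3 : R) : R :=
  tau ^+ 2 + 2 * expR (- B) * ((a1 ^+ 2 + tau ^+ 2) * ch s1 - 2 * tau * a1 * sh s1 +
     ((a2 ^+ 2 + tau ^+ 2) * ch s2 - 2 * tau * a2 * sh s2) +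
     ((a3 ^+ 2 + tau ^+ 2) * ch s3 - 2 * tau * a3 * sh s3)).

(** The value 2 is the contribution of the shell at [k = 0]; the second term
  is the surplus, which has to pay for all the other shells. *)
Definition shell_gain (B a1 a2 a3 s1 s2 s3 : R) : R :=
  expR (- B) * (a1 ^+ 2 + a2 ^+ 2 + a3 ^+ 2) *
  (2 + Num.min ((s1 ^+ 2 + s2 ^+ 2 + s3 ^+ 2) / (6 * B)) 1 / 10).

Lemma shell_sorted (B tau a1 a2 a3 s1 s2 s3 : R) : 51 / 8 <= B -> a1 + a2 + a3 = 0 ->
  `|s3| <= `|s2| -> `|s1| = `|s2| + `|s3| -> `|s1| <= B ->
  shell_gain B a1 a2 a3 s1 s2 s3 * expR ((s1 ^+ 2 + s2 ^+ 2 + s3 ^+ 2) / (6 * B)) <=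
  shell_energy B tau a1 a2 a3 s1 s2 s3.
Proof.
move=> B0 a0 s32 s1E s1B.
have Bn : B != 0 by rewrite gt_eqF//; move: B0; clear; lra.
have c1E : ch s1 = ch (`|s2| + `|s3|) by rewrite -s1E ch_norm.
have c2E : ch s2 = ch `|s2| by rewrite ch_norm. have c3E : ch s3 = ch `|s3| by rewrite ch_norm.
have tE : (s1 ^+ 2 + s2 ^+ 2 + s3 ^+ 2) / (6 * B) =
    (`|s2| ^+ 2 + `|s2| * `|s3| + `|s3| ^+ 2) / (3 * B).
  have -> : s1 ^+ 2 = (`|s2| + `|s3|) ^+ 2 by rewrite -s1E real_normK ?num_real.
  rewrite -(@real_normK _ s2) ?num_real// -(@real_normK _ s3) ?num_real//.
  by field.
rewrite /shell_gain tE; move: (normr_ge0 s3) s32; rewrite s1E in s1B.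
have y0 := normr_ge0 s3.
set x := `|s2| in c1E c2E s1B *; set y := `|s3| in c1E c3E s1B y0 *.
set t := _ / (3 * B) => _ yx.
have x0 : 0 <= x := le_trans y0 yx.
have t0 : 0 <= t.
  rewrite /t mulr_ge0 ?invr_ge0//; last by move: B0; clear; lra.
  by rewrite !addr_ge0 ?mulr_ge0 ?sqr_ge0.
set q := expR (- B); have q0 : 0 < q := expR_gt0 _.
have A0 : 0 <= a1 ^+ 2 + a2 ^+ 2 + a3 ^+ 2 by rewrite !addr_ge0 ?sqr_ge0.
have m0 : 0 <= Num.min t 1 by rewrite le_min t0 ler01.
have mt : Num.min t 1 <= t by rewrite ge_min lexx.
have m1 : Num.min t 1 <= 1 by rewrite ge_min lexx orbT.
have c32 : ch s3 <= ch s2 by rewrite c2E c3E; exact: ch_le.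
have c21 : ch s2 <= ch s1 by rewrite c2E c1E; apply: ch_le => //; rewrite lerDl.
have E0 := expR_gt0 t.
move: (Num.min t 1) m0 mt m1 => m m0 mt m1.
have [x4|x4] := leP (x + y) 4.
- have H1 := shell_min1 tau a1 a2 a3 q0 (ch_ge1 s1) (ch_ge1 s2) (ch_ge1 s3)
     (sh_sqr s1) (sh_sqr s2) (sh_sqr s3).
  apply: le_trans H1.
  have H2 := shell_small B0 y0 yx x4 m0 mt.
  rewrite -c1E -c2E -c3E -/t -/q in H2.
  have W := weights_min a0 c21 (lexx _) c32.
  set D := 1 + 2 * q * _ in H2 *.
  have D0 : 0 < D.
    apply: ltr_pwDl => //; apply: mulr_ge0; first by apply: mulr_ge0 => //; exact: ltW.
    by apply: addr_ge0; [apply: addr_ge0|]; apply: sub_inv_ge0; exact: ch_ge1.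
  rewrite ler_pdivlMr//.
  have k : 0 <= 2 * q by rewrite mulr_ge0// ltW.
  apply: le_trans (ler_wpM2l k W).
  have k2 : 0 <= 2 * q * ((a1 ^+ 2 + a2 ^+ 2 + a3 ^+ 2) / 3) by rewrite mulr_ge0// divr_ge0.
  have := ler_wpM2l k2 H2; clear; lra.
have H1 := shell_min2 tau a1 a2 a3 q0 (ch_ge1 s1) (ch_ge1 s2) (ch_ge1 s3)
     (sh_sqr s1) (sh_sqr s2) (sh_sqr s3).
apply: le_trans H1.
have [L1 L2 L3 L4] := shell_large B0 y0 yx (ltW x4) s1B.
rewrite -c1E -c2E -c3E -/t -/q in L1 L2 L3 L4.
set N1 := ch s1 * _ in L2 L4 *; set N2 := ch s2 * _ in L1 L3 *.
set N3 := ch s3 * _ in L1 L2 L3 L4 *; set K := 1 + 2 * q * _ in L1 L2 *.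
have K0 : 0 < K.
  have cp (s : R) : 0 <= ch s := le_trans ler01 (ch_ge1 s).
  apply: ltr_pwDl => //; apply: mulr_ge0; first by apply: mulr_ge0 => //; exact: ltW.
  by apply: addr_ge0 => //; exact: addr_ge0.
pose M := Num.min N1 N2.
have W : (a1 ^+ 2 + a2 ^+ 2 + a3 ^+ 2) / 3 * (M + 2 * N3) <= a1 ^+ 2 * N1 + a2 ^+ 2 * N2 + a3 ^+ 2 * N3.
  by apply: weights_min => //; rewrite /M ?ge_min ?lexx ?orbT// le_min L3 L4.
have L : 315 / 100 * expR t * K <= M + 2 * N3.
  rewrite /M; case: (leP N1 N2) => _; [exact: L2|exact: L1].
rewrite ler_pdivlMr//.
have k : 0 <= 2 * q by rewrite mulr_ge0// ltW.
apply: le_trans (ler_wpM2l k W).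
have k2 : 0 <= 2 * q * ((a1 ^+ 2 + a2 ^+ 2 + a3 ^+ 2) / 3) by rewrite mulr_ge0// divr_ge0.
have L' : (3 + 15 / 100 * m) * expR t * K <= 315 / 100 * expR t * K.
  by rewrite ler_pM2r// ler_pM2r//; move: m1; clear; lra.
have := ler_wpM2l k2 (le_trans L' L); clear; lra.
Qed.

(** The three phases add up to 0, so the largest one is the sum of the two
  others in absolute value; the expressions are symmetric in the axes. *)
Lemma shell_symm (B tau a1 a2 a3 s1 s2 s3 : R) : 51 / 8 <= B -> a1 + a2 + a3 = 0 ->
  s1 + s2 + s3 = 0 -> `|s1| <= B -> `|s2| <= B -> `|s3| <= B ->
  shell_gain B a1 a2 a3 s1 s2 s3 * expR ((s1 ^+ 2 + s2 ^+ 2 + s3 ^+ 2) / (6 * B)) <=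
  shell_energy B tau a1 a2 a3 s1 s2 s3.
Proof.
move=> B0.
(* the largest of the three phases is the sum of the other two in absolute value *)
have two (b1 b2 b3 r1 r2 r3 : R) : b1 + b2 + b3 = 0 -> r1 + r2 + r3 = 0 -> `|r1| <= B ->
    `|r2| <= `|r1| -> `|r3| <= `|r1| ->
  shell_gain B b1 b2 b3 r1 r2 r3 * expR ((r1 ^+ 2 + r2 ^+ 2 + r3 ^+ 2) / (6 * B)) <=
  shell_energy B tau b1 b2 b3 r1 r2 r3.
  move=> b0 r0 r1B r21 r31.
  have r1E : `|r1| = `|r2| + `|r3|.
    have r1N : r1 = - (r2 + r3) by move: r0; clear; lra.
    move: r21 r31; rewrite r1N normrN; clear.
    by case: (ger0P r2); case: (ger0P r3); case: (ger0P (r2 + r3)); lra.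
  have [r32|r32] := leP `|r3| `|r2|; first exact: shell_sorted.
  have := @shell_sorted B tau b1 b3 b2 r1 r3 r2 B0 _ (ltW r32) _ r1B.
  have -> : shell_gain B b1 b3 b2 r1 r3 r2 = shell_gain B b1 b2 b3 r1 r2 r3.
    by rewrite /shell_gain; do 2 rewrite [X in _ * X * _]addrAC ?[_ + _ + r2 ^+ 2]addrAC.
  have -> : shell_energy B tau b1 b3 b2 r1 r3 r2 = shell_energy B tau b1 b2 b3 r1 r2 r3.
    by rewrite /shell_energy; ring.
  have -> : r1 ^+ 2 + r3 ^+ 2 + r2 ^+ 2 = r1 ^+ 2 + r2 ^+ 2 + r3 ^+ 2 by rewrite addrAC.
  by apply; [rewrite addrAC|rewrite addrC].
move=> a0 s0 s1B s2B s3B.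
have g1 : shell_gain B a2 a1 a3 s2 s1 s3 = shell_gain B a1 a2 a3 s1 s2 s3.
  by rewrite /shell_gain (addrC (a2 ^+ 2) (a1 ^+ 2)) (addrC (s2 ^+ 2) (s1 ^+ 2)).
have e1 : shell_energy B tau a2 a1 a3 s2 s1 s3 = shell_energy B tau a1 a2 a3 s1 s2 s3.
  by rewrite /shell_energy; ring.
have g2 : shell_gain B a3 a1 a2 s3 s1 s2 = shell_gain B a1 a2 a3 s1 s2 s3.
  by rewrite /shell_gain -(addrA (a3 ^+ 2)) -(addrA (s3 ^+ 2)) (addrC (a3 ^+ 2)) (addrC (s3 ^+ 2)).
have e2 : shell_energy B tau a3 a1 a2 s3 s1 s2 = shell_energy B tau a1 a2 a3 s1 s2 s3.
  by rewrite /shell_energy; ring.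
have [s21|s12] := leP `|s2| `|s1|.
  have [s31|s13] := leP `|s3| `|s1|; first exact: two.
  have := @two a3 a1 a2 s3 s1 s2; rewrite g2 e2.
  have -> : s3 ^+ 2 + s1 ^+ 2 + s2 ^+ 2 = s1 ^+ 2 + s2 ^+ 2 + s3 ^+ 2 by ring.
  by apply => //; lra.
have [s32|s23] := leP `|s3| `|s2|.
  have := @two a2 a1 a3 s2 s1 s3; rewrite g1 e1 (addrC (s2 ^+ 2) (s1 ^+ 2)).
  by apply => //; lra.
have := @two a3 a1 a2 s3 s1 s2; rewrite g2 e2.
have -> : s3 ^+ 2 + s1 ^+ 2 + s2 ^+ 2 = s1 ^+ 2 + s2 ^+ 2 + s3 ^+ 2 by ring.
by apply => //; lra.
Qed.

End ShellFinal.

(** * Positivity of the dual sum on the hexagonal cell *)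
Section DualPositivity.
Context {R : realType}.
Implicit Types z w s t : R.
Implicit Types (u : int * int).

(** With [F = exp (- s)] this is a quadratic inequality in [F], and [F] is
  bounded below by its cubic Taylor polynomial. *)
Lemma inv_ch_ge (s : R) : 1 - s ^+ 2 / 2 <= (ch s)^-1.
Proof.
rewrite -ch_norm -(@real_normK _ s) ?num_real//; move: (normr_ge0 s); move: `|s| => x x0 {s}.
have c1 := ch_ge1 x; have c0 : 0 < ch x := lt_le_trans ltr01 c1.
have [h|h] := leP 2 (x ^+ 2).
  by apply: (@le_trans _ _ 0); [move: h; clear; lra|rewrite invr_ge0 ltW].
rewrite -[leRHS]mul1r ler_pdivlMr//.
have [_ h3 _] := expRN_taylor_pos x0.
have F1 : expR (- x) <= 1 by rewrite -expR0 ler_expR; lra.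
have EF := expRxMexpNx_1 x; have E0 := expR_gt0 x; have F0 := expR_gt0 (- x).
rewrite /ch; clear c1 c0.
move: (expR x) (expR (- x)) h3 F1 EF E0 F0 => E F h3 F1 EF E0 F0.
have k : (1 - x ^+ 2 / 2) * (1 + F ^+ 2) <= 2 * F.
  set L := 1 - x + x ^+ 2 / 2 - x ^+ 3 / 6 in h3.
  have kL : (1 - x ^+ 2 / 2) * (1 + L ^+ 2) <= 2 * L.
    rewrite -subr_ge0.
    have -> : 2 * L - (1 - x ^+ 2 / 2) * (1 + L ^+ 2) =
       (x ^+ 2) ^+ 2 * (30 - 36 * x + 19 * x ^+ 2 - 6 * x ^+ 3 + x ^+ 4) / 72.
      by rewrite /L; field.
    apply: divr_ge0 => //; apply: mulr_ge0; first exact: sqr_ge0.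
    have x2 : x <= 15 / 10 by move: x0 h; clear; nra.
    have -> : 30 - 36 * x + 19 * x ^+ 2 - 6 * x ^+ 3 + x ^+ 4 =
      (x ^+ 2 - 3 * x + 4) ^+ 2 + 2 * ((3 - x) ^+ 2 - 2) by ring.
    apply: addr_ge0; first exact: sqr_ge0.
    move: x0 x2; clear; nra.
  have g : 0 <= (F - L) * (2 - (1 - x ^+ 2 / 2) * (F + L)).
    apply: mulr_ge0; first exact: h3.
    have : 0 <= (x ^+ 2 / 2) by rewrite divr_ge0 ?sqr_ge0//.
    move: h3 F1 h F0; clear; move: L => L; set y := x ^+ 2 / 2 => LF F1 h F0 y0.
    have y1 : y <= 1 by rewrite /y; lra.
    by nra.
  by move: g kL; clear; lra.
have e : (1 - x ^+ 2 / 2) * ((E + F) / 2) = ((1 - x ^+ 2 / 2) * (1 + F ^+ 2)) * E / 2.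
  have -> : (1 - x ^+ 2 / 2) * (1 + F ^+ 2) * E / 2 = (1 - x ^+ 2 / 2) * (E + F * (E * F)) / 2 by field.
  by rewrite EF; field.
rewrite e; have := ler_wpM2r (ltW E0) k; rewrite -(mulrA 2) (mulrC F) EF.
clear; lra.
Qed.

(** Minimising over [tau] leaves [a ^ 2 / cosh s]; a pair of opposite points
  loses at most the fraction [t + s ^ 2 / 2] of its value at [k = 0]. *)
Lemma pair_loss (t s a tau : R) : 0 <= t -> 
  a ^+ 2 * (1 - Num.min (t + s ^+ 2 / 2) 1) <=
  expR (- t) * ((a ^+ 2 + tau ^+ 2) * ch s - 2 * tau * a * sh s).
Proof.
move=> t0; have c1 := ch_ge1 s; have c0 : 0 < ch s := lt_le_trans ltr01 c1.
have ss := sh_sqr s.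
have h : a ^+ 2 * (ch s)^-1 <= (a ^+ 2 + tau ^+ 2) * ch s - 2 * tau * a * sh s.
  rewrite -subr_ge0.
  have -> : (a ^+ 2 + tau ^+ 2) * ch s - 2 * tau * a * sh s - a ^+ 2 * (ch s)^-1 =
    (tau * ch s - a * sh s) ^+ 2 / ch s + a ^+ 2 * (ch s ^+ 2 - 1 - sh s ^+ 2) / ch s.
    by field; rewrite gt_eqF.
  by rewrite ss subrr mulr0 mul0r addr0 divr_ge0 ?sqr_ge0// ltW.
apply: le_trans (ler_wpM2l (expR_ge0 (- t)) h).
rewrite mulrCA ler_wpM2l ?sqr_ge0//.
have i0 : 0 <= (ch s)^-1 by rewrite invr_ge0 ltW.
have i1 := inv_ch_ge s; have e1 := expR_ge1Dx (- t); have e0 := expR_ge0 (- t).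
have e2 : expR (- t) <= 1 by rewrite -expR0 ler_expR; lra.
have s0 : 0 <= s ^+ 2 / 2 by rewrite divr_ge0 ?sqr_ge0.
move: i0 i1 e0 e1 e2 s0; clear -t0; move: (s ^+ 2 / 2) (ch s)^-1 (expR _) => x i e i0 i1 e0 e1 e2 x0.
have [h|h] := leP (t + x) 1; last by rewrite subrr mulr_ge0.
by nra.
Qed.

Lemma expR_996 : 15000 <= expR (996 / 100) :> R.
Proof. by apply: (le_trans _ (@expR_ge_pow _ _ 8 (34 / 10) isT _ _)); lra. Qed.

Lemma expR_06975 : 2 <= expR (6975 / 10000) :> R.
Proof. by apply: (le_trans _ (@expR_ge_pow _ _ 1 2 isT _ _)); lra. Qed.

(** Beyond the first shell the squared norm [n] is at least 3, and the decay
  [exp (- B (n - 1))] leaves room for a geometric factor that is easy to sum. *)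
Lemma outer_decay (B n : R) (k : nat) : 51 / 8 <= B -> 3 <= n -> k%:R <= 4 / 3 * n ->
  expR (- (B * n)) * n * (1 + 2 * B * n) <= 8 / 1000 * expR (- B) * (1 / 2) ^+ k.
Proof.
move=> B0 n0 kn.
have h2 : 2 ^+ k <= expR (93 / 100 * n).
  apply: (@le_trans _ _ (expR (6975 / 10000) ^+ k)).
    by rewrite lerXn2r ?nnegrE ?expR_ge0 ?expR_06975.
  rewrite -expRM_natl ler_expR; move: kn; clear; lra.
have h3 : 125 * (n * (1 + 2 * B * n)) <= expR (B * (n - 1) - 93 / 100 * n).
  apply: (@le_trans _ _ (expR (996 / 100) * (expR (B - 51 / 8) * expR (n - 3) ^+ 2))); last first.
    rewrite -expRM_natl -!expRD ler_expR.
    have : 0 <= (B - 51 / 8) * (n - 3) by apply: mulr_ge0; lra.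
    move: B0 n0; clear; lra.
  have e1 := expR_996; have e2 := expR_ge1Dx (B - 51 / 8); have e3 := expR_ge1Dx (n - 3).
  apply: (@le_trans _ _ (15000 * ((1 + (B - 51 / 8)) * (1 + (n - 3)) ^+ 2))).
    move: B0 n0; clear.
    set b := B - 51 / 8; set m := n - 3 => b0 n0.
    have -> : B = b + 51 / 8 by rewrite /b; lra.
    have -> : n = m + 3 by rewrite /m; lra.
    have {}b0 : 0 <= b by rewrite /b; lra.
    have {}n0 : 0 <= m by rewrite /m; lra.
    have := mulr_ge0 b0 n0; have := mulr_ge0 n0 n0; have := mulr_ge0 b0 (mulr_ge0 n0 n0).
    move: b0 n0; clear; lra.
  apply: ler_pM; [by clear; lra| |exact: e1|].
  - by apply: mulr_ge0; [move: B0; clear; lra|exact: sqr_ge0].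
  - apply: ler_pM => //; first by move: B0; clear; lra.
      exact: sqr_ge0.
    have m0 : 0 <= 1 + (n - 3) by move: n0; clear; lra.
    by rewrite lerXn2r ?nnegrE ?expR_ge0.
have k0 : 0 < 2 ^+ k :> R by rewrite exprn_gt0.
rewrite (_ : (1 / 2) ^+ k = (2 ^+ k)^-1); last by rewrite mul1r exprVn.
rewrite ler_pdivlMr//.
have e : expR (- (B * n)) * (expR (B * (n - 1) - 93 / 100 * n) * expR (93 / 100 * n)) = expR (- B).
  by rewrite -!expRD; congr expR; ring.
have := expR_ge0 (- (B * n)) => q0.
have N0 : 0 <= n * (1 + 2 * B * n).
  by apply: mulr_ge0; [|apply: addr_ge0 => //; rewrite !mulr_ge0//]; move: B0 n0; clear; lra.
have h4 : (125 * (n * (1 + 2 * B * n))) * 2 ^+ k <= expR (B * (n - 1) - 93 / 100 * n) * expR (93 / 100 * n).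
  apply: ler_pM; [|exact: ltW|exact: h3|exact: h2].
  by apply: mulr_ge0; [clear; lra|exact: N0].
have := ler_wpM2l q0 h4; rewrite e; clear; lra.
Qed.

End DualPositivity.

Section DualCell.
Context {R : realType}.
Implicit Types z w : R.
Implicit Types (u : int * int).

Definition negz u : int * int := (- u.1, - u.2).

Lemma negzK : cancel negz negz. Proof. by case=> a b; rewrite /negz /= !opprK. Qed.

Lemma par_negz u : par (negz u) = par u :> R.
Proof. by rewrite /par /negz /= -opprD abszN. Qed.

(** Opposite dual points are paired, so that only even functions of the phase
  occur. *)
Definition dual_pair (B z w v1 v2 : R) u : R :=
  (dual_term B z w v1 v2 u + dual_term B z w v1 v2 (negz u)) / 2 - dual_term B 0 0 v1 v2 u.

Lemma dual_pair_sum (B z w v1 v2 : R) : 0 < B ->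
  abs_summable (dual_pair B z w v1 v2) /\ hsum (dual_pair B z w v1 v2) =
  hsum (dual_term B z w v1 v2) - hsum (dual_term B 0 0 v1 v2).
Proof.
move=> B0; have H := dual_summable z w v1 v2 B0; have H0 := dual_summable 0 0 v1 v2 B0.
have [H1 E1] := hsum_reindex negzK negzK H.
have H2 := abs_summableZ 2^-1 (abs_summableD H H1).
have e : dual_pair B z w v1 v2 = (fun u => 2^-1 * (dual_term B z w v1 v2 u +
   (dual_term B z w v1 v2 \o negz) u) - dual_term B 0 0 v1 v2 u).
  by apply/funext => u; rewrite /dual_pair mulrC.
rewrite e; split; first exact: abs_summableB.
rewrite hsumB// hsumZ; last exact: abs_summableD.
by rewrite hsumD// E1; field.
Qed.

Lemma dual_pairE (B z w v1 v2 : R) u :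
  let a := dualv 0 0 v1 v2 u in let tau := s3 * z * v1 + w * v2 in
  let s := B * (3 * z * u.1%:~R + w * u.2%:~R) in let t := B * (3 * z ^+ 2 + w ^+ 2) in
  dual_pair B z w v1 v2 u = par u * dgauss B 0 0 u *
  (expR (- t) * ((a ^+ 2 + tau ^+ 2) * ch s - 2 * tau * a * sh s) - a ^+ 2).
Proof.
move=> a tau s t; rewrite /dual_pair /dual_term par_negz.
have e1 : dgauss B z w u = dgauss B 0 0 u * expR (- t) * expR (- s).
  by rewrite -!expRD; congr expR; rewrite /dualX /dualY /t /s; field.
have e2 : dgauss B z w (negz u) = dgauss B 0 0 u * expR (- t) * expR s.
  by rewrite -!expRD; congr expR; rewrite /dualX /dualY /t /s /negz /= !mulrNz; field.
have d1 : dualv z w v1 v2 u = tau + a by rewrite /dualv /tau /a /dualv /dualX /dualY; ring.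
have d2 : dualv z w v1 v2 (negz u) = tau - a.
  by rewrite /dualv /tau /a /dualv /dualX /dualY /negz /= !mulrNz; ring.
by rewrite e1 e2 d1 d2 /ch /sh -/a; field.
Qed.

Lemma dualv_sqr_le v1 v2 u : dualv 0 0 v1 v2 u ^+ 2 <=
  (3 * u.1%:~R ^+ 2 + u.2%:~R ^+ 2) / 4 * (v1 ^+ 2 + v2 ^+ 2) :> R.
Proof.
rewrite -subr_ge0 /dualv /dualX /dualY !add0r.
have -> : (3 * u.1%:~R ^+ 2 + u.2%:~R ^+ 2) / 4 * (v1 ^+ 2 + v2 ^+ 2) -
  (s3 * (u.1%:~R / 2) * v1 + u.2%:~R / 2 * v2) ^+ 2 =
  (s3 * (u.1%:~R / 2) * v2 - u.2%:~R / 2 * v1) ^+ 2 +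
    (3 - s3 ^+ 2) * (v1 ^+ 2 + v2 ^+ 2) * (u.1%:~R / 2) ^+ 2 :> R by field.
by rewrite s3_sqr subrr !mul0r addr0 sqr_ge0.
Qed.

(** The loss of an outer pair, relative to the surplus of the first shell. *)
Lemma dual_outer (B z w v1 v2 : R) u : 51 / 8 <= B -> (12 <= 3 * u.1 ^+ 2 + u.2 ^+ 2)%R ->
  - ((8 / 1000 * expR (- B) * (v1 ^+ 2 + v2 ^+ 2) * Num.min (B * (3 * z ^+ 2 + w ^+ 2)) 1) *
     ((1 / 2) ^+ `|u.1|%N * (1 / 2) ^+ `|u.2|%N)) <= dual_pair B z w v1 v2 u.
Proof.
move=> B0 u12; rewrite dual_pairE.
set a := dualv _ _ _ _ _; set tau := _ + w * v2; set t := B * _; set s := B * _.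
have Bp : 0 < B by move: B0; clear; lra.
have zw0 : 0 <= 3 * z ^+ 2 + w ^+ 2 by apply: addr_ge0; [apply: mulr_ge0 => //|]; exact: sqr_ge0.
have t0 : 0 <= t by apply: mulr_ge0 => //; exact: ltW.
pose n : R := (3 * u.1%:~R ^+ 2 + u.2%:~R ^+ 2) / 4.
have n3 : 3 <= n.
  have : ((12 : int)%:~R <= (3 * u.1 ^+ 2 + u.2 ^+ 2)%:~R :> R) by rewrite ler_int.
  by rewrite /n [X in _ <= X]intrD intrM !rmorphXn /=; lra.
have n0 : 0 <= n by apply: le_trans n3; clear; lra.
have ks : (`|u.1|%N + `|u.2|%N)%:R <= 4 / 3 * n.
  have -> : (`|u.1|%N + `|u.2|%N)%:R = `|u.1%:~R| + `|u.2%:~R| :> R.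
    by rewrite natrD !natr_absz !intr_norm.
  have x0 := normr_ge0 (u.1%:~R : R); have y0 := normr_ge0 (u.2%:~R : R).
  have nE : n = (3 * `|u.1%:~R| ^+ 2 + `|u.2%:~R| ^+ 2) / 4 by rewrite /n !real_normK ?num_real.
  rewrite -(ler_pXn2r (isT : (0 < 2)%N)) ?nnegrE ?addr_ge0//; last by move: n3; clear; lra.
  move: nE n3; clear; move: n `|u.1%:~R| `|u.2%:~R| => n x y nE n3.
  have k : n * 3 <= n * n by rewrite ler_pM2l//; lra.
  have k2 : (x + y) ^+ 2 <= 16 / 3 * n.
    rewrite nE; have := sqr_ge0 (3 * x - y); lra.
  by apply: le_trans k2 _; lra.
have P := outer_decay B0 n3 ks.
have WE : dgauss B 0 0 u = expR (- (B * n)).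
  by rewrite /dgauss /dualX /dualY /n; congr expR; field.
have an : a ^+ 2 <= n * (v1 ^+ 2 + v2 ^+ 2) := dualv_sqr_le v1 v2 u.
have sn : s ^+ 2 / 2 <= 2 * B * n * t.
  have -> : 2 * B * n * t = B ^+ 2 * (2 * n * (3 * z ^+ 2 + w ^+ 2)) by rewrite /t; ring.
  have -> : s ^+ 2 / 2 = B ^+ 2 * ((3 * z * u.1%:~R + w * u.2%:~R) ^+ 2 / 2) by rewrite /s; field.
  rewrite ler_wpM2l ?sqr_ge0// /n; have := sqr_ge0 (u.2%:~R * z - u.1%:~R * w); lra.
have V0 : 0 <= v1 ^+ 2 + v2 ^+ 2 by rewrite addr_ge0 ?sqr_ge0.
have mm : Num.min (t + s ^+ 2 / 2) 1 <= (1 + 2 * B * n) * Num.min t 1.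
  have g1 : 1 <= 1 + 2 * B * n by rewrite lerDl mulr_ge0// mulr_ge0// ltW.
  rewrite ge_min; have [t1|t1] := leP t 1.
    by apply/orP; left; move: sn; clear; lra.
  by apply/orP; right; rewrite mulr1.
have m0 : 0 <= Num.min t 1 by rewrite le_min t0 ler01.
have L := pair_loss s a tau t0.
rewrite -/a -/tau -/s -/t.
set X := expR (- t) * _ in L *.
have W0 := expR_ge0 (- (B * n)).
rewrite WE -exprD; set Q := (1 / 2) ^+ _ in P *.
have h1 : - (a ^+ 2 * ((1 + 2 * B * n) * Num.min t 1)) <= X - a ^+ 2.
  have := ler_wpM2l (sqr_ge0 a) mm; move: L; clear; lra.
have Y0 : 0 <= (1 + 2 * B * n) * Num.min t 1.
  apply: le_trans mm; rewrite le_min ler01 andbT addr_ge0// divr_ge0 ?sqr_ge0//.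
have h2 := ler_wpM2r Y0 an.
have h3 : - (n * (v1 ^+ 2 + v2 ^+ 2) * ((1 + 2 * B * n) * Num.min t 1)) <= X - a ^+ 2.
  by apply: le_trans h1; rewrite lerN2.
have h4 := ler_wpM2l W0 h3.
have h5 := ler_wpM2r (mulr_ge0 V0 m0) P.
set Y := expR (- (B * n)) * (X - a ^+ 2) in h4.
rewrite -[X in _ <= X]mulrA -/Y.
have h6 : - (8 / 1000 * expR (- B) * (v1 ^+ 2 + v2 ^+ 2) * Num.min t 1 * Q) <= Y.
  apply: le_trans h4; move: h5; clear; lra.
have h7 : 0 <= 8 / 1000 * expR (- B) * (v1 ^+ 2 + v2 ^+ 2) * Num.min t 1 * Q.
  have k8 : 0 <= 8 / 1000 :> R by clear; lra.
  have Q0 : 0 <= Q by apply: exprn_ge0; clear; lra.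
  by apply: mulr_ge0 Q0; apply: mulr_ge0 m0; apply: mulr_ge0 V0; apply: mulr_ge0 k8 _; exact: expR_ge0.
by rewrite parE; case: (~~ _); rewrite /= ?mul1r ?mul0r ?oppr_le0; [exact: h6|exact: h7].
Qed.

Definition inner_shell : seq (int * int) :=
  [:: (0, 0); (0, 2); (0, -2); (1, -1); (-1, 1); (-1, -1); (1, 1)].

Lemma outer_norm u : ~~ odd `|(u.1 + u.2)%R|%N -> u \notin inner_shell ->
  (12 <= 3 * u.1 ^+ 2 + u.2 ^+ 2)%R.
Proof.
case: u => a b; rewrite /inner_shell !inE !xpair_eqE /= => /[swap] H.
have [h1|h1] : (2 <= `|a|)%R \/ (`|a| <= 1)%R by lia.
  by move=> _; nia.
have [h2|h2] : (4 <= `|b|)%R \/ (`|b| <= 3)%R by lia.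
  by move=> _; nia.
have : [|| a == 0, a == 1 | a == -1] by lia.
have : [|| b == 0, b == 1, b == 2, b == 3, b == -1, b == -2 | b == -3] by lia.
by move=> /or4P[/eqP ?|/eqP ?|/eqP ?|/or4P[]/eqP ?] /or3P[]/eqP ?; subst a b; move: H.
Qed.

(** On the hexagonal cell the surplus of the first shell, 0.1 of its weight,
  exceeds the total loss of the outer shells, at most 0.072 times [|v| ^ 2],
  that is 0.048 of that weight. *)
Lemma dual_gain_cell (B z w v1 v2 : R) : 51 / 8 <= B ->
  `|2 * w| <= 1 -> `|3 * z - w| <= 1 -> `|3 * z + w| <= 1 ->
  78 / 1000 * expR (- B) * (v1 ^+ 2 + v2 ^+ 2) * Num.min (B * (3 * z ^+ 2 + w ^+ 2)) 1 <=
  hsum (dual_term B z w v1 v2) - hsum (dual_term B 0 0 v1 v2).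
Proof.
move=> B0 w1 w2 w3; have Bp : 0 < B by move: B0; clear; lra.
have [S <-] := dual_pair_sum z w v1 v2 Bp.
set m := Num.min _ _; set V := v1 ^+ 2 + v2 ^+ 2; set q := expR (- B).
have zw0 : 0 <= 3 * z ^+ 2 + w ^+ 2 by apply: addr_ge0; [apply: mulr_ge0 => //|]; exact: sqr_ge0.
have m0 : 0 <= m by rewrite le_min ler01 andbT mulr_ge0// ltW.
have V0 : 0 <= V by rewrite addr_ge0 ?sqr_ge0.
have q0 : 0 < q := expR_gt0 _.
pose K := 8 / 1000 * q * V * m.
have k8 : 0 <= 8 / 1000 :> R by clear; lra.
have K0 : 0 <= K by apply: mulr_ge0 m0; apply: mulr_ge0 V0; apply: mulr_ge0 k8 _; exact: ltW.
pose b u : R := K * ((1 / 2) ^+ `|u.1|%N * (1 / 2) ^+ `|u.2|%N).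
have b0 u : 0 <= b u by apply: mulr_ge0 K0 _; rewrite mulr_ge0// exprn_ge0.
pose gm (a : int) : R := (1 / 2) ^+ `|a|%N.
have r01 : 0 <= (1 / 2 : R) < 1 by apply/andP; split; lra.
have gs s : uniq s -> \sum_(a <- s) gm a <= 3.
  by move=> us; apply: le_trans (geom_int_sum r01 us) _; rewrite ler_pdivrMr; lra.
have Sg : abs_summable gm.
  exists 3 => s us; under eq_bigr do rewrite ger0_norm ?exprn_ge0//.
  exact: gs.
have [Sgg Egg] := hsum_prod Sg Sg.
have g3 : hsum gm <= 3 by apply: hsum_le_bound.
have g0 : 0 <= hsum gm by apply: hsum_ge0 => // a; rewrite exprn_ge0.
have Sb : abs_summable b by exact: abs_summableZ.
have b9 : hsum b <= K * 9.
  by rewrite hsumZ// Egg ler_wpM2l//; move: g3 g0; clear; nra.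
have Spb := abs_summableD S Sb.
have G : \sum_(u <- inner_shell) (dual_pair B z w v1 v2 u + b u) <=
   hsum (fun u => dual_pair B z w v1 v2 u + b u).
  apply: hsum_ge_finite => // u ui; rewrite -[X in _ <= _ + X]opprK subr_ge0.
  have [od|ev] := boolP (odd `|(u.1 + u.2)%R|%N).
    by rewrite dual_pairE parE od /= !mul0r oppr_le0.
  by apply: dual_outer => //; exact: outer_norm.
rewrite hsumD// in G.
have G2 : \sum_(u <- inner_shell) dual_pair B z w v1 v2 u <=
    \sum_(u <- inner_shell) (dual_pair B z w v1 v2 u + b u).
  by apply: ler_sum => u _; rewrite lerDl.
set t := B * (3 * z ^+ 2 + w ^+ 2) in m m0 K K0 b b0 Sb b9 Spb G G2 *.
pose tau := s3 * z * v1 + w * v2.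
pose a1 := v2; pose a2 := (s3 * v1 - v2) / 2; pose a3 := (- (s3 * v1) - v2) / 2.
pose s1 := 2 * B * w; pose s2 := B * (3 * z - w); pose s3' := - (B * (3 * z + w)).
have bd (x : R) : `|x| <= 1 -> `|B * x| <= B.
  by move=> x1; rewrite normrM (gtr0_norm Bp) ler_piMr// ltW.
have s1B : `|s1| <= B by rewrite /s1 (mulrC 2) -mulrA; exact: bd.
have s2B : `|s2| <= B by exact: bd.
have s3B : `|s3'| <= B by rewrite normrN; exact: bd.
have a0 : a1 + a2 + a3 = 0 by rewrite /a1 /a2 /a3; field.
have s0 : s1 + s2 + s3' = 0 by rewrite /s1 /s2 /s3'; ring.
have SH := shell_symm tau B0 a0 s0 s1B s2B s3B.
have sqr3 := @s3_sqr R.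
have tE : (s1 ^+ 2 + s2 ^+ 2 + s3' ^+ 2) / (6 * B) = t.
  by rewrite /s1 /s2 /s3' /t; field; rewrite gt_eqF.
have AE : a1 ^+ 2 + a2 ^+ 2 + a3 ^+ 2 = 3 / 2 * V.
  have -> : a1 ^+ 2 + a2 ^+ 2 + a3 ^+ 2 = 3 / 2 * v2 ^+ 2 + s3 ^+ 2 * v1 ^+ 2 / 2.
    by rewrite /a1 /a2 /a3; field.
  by rewrite sqr3 /V; field.
rewrite /shell_gain tE AE -/m -/q in SH.
have IN : \sum_(u <- inner_shell) dual_pair B z w v1 v2 u =
   expR (- t) * shell_energy B tau a1 a2 a3 s1 s2 s3' - 2 * q * (3 / 2 * V).
  rewrite -AE /inner_shell !big_cons big_nil addr0 !dual_pairE !parE /= -/tau -/t.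
  have W1 x y : 3 * x ^+ 2 + y ^+ 2 = 4 -> dgauss B 0 0 (x, y) = q.
    move=> xy; rewrite /dgauss /dualX /dualY /q; congr expR; congr (- _).
    have -> : 3 * (0 + (x, y).1%:~R / 2) ^+ 2 + (0 + (x, y).2%:~R / 2) ^+ 2 = (3 * x ^+ 2 + y ^+ 2)%:~R / 4 :> R.
      by rewrite intrD intrM !rmorphXn /=; field.
    by rewrite xy; field.
  have W0 : dgauss B 0 0 (0, 0) = 1 by rewrite /dgauss /dualX /dualY /= !mul0r !addr0 !expr0n /= !mulr0 addr0 mulr0 oppr0 expR0.
  rewrite W0 !W1//.
  have f1 x y : dualv 0 0 v1 v2 (x, y) = s3 * (x%:~R / 2) * v1 + y%:~R / 2 * v2.
    by rewrite /dualv /dualX /dualY !add0r.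
  rewrite !f1 /=.
  have chN (x : R) : ch (- x) = ch x by rewrite -ch_norm normrN ch_norm.
  have shN (x : R) : sh (- x) = - sh x by rewrite /sh opprK; field.
  have c0 : ch 0 = 1 :> R by rewrite /ch oppr0 expR0; field.
  have h0 : sh 0 = 0 :> R by rewrite /sh oppr0 subrr mul0r.
  have -> : B * (3 * z * 0%:~R + w * 0%:~R) = 0 by rewrite !mulr0 addr0 mulr0.
  have -> : B * (3 * z * 0%:~R + w * 2%:~R) = s1 by rewrite /s1; ring.
  have -> : B * (3 * z * 0%:~R + w * (-2)%:~R) = - s1 by rewrite /s1; ring.
  have -> : B * (3 * z * 1%:~R + w * (-1)%:~R) = s2 by rewrite /s2; ring.
  have -> : B * (3 * z * (-1)%:~R + w * 1%:~R) = - s2 by rewrite /s2; ring.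
  have -> : B * (3 * z * (-1)%:~R + w * (-1)%:~R) = s3' by rewrite /s3'; ring.
  have -> : B * (3 * z * 1%:~R + w * 1%:~R) = - s3' by rewrite /s3'; ring.
  rewrite (chN s1) (chN s2) (chN s3') (shN s1) (shN s2) (shN s3') c0 h0 /shell_energy -/q /a1 /a2 /a3.
  by field.
have SH2 : q * (3 / 2 * V) * (2 + m / 10) <= expR (- t) * shell_energy B tau a1 a2 a3 s1 s2 s3'.
  have := ler_wpM2l (expR_ge0 (- t)) SH; rewrite [X in X <= _ -> _]mulrC -[X in X <= _ -> _]mulrA.
  by rewrite expRxMexpNx_1 mulr1.
have e9 : K * 9 = 72 / 1000 * (q * V * m) by rewrite /K; ring.
rewrite e9 in b9; rewrite IN in G2.
move: SH2 b9 G G2; rewrite -!mulrA; clear; lra.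
Qed.

End DualCell.

(** * The sine inequality on an orbit of the rotation by 120 degrees *)
Section DirectRegime.
Context {R : realType}.
Implicit Types z w : R.
Implicit Types (u : int * int).

Definition wave (phi : R) : R := 1 - cos phi.

Lemma wave_sin phi : wave phi = 2 * sin (phi / 2) ^+ 2.
Proof.
rewrite /wave; have {1}-> : phi = phi / 2 + phi / 2 by field.
rewrite cosD -!expr2 cos2sin2; ring.
Qed.

Lemma wave_ge0 phi : 0 <= wave phi.
Proof. by rewrite wave_sin mulr_ge0 ?sqr_ge0. Qed.

(** The square roots of the three [1 - cos] satisfy the triangle inequality,
  because [|sin (x + y)| <= |sin x| + |sin y|]; the first inequality is the
  form without roots of this, Heron's expression being nonnegative. *)
Lemma wave_tri p1 p2 p3 : p1 + p2 + p3 = 0 ->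
  [/\ wave p1 ^+ 2 + wave p2 ^+ 2 + wave p3 ^+ 2 <=
        2 * (wave p1 * wave p2 + wave p1 * wave p3 + wave p2 * wave p3) &
      wave p2 <= 2 * (wave p1 + wave p3)].
Proof.
move=> p0; rewrite !wave_sin.
have -> : p2 / 2 = - (p1 / 2 + p3 / 2) by lra.
rewrite sinN sinD.
have c1 := sin2cos2 (p1 / 2); have c3 := sin2cos2 (p3 / 2).
move: c1 c3; set s1 := sin (p1 / 2); set s2 := sin (p3 / 2); set k1 := cos _; set k2 := cos _.
move=> c1 c3.
have k1s : k1 ^+ 2 = 1 - s1 ^+ 2 by lra.
have k2s : k2 ^+ 2 = 1 - s2 ^+ 2 by lra.
have P : (k1 * k2) ^+ 2 = (1 - s1 ^+ 2) * (1 - s2 ^+ 2) by rewrite exprMn k1s k2s.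
set P' := k1 * k2 in P.
have e : (- (s1 * k2 + k1 * s2)) ^+ 2 = s1 ^+ 2 * (1 - s2 ^+ 2) + (1 - s1 ^+ 2) * s2 ^+ 2 + 2 * s1 * s2 * P'.
  rewrite sqrrN sqrrD !exprMn k1s k2s /P'; ring.
rewrite e.
have s1l : 0 <= s1 ^+ 2 := sqr_ge0 _. have s2l : 0 <= s2 ^+ 2 := sqr_ge0 _.
have s1u : s1 ^+ 2 <= 1 by rewrite -subr_ge0 -k1s sqr_ge0.
have s2u : s2 ^+ 2 <= 1 by rewrite -subr_ge0 -k2s sqr_ge0.
have P1 : P' ^+ 2 <= 1 by rewrite P; move: s1l s2l s1u s2u; clear; nra.
split; last first.
  have : (s1 - s2 * P') ^+ 2 >= 0 := sqr_ge0 _.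
  have : s2 ^+ 2 * P' ^+ 2 <= s2 ^+ 2 by rewrite ler_piMr.
  move: s1l s2l; clear; have : 0 <= s1 ^+ 2 * s2 ^+ 2 by rewrite mulr_ge0 ?sqr_ge0.
  by lra.
rewrite -subr_ge0.
set a := s1 ^+ 2 in s1l s1u P e *; set b := s2 ^+ 2 in s2l s2u P e *.
have -> : 2 * (2 * a * (2 * (a * (1 - b) + (1 - a) * b + 2 * s1 * s2 * P')) + 2 * a * (2 * b) +
    2 * (a * (1 - b) + (1 - a) * b + 2 * s1 * s2 * P') * (2 * b)) -
  ((2 * a) ^+ 2 + (2 * (a * (1 - b) + (1 - a) * b + 2 * s1 * s2 * P')) ^+ 2 + (2 * b) ^+ 2) =
  16 * a * b - 16 * (a * b - s1 * s2 * P') ^+ 2 by ring.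
have -> : a * b - s1 * s2 * P' = s1 * s2 * (s1 * s2 - P') by rewrite /a /b; ring.
rewrite exprMn exprMn -/a -/b.
suff : (s1 * s2 - P') ^+ 2 <= 1.
  have := mulr_ge0 s1l s2l; clear; move: a b => a b; nra.
have -> : s1 * s2 - P' = - cos (p1 / 2 + p3 / 2) by rewrite cosD -/s1 -/s2 -/k1 -/k2 /P'; ring.
by rewrite sqrrN -real_normK ?num_real// expr_le1// cos_max.
Qed.

Lemma form_ge0 (A B C x y : R) : 0 <= A -> 0 <= C -> B ^+ 2 <= A * C ->
  0 <= A * x ^+ 2 + 2 * B * x * y + C * y ^+ 2.
Proof.
rewrite le_eqVlt => /predU1P[<-|A0] C0 BAC.
  rewrite mul0r in BAC; have /eqP : B ^+ 2 = 0 by apply/le_anti; rewrite BAC sqr_ge0.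
  by rewrite sqrf_eq0 => /eqP ->; rewrite mul0r mulr0 !mul0r !add0r mulr_ge0 ?sqr_ge0.
rewrite -(pmulr_rge0 _ A0).
have -> : A * (A * x ^+ 2 + 2 * B * x * y + C * y ^+ 2) = (A * x + B * y) ^+ 2 + (A * C - B ^+ 2) * y ^+ 2 by ring.
by rewrite addr_ge0 ?sqr_ge0// mulr_ge0 ?sqr_ge0// subr_ge0.
Qed.

(** The difference is a quadratic form in [(d1, d2)] whose determinant is, up
  to a factor, Heron's expression in the three [1 - cos]. *)
Lemma wave_orbit p1 p2 p3 d1 d2 d3 : p1 + p2 + p3 = 0 -> d1 + d2 + d3 = 0 ->
  (wave p1 + wave p2 + wave p3) * (d1 ^+ 2 + d2 ^+ 2 + d3 ^+ 2) / 6 <=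
  wave p1 * d1 ^+ 2 + wave p2 * d2 ^+ 2 + wave p3 * d3 ^+ 2.
Proof.
move=> p0 d0; have [T _] := wave_tri p0.
have [_ T2] := wave_tri p0.
have [|_ T1] := @wave_tri p2 p1 p3; first lra.
have [|_ T3] := @wave_tri p1 p3 p2; first lra.
have -> : d3 = - (d1 + d2) by lra.
move: T T1 T2 T3; move: (wave p1) (wave p2) (wave p3) => w1 w2 w3 T T1 T2 T3; clear p0 d0.
rewrite -subr_ge0.
have -> : w1 * d1 ^+ 2 + w2 * d2 ^+ 2 + w3 * (- (d1 + d2)) ^+ 2 -
  (w1 + w2 + w3) * (d1 ^+ 2 + d2 ^+ 2 + (- (d1 + d2)) ^+ 2) / 6 =
  (w1 + w3 - (w1 + w2 + w3) / 3) * d1 ^+ 2 + 2 * (w3 - (w1 + w2 + w3) / 6) * d1 * d2 +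
  (w2 + w3 - (w1 + w2 + w3) / 3) * d2 ^+ 2 by field.
by apply: form_ge0; [lra|lra|rewrite -subr_ge0; move: T; clear; lra].
Qed.

End DirectRegime.

(** * Lower bound for the symbol of the Hessian *)
Section Symbol.
Context {R : realType}.
Implicit Types z w : R.
Implicit Types (u : int * int).

(** From coefficients on [(sigma, tau)] to the coordinates [(a, b)] with [a +
  b] even for which the point is [r_star / 2 (a, sqrt 3 b)]. *)
Definition hexpt (p : int * int) : int * int := (2 * p.1 + p.2, p.2).
Definition hexpt' u : int * int := (divz (u.1 - u.2) 2, u.2).

Lemma hexptK : cancel hexpt hexpt'.
Proof. by case=> m n; rewrite /hexpt /hexpt' /= addrK mulrC mulzK. Qed.

Lemma par_hexpt p : par (hexpt p) = 1 :> R.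
Proof.
case: p => m n; rewrite parE /hexpt /=.
suff -> : ~~ odd `|(2 * m + n + n)%R|%N by [].
by lia.
Qed.

Lemma hexpt'K u : hexpt (hexpt' u) != u -> par u = 0 :> R.
Proof.
case: u => a b H; rewrite parE /=.
suff -> : odd `|(a + b)%R|%N by [].
apply: contraNT H => od; apply/eqP; rewrite /hexpt /hexpt' /=; congr pair.
lia.
Qed.

Lemma hsum_hexpt (f : int * int -> R) : abs_summable f -> (forall u, par u = 0 :> R -> f u = 0) ->
  abs_summable (f \o hexpt) /\ hsum f = hsum (f \o hexpt).
Proof. by move=> Sf f0; apply: (hsum_inj hexptK) => // u /hexpt'K/f0. Qed.

Definition rot120 (p : int * int) : int * int := (- p.1 - p.2, p.1).
Definition rot240 (p : int * int) : int * int := (p.2, - p.1 - p.2).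

Lemma rot120K : cancel rot120 rot240.
Proof. by case=> m n; rewrite /rot120 /rot240 /=; congr pair; ring. Qed.
Lemma rot240K : cancel rot240 rot120.
Proof. by case=> m n; rewrite /rot120 /rot240 /=; congr pair; ring. Qed.

(** The comparison symbol. The phases are those of [sigma] and [tau], so it
  vanishes exactly on the dual lattice, and only to second order. *)
Definition wave2 z w : R := wave (angle z w (2, 0)) + wave (angle z w (1, 1)).

Lemma wave2_ge0 z w : 0 <= wave2 z w. Proof. by rewrite addr_ge0 ?wave_ge0. Qed.

Lemma wave_angleN z w u : wave (angle z w (negz u)) = wave (angle z w u).
Proof.
rewrite /wave; have -> : angle z w (negz u) = - angle z w u.
  by rewrite /angle /negz /= !mulrNz; ring.
by rewrite cosN.
Qed.

(** The sum is averaged over the rotations by 120 degrees. On an orbit at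
  squared distance [N] the sum is, up to positive factors, at least [la N / 2
  - 1], which is nonnegative from the first shell [N = 4] on; the first shell
  alone gives the bound. *)
Lemma direct_gain (la z w v1 v2 : R) : 1 / 2 <= la ->
  (2 * la - 1) / 3 * expR (- (4 * la)) * (v1 ^+ 2 + v2 ^+ 2) * wave2 z w <=
  hsum (fun u => stiff la v1 v2 u * wave (angle z w u)).
Proof.
move=> la1; have la0 : 0 < la by move: la1; clear; lra.
set f := fun u => _.
have Sf : abs_summable f.
  have := abs_summableB (stiff_summable v1 v2 la0) (stiff_cos_summable z w v1 v2 la0).
  by congr abs_summable; apply/funext => u; rewrite /f /wave; ring.
have [Sg ->] : abs_summable (f \o hexpt) /\ hsum f = hsum (f \o hexpt).
  by apply: hsum_hexpt => // u p0; rewrite /f /stiff p0 !mul0r.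
set g := f \o hexpt in Sg *.
have [S1 E1] := hsum_reindex rot120K rot240K Sg.
have [S2 E2] := hsum_reindex rot240K rot120K Sg.
have S12 := abs_summableD S1 S2.
have S := abs_summableD Sg S12.
have E : hsum (fun p => g p + ((g \o rot120) p + (g \o rot240) p)) = 3 * hsum g.
  by rewrite hsumD// hsumD// E1 E2; ring.
have V0 : 0 <= v1 ^+ 2 + v2 ^+ 2 by rewrite addr_ge0 ?sqr_ge0.
set V := v1 ^+ 2 + v2 ^+ 2 in V0 *.
pose N (p : int * int) : R := 4 * (p.1%:~R ^+ 2 + p.1%:~R * p.2%:~R + p.2%:~R ^+ 2).
pose W p := wave (angle z w (hexpt p)) + wave (angle z w (hexpt (rot120 p))) + wave (angle z w (hexpt (rot240 p))).
have gE p : g p = (2 * la * dirv v1 v2 (hexpt p) ^+ 2 - V) * expR (- (la * N p)) * wave (angle z w (hexpt p)).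
  rewrite /g /f /= /stiff par_hexpt mul1r /hgauss.
  congr (_ * expR (- (la * _)) * _); rewrite /N /hexpt /= intrD intrM; ring.
have N1 p : N (rot120 p) = N p by rewrite /N /rot120 /= intrD !mulrNz; ring.
have N2 p : N (rot240 p) = N p by rewrite /N /rot240 /= intrD !mulrNz; ring.
have s33 := @s3_sqr R.
have T p : expR (- (la * N p)) * ((la * N p / 2 - 1) * V * W p) <=
    g p + ((g \o rot120) p + (g \o rot240) p).
  rewrite /= !gE N1 N2.
  set d1 := dirv _ _ _; set d2 := dirv _ _ _; set d3 := dirv _ _ _.
  set p1 := angle _ _ _; set p2 := angle _ _ _; set p3 := angle _ _ _.
  have p0 : p1 + p2 + p3 = 0.
    by rewrite /p1 /p2 /p3 /angle /hexpt /rot120 /rot240 /= !(intrD, intrM, mulrNz); ring.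
  have d0 : d1 + d2 + d3 = 0.
    by rewrite /d1 /d2 /d3 /dirv /hexpt /rot120 /rot240 /= !(intrD, intrM, mulrNz); ring.
  have dd : d1 ^+ 2 + d2 ^+ 2 + d3 ^+ 2 = 3 / 2 * N p * V.
    have -> : 3 / 2 * N p * V = 3 / 2 * N p * (v1 ^+ 2 + s3 ^+ 2 / 3 * v2 ^+ 2).
      by rewrite s33 /V; field.
    rewrite /d1 /d2 /d3 /dirv /hexpt /rot120 /rot240 /N /= !(intrD, intrM, mulrNz).
    by field: s33.
  have O := wave_orbit p0 d0.
  rewrite dd in O.
  have -> : (2 * la * d1 ^+ 2 - V) * expR (- (la * N p)) * wave p1 +
    ((2 * la * d2 ^+ 2 - V) * expR (- (la * N p)) * wave p2 +
     (2 * la * d3 ^+ 2 - V) * expR (- (la * N p)) * wave p3) =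
    expR (- (la * N p)) * (2 * la * (wave p1 * d1 ^+ 2 + wave p2 * d2 ^+ 2 + wave p3 * d3 ^+ 2)
      - V * W p) by rewrite /W -/p1 -/p2 -/p3; ring.
  apply: ler_wpM2l; first exact: expR_ge0.
  have la20 : 0 <= 2 * la by move: la0; clear; lra.
  have := ler_wpM2l la20 O; rewrite /W -/p1 -/p2 -/p3; clear; lra.
have W0 p : 0 <= W p by apply: addr_ge0; [apply: addr_ge0|]; exact: wave_ge0.
have T0 p : 0 <= g p + ((g \o rot120) p + (g \o rot240) p).
  have [->|pn] := eqVneq p (0, 0).
    have g0 q : hexpt q = (0, 0) -> g q = 0.
      move=> e; rewrite gE e; have -> : angle z w (0, 0) = 0 by rewrite /angle /= !mul0r addr0 mulr0.
      by rewrite /wave cos0 subrr mulr0.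
    have -> : (g \o rot120) (0, 0) = 0 by exact: g0.
    have -> : (g \o rot240) (0, 0) = 0 by exact: g0.
    by rewrite g0// !addr0.
  apply: le_trans (T p); apply: mulr_ge0; first exact: expR_ge0.
  rewrite !mulr_ge0//.
  have n1 : 4 <= N p.
    rewrite /N; have : (1 <= p.1 ^+ 2 + p.1 * p.2 + p.2 ^+ 2)%R.
      by move: pn; case: p => m n /=; rewrite xpair_eqE /=; nia.
    rewrite -(ler_int R) !(intrD, intrM) /=; clear; lra.
  have := ler_wpM2l (ltW la0) n1; move: la1; clear; lra.
have G := @hsum_ge_finite R _ _ [:: (1, 0)] isT S.
rewrite big_seq1 E in G.
have {}G := le_trans (T (1, 0)) (G (fun p _ => T0 p)).
have N10 : N (1, 0) = 4 by rewrite /N /=; ring.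
rewrite N10 in G.
have WE : wave2 z w <= W (1, 0).
  have h1 : wave (angle z w (hexpt (1, 0))) = wave (angle z w (2, 0)) by [].
  have h2 : wave (angle z w (hexpt (rot240 (1, 0)))) = wave (angle z w (1, 1)).
    by rewrite -wave_angleN.
  rewrite /W h1 h2 /wave2; have := wave_ge0 (angle z w (hexpt (rot120 (1, 0)))); clear; lra.
have k0 : 0 <= expR (- (4 * la)) * (2 * la - 1) * V.
  by rewrite mulr_ge0// mulr_ge0 ?expR_ge0//; move: la1; clear; lra.
have := ler_wpM2l k0 WE; move: G; rewrite (mulrC la 4); clear; lra.
Qed.

Lemma dual_term_shift (B z w v1 v2 : R) (m n : int) : ~~ odd `|(m + n)%R|%N -> 0 < B ->
  hsum (dual_term B (z + m%:~R / 2) (w + n%:~R / 2) v1 v2) = hsum (dual_term B z w v1 v2).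
Proof.
move=> mn B0.
pose h u : int * int := (u.1 + m, u.2 + n); pose h' u : int * int := (u.1 - m, u.2 - n).
have hK : cancel h h' by case=> a b; rewrite /h /h' /= !addrK.
have h'K : cancel h' h by case=> a b; rewrite /h /h' /= !subrK.
have [_ <-] := hsum_reindex hK h'K (dual_summable z w v1 v2 B0).
congr hsum; apply/funext => u; rewrite /= /dual_term /dualv /dgauss.
have -> : par (h u) = par u :> R.
  rewrite !parE; congr ((~~ _)%:R); rewrite /h /=.
  have -> : (u.1 + m + (u.2 + n))%R = ((u.1 + u.2) + (m + n))%R by ring.
  by move: mn; set x := (u.1 + u.2)%R; set y := (m + n)%R; lia.
have -> : dualX (z + m%:~R / 2) u = dualX z (h u) by rewrite /dualX /h /= intrD; field.
by have -> : dualY (w + n%:~R / 2) u = dualY w (h u) by rewrite /dualY /h /= intrD; field.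
Qed.

Lemma near_int (x : R) : exists m : int, `|x + m%:~R| <= 1 / 2.
Proof.
exists (- Num.floor (x + 1 / 2)); rewrite mulrNz.
have /andP[h1 h2] := real_floor_itv (num_real (x + 1 / 2)).
by rewrite ler_norml; move: h1 h2; rewrite intrD; lra.
Qed.

Lemma wave2_shift z w (m n : int) : ~~ odd `|(m + n)%R|%N ->
  wave2 (z + m%:~R / 2) (w + n%:~R / 2) = wave2 z w.
Proof.
move=> mn; rewrite /wave2 /wave /angle /=.
have [k kE] : exists k : int, (m + n)%R = 2 * k by exists (divz (m + n) 2); lia.
have kR : m%:~R + n%:~R = 2 * k%:~R :> R by rewrite -intrD kE intrM.
have -> : 2 * pi * (2 * (z + m%:~R / 2) + 0 * (w + n%:~R / 2)) =
   2 * pi * (2 * z + 0 * w) + 2 * pi * m%:~R :> R by field.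
have -> : 2 * pi * (1 * (z + m%:~R / 2) + 1 * (w + n%:~R / 2)) =
   2 * pi * (1 * z + 1 * w) + 2 * pi * k%:~R :> R.
  have -> : 2 * pi * (1 * (z + m%:~R / 2) + 1 * (w + n%:~R / 2)) =
    2 * pi * (1 * z + 1 * w) + pi * (m%:~R + n%:~R) :> R by field.
  by rewrite kR; ring.
by rewrite !cosD2piz.
Qed.

(** Every wave vector is congruent to one in the hexagonal cell: a rectangle
  of half the density is cut by the bisector with its corner. *)
Lemma hex_cell z w : exists m n : int, [/\ ~~ odd `|(m + n)%R|%N,
  `|w + n%:~R / 2| <= 1 / 2 & 3 * `|z + m%:~R / 2| + `|w + n%:~R / 2| <= 1].
Proof.
have [m0 hm] := near_int z; have [n0 hn] := near_int w.
have [h|h] := leP (3 * `|z + m0%:~R| + `|w + n0%:~R|) 1.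
  exists (2 * m0), (2 * n0); rewrite !intrM.
  have -> : z + 2%:~R * m0%:~R / 2 = z + m0%:~R by field.
  have -> : w + 2%:~R * n0%:~R / 2 = w + n0%:~R by field.
  by split=> //; lia.
have st (x : R) (k : int) : `|x + k%:~R| <= 1 / 2 -> exists e : int, odd `|e|%N /\
    `|x + (2 * k + e)%:~R / 2| = 1 / 2 - `|x + k%:~R|.
  move=> hx; have [x0|x0] := leP 0 (x + k%:~R).
    exists (-1); split=> //; rewrite intrD intrM.
    have -> : x + (2%:~R * k%:~R + (-1)%:~R) / 2 = - (1 / 2 - (x + k%:~R)) by field.
    by rewrite normrN (ger0_norm x0) ger0_norm// subr_ge0; move: hx; rewrite ger0_norm.
  exists 1; split=> //; rewrite intrD intrM.
  have -> : x + (2%:~R * k%:~R + 1%:~R) / 2 = 1 / 2 + (x + k%:~R) by field.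
  by move: hx; rewrite (ltr0_norm x0) opprK => hx; rewrite ger0_norm//; lra.
have [e1 [ od1 E1]] := st z m0 hm; have [e2 [ od2 E2]] := st w n0 hn.
exists (2 * m0 + e1), (2 * n0 + e2); rewrite E1 E2; split; first lia.
  by have := normr_ge0 (w + n0%:~R); lra.
by move: h; lra.
Qed.

Lemma wave_le_sqr (phi : R) : wave phi <= phi ^+ 2 / 2.
Proof.
rewrite /wave.
rewrite -cos_norm.
rewrite -(@real_normK _ phi) ?num_real//.
have := @trig_taylor R `|phi| (normr_ge0 _); case; lra.
Qed.

(** The right side is comparable to the gain in [dual_gain_cell], with [B >=
  1]. *)
Lemma wave2_le z w : wave2 z w <= 4 * pi ^+ 2 * Num.min (3 * z ^+ 2 + w ^+ 2) 1.
Proof.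
have p2 : 1 <= pi ^+ 2 :> R.
  have := @pi_ge31 R; move: pi => p p31; have : 1 <= p by lra.
  by move=> p1; rewrite expr_ge1//; lra.
have [h|h] := leP (3 * z ^+ 2 + w ^+ 2) 1; last first.
  have w2 (x : R) : wave x <= 2 by rewrite /wave; have := cos_geN1 x; lra.
  by have := w2 (angle z w (2, 0)); have := w2 (angle z w (1, 1)); rewrite /wave2; move: p2; lra.
have h1 := wave_le_sqr (angle z w (2, 0)); have h2 := wave_le_sqr (angle z w (1, 1)).
apply: le_trans (lerD h1 h2) _; rewrite /angle /=.
move: p2; rewrite -subr_ge0 => p2; rewrite -subr_ge0.
have -> : 4 * pi ^+ 2 * (3 * z ^+ 2 + w ^+ 2) - ((2 * pi * (2 * z + 0 * w)) ^+ 2 / 2 +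
  (2 * pi * (1 * z + 1 * w)) ^+ 2 / 2) = 2 * pi ^+ 2 * (z - w) ^+ 2 :> R by field.
by rewrite mulr_ge0 ?sqr_ge0// mulr_ge0 ?sqr_ge0.
Qed.

End Symbol.

Section SymbolLower.
Context {R : realType}.
Implicit Types z w : R.

Lemma dual_gain (B z w v1 v2 : R) : 51 / 8 <= B ->
  78 / 1000 * expR (- B) / (4 * pi ^+ 2) * (v1 ^+ 2 + v2 ^+ 2) * wave2 z w <=
  hsum (dual_term B z w v1 v2) - hsum (dual_term B 0 0 v1 v2).
Proof.
move=> B0; have B1 : 1 <= B by move: B0; clear; lra.
have Bp : 0 < B := lt_le_trans ltr01 B1.
have [m [n [mn h1 h2]]] := hex_cell z w.
rewrite -(dual_term_shift z w v1 v2 mn Bp) -(wave2_shift z w mn).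
move: (z + _) (w + _) h1 h2 => {m n mn}z {}w h1 h2.
have w1 : `|2 * w| <= 1 by rewrite normrM (@ger0_norm _ 2)//; move: h1; clear; lra.
have n3 : `|3 * z| = 3 * `|z| by rewrite normrM (@ger0_norm _ 3).
have w2 : `|3 * z - w| <= 1 by apply: le_trans (ler_normB _ _) _; rewrite n3.
have w3 : `|3 * z + w| <= 1 by apply: le_trans (ler_normD _ _) _; rewrite n3.
apply: le_trans (dual_gain_cell v1 v2 B0 w1 w2 w3).
have p2 : 0 < 4 * pi ^+ 2 :> R by rewrite mulr_gt0// exprn_gt0// pi_gt0.
have k0 : 0 <= 78 / 1000 * expR (- B) * (v1 ^+ 2 + v2 ^+ 2).
  apply: mulr_ge0; last by rewrite addr_ge0 ?sqr_ge0.
  by apply: mulr_ge0; [clear; lra|exact: expR_ge0].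
have -> : 78 / 1000 * expR (- B) / (4 * pi ^+ 2) * (v1 ^+ 2 + v2 ^+ 2) * wave2 z w =
  78 / 1000 * expR (- B) * (v1 ^+ 2 + v2 ^+ 2) * (wave2 z w / (4 * pi ^+ 2)).
  by move: p2; move: (4 * _) => q q0; ring.
apply: ler_wpM2l => //; rewrite ler_pdivrMr// mulrC.
apply: le_trans (wave2_le z w) _; rewrite ler_pM2l//.
rewrite le_min ge_min ge_min lexx orbT andbT ler_peMl//.
by apply: addr_ge0; [apply: mulr_ge0 => //|]; exact: sqr_ge0.
Qed.

(** The two regimes overlap: for [la] at least 0.501 the orbits of the
  rotation are positive one by one, and below that value the dual parameter [B
  = pi ^ 2 / (3 la)] is at least [51 / 8] because [pi >= 3.1]. *)
Lemma symbol_lower (l0 l1 : R) : 0 < l0 -> exists2 c : R, 0 < c &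
  forall la, l0 <= la <= l1 -> forall z w v1 v2,
  c * (v1 ^+ 2 + v2 ^+ 2) * wave2 z w <=
  hsum (fun u => stiff la v1 v2 u * wave (angle z w u)).
Proof.
move=> l00; pose B1 : R := pi ^+ 2 / (3 * l0).
have p2 : 0 < pi ^+ 2 :> R by rewrite exprn_gt0// pi_gt0.
have p961 : 961 / 100 <= pi ^+ 2 :> R.
  by have := @pi_ge31 R; clear; move: pi => p p31; nra.
pose c1 : R := 2 / 1000 / 3 * expR (- (4 * l1)).
pose c2 : R := 78 / 1000 * expR (- B1) / (4 * pi ^+ 2).
have c10 : 0 < c1 by apply: mulr_gt0; [clear; lra|exact: expR_gt0].
have c20 : 0 < c2.
  apply: divr_gt0; last exact: mulr_gt0.
  by apply: mulr_gt0; [clear; lra|exact: expR_gt0].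
exists (Num.min c1 c2); first by rewrite lt_min c10.
move=> la /andP[la0 la1] z w v1 v2.
have V0 : 0 <= v1 ^+ 2 + v2 ^+ 2 by rewrite addr_ge0 ?sqr_ge0.
have W0 := @wave2_ge0 R z w.
have [h|h] := leP (501 / 1000) la.
  have lah : 1 / 2 <= la by move: h; clear; lra.
  apply: le_trans (direct_gain z w v1 v2 lah).
  rewrite ler_wpM2r// ler_wpM2r// ge_min; apply/orP; left; rewrite /c1.
  apply: ler_pM; [clear; lra|exact: expR_ge0|move: h; clear; lra|].
  by rewrite ler_expR lerN2; move: la1; clear; lra.
have lap : 0 < la := lt_le_trans l00 la0.
have [C [C0 C9] HC] := dual_symbol lap.
rewrite HC; set B := pi ^+ 2 / (3 * la) in C9 HC *.
have B0 : 51 / 8 <= B.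
  rewrite ler_pdivlMr ?mulr_gt0//; move: h p961; clear; lra.
have BB1 : B <= B1.
  rewrite ler_pM2l// lef_pV2 ?posrE ?mulr_gt0// ler_pM2l//.
have {}C9 : 1 / 9 <= C by apply: C9; move: B0; clear; lra.
apply: (@le_trans _ _ (1 * (hsum (dual_term B z w v1 v2) - hsum (dual_term B 0 0 v1 v2)))).
  rewrite mul1r; apply: le_trans (dual_gain z w v1 v2 B0).
  rewrite ler_wpM2r// ler_wpM2r// ge_min; apply/orP; right; rewrite /c2.
  rewrite ler_pM2r; last by rewrite invr_gt0; exact: mulr_gt0.
  by apply: ler_wpM2l; [clear; lra|rewrite ler_expR lerN2].
have D0 : 0 <= hsum (dual_term B z w v1 v2) - hsum (dual_term B 0 0 v1 v2).
  apply: le_trans (dual_gain z w v1 v2 B0).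
  apply: mulr_ge0 W0; apply: mulr_ge0 V0; apply: divr_ge0; last by apply: mulr_ge0 => //; exact: ltW.
  by apply: mulr_ge0; [clear; lra|exact: expR_ge0].
have k : 1 <= 2 * B * C by move: B0 C9; clear; nra.
exact: (ler_wpM2r D0 k).
Qed.

End SymbolLower.

(** * Positivity of the finite sections of a convolution *)
Section Toeplitz.
Context {R : realType}.
Notation I := (int * int)%type.
Implicit Types (p q : I) (d : R * R).

Definition subI p q : I := (p.1 - q.1, p.2 - q.2).

Definition bform (a b c : R) (d e : R * R) : R := a * (d.1 * e.1) + b * (d.1 * e.2 + d.2 * e.1) + c * (d.2 * e.2).

Definition sqn d : R := d.1 ^+ 2 + d.2 ^+ 2.

Lemma bform_le (a b c : R) d : `|bform a b c d d| <= (`|a| + `|b| + `|c|) * sqn d.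
Proof.
rewrite /bform /sqn; case: d => x y /=.
apply: le_trans (ler_normD _ _) _; apply: le_trans (lerD (ler_normD _ _) (lexx _)) _.
rewrite !normrM -!expr2 !real_normK ?num_real//.
have h : `|x * y + y * x| <= x ^+ 2 + y ^+ 2.
  by rewrite ler_norml; apply/andP; split; [have := sqr_ge0 (x + y)|have := sqr_ge0 (x - y)]; lra.
have := ler_wpM2l (normr_ge0 b) h.
have := mulr_ge0 (normr_ge0 a) (sqr_ge0 y); have := mulr_ge0 (normr_ge0 c) (sqr_ge0 x).
lra.
Qed.

(** Finitely many integer vectors are told apart modulo [N] by one linear
  form; a one-dimensional Fourier transform is then enough in two dimensions. *)
Lemma int_encoding (T : seq I) : exists L N : nat, (0 < N)%N /\
  forall w, w \in T -> (N %| `|(w.1 + L%:Z * w.2)%R|)%N -> w = (0, 0).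
Proof.
have [b hb] : exists b : nat, forall w, w \in T -> (`|w.1| <= b)%N /\ (`|w.2| <= b)%N.
  elim: T => [|w T [b hb]]; first by exists 0%N.
  exists (maxn b (maxn `|w.1|%N `|w.2|%N)) => v; rewrite inE => /predU1P[->|/hb[h1 h2]]; rewrite !leq_max ?leqnn ?orbT ?h1 ?h2 //=.
exists (2 * b + 1)%N, (b * (2 * b + 1) + b + 1)%N; split; first lia.
case=> m n /hb [/= hm hn] dv.
have s : (`|(m + (2 * b + 1)%N%:Z * n)%R| < b * (2 * b + 1) + b + 1)%N by nia.
have z : (`|(m + (2 * b + 1)%N%:Z * n)%R| = 0)%N.
  by apply/eqP; apply: contraTT dv => h; rewrite gtnNdvd// lt0n.
have {}z : (m + (2 * b + 1)%N%:Z * n = 0)%R by lia.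
have n0 : n = 0 by nia.
by move: z; rewrite n0 mulr0 addr0 => ->.
Qed.

Lemma tail_close (T : eqType) (f : T -> R) (s : seq T) (t : R) : abs_summable f -> uniq s ->
  (forall s', uniq s' -> (forall u, u \in s' -> u \notin s) -> \sum_(u <- s') `|f u| <= t) ->
  `|hsum f - \sum_(u <- s) f u| <= t.
Proof.
move=> Sf us H; apply/ler_addgt0Pr => e e0.
have [s2 [u2 ss h2]] := has_sum_eval s (has_hsum Sf) e0.
have E : \sum_(u <- s2) f u = \sum_(u <- s) f u + \sum_(u <- s2 | u \notin s) f u.
  rewrite (bigID (fun u => u \in s)) /=; congr (_ + _).
  rewrite -big_filter; apply: perm_big; apply: uniq_perm => //; first exact: filter_uniq.
  by move=> u; rewrite mem_filter; case: (boolP (u \in s)) => // /ss ->.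
rewrite E in h2.
have h3 : `|\sum_(u <- s2 | u \notin s) f u| <= t.
  rewrite -big_filter; apply: le_trans (ler_norm_sum _ _ _) _.
  apply: H; first exact: filter_uniq.
  by move=> u; rewrite mem_filter => /andP[].
have -> : hsum f - \sum_(u <- s) f u = - (\sum_(u <- s) f u + \sum_(u <- s2 | u \notin s) f u - hsum f)
  + \sum_(u <- s2 | u \notin s) f u by ring.
by apply: le_trans (ler_normD _ _) _; rewrite normrN addrC; apply: lerD.
Qed.

Lemma sum_pick (f : I -> R) (s : seq I) w : uniq s -> w \in s ->
  \sum_(u <- s) f u * (u == w)%:R = f w.
Proof.
move=> us ws; rewrite (bigD1_seq w)//= eqxx mulr1 big1 ?addr0// => u /negbTE ->.
by rewrite mulr0.
Qed.

(** The waves [cos] and [sin] of the same frequency recombine to the cosine of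
  the difference. *)
Lemma plancherel_bform (a b c : R) (F : seq I) (dl : I -> R * R) (phi : I -> int) (N : nat) (h : nat -> R) :
  (forall p q, phi (subI p q) = (phi p - phi q)%R) ->
  \sum_(j < N) (bform a b c
     (\sum_(p <- F) (dl p).1 * cos (2 * pi * (phi p)%:~R * j%:R / N%:R),
      \sum_(p <- F) (dl p).2 * cos (2 * pi * (phi p)%:~R * j%:R / N%:R))
     (\sum_(p <- F) (dl p).1 * cos (2 * pi * (phi p)%:~R * j%:R / N%:R),
      \sum_(p <- F) (dl p).2 * cos (2 * pi * (phi p)%:~R * j%:R / N%:R)) +
    bform a b c
     (\sum_(p <- F) (dl p).1 * sin (2 * pi * (phi p)%:~R * j%:R / N%:R),
      \sum_(p <- F) (dl p).2 * sin (2 * pi * (phi p)%:~R * j%:R / N%:R))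
     (\sum_(p <- F) (dl p).1 * sin (2 * pi * (phi p)%:~R * j%:R / N%:R),
      \sum_(p <- F) (dl p).2 * sin (2 * pi * (phi p)%:~R * j%:R / N%:R))) * h j =
  \sum_(p <- F) \sum_(q <- F) bform a b c (dl p) (dl q) *
    \sum_(j < N) cos (2 * pi * (phi (subI p q))%:~R * j%:R / N%:R) * h j.
Proof.
move=> phiB.
under [RHS]eq_bigr => p _ do under eq_bigr => q _ do rewrite mulr_sumr.
under [RHS]eq_bigr => p _ do rewrite exchange_big.
rewrite [RHS]exchange_big; apply: eq_bigr => j _.
have bs (f1 f2 : I -> R) : bform a b c (\sum_(p <- F) f1 p, \sum_(p <- F) f2 p)
    (\sum_(p <- F) f1 p, \sum_(p <- F) f2 p) =
    \sum_(p <- F) \sum_(q <- F) bform a b c (f1 p, f2 p) (f1 q, f2 q).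
  have P (g1 g2 : I -> R) : (\sum_(p <- F) g1 p) * (\sum_(p <- F) g2 p) =
     \sum_(p <- F) \sum_(q <- F) g1 p * g2 q.
    by rewrite mulr_suml; apply: eq_bigr => p _; rewrite mulr_sumr.
  rewrite /bform /= !P.
  rewrite -big_split /= !mulr_sumr -!big_split /=; apply: eq_bigr => p _.
  by rewrite -big_split /= !mulr_sumr -!big_split.
rewrite !bs -big_split mulr_suml; apply: eq_bigr => p _.
rewrite -big_split mulr_suml; apply: eq_bigr => q _ /=.
rewrite mulrA; congr (_ * h j); rewrite phiB.
have -> : 2 * pi * (phi p - phi q)%:~R * j%:R / N%:R =
  2 * pi * (phi p)%:~R * j%:R / N%:R - 2 * pi * (phi q)%:~R * j%:R / N%:R :> R.
  by rewrite intrB; ring.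
rewrite cosB /bform /=; ring.
Qed.

End Toeplitz.

Section Toeplitz2.
Context {R : realType}.
Notation I := (int * int)%type.
Implicit Types (p q : I) (d : R * R).

Lemma sum_cos_wave (N : nat) (a b : int) : (0 < N)%N ->
  ((N %| `|a|)%N -> a = 0) -> ((N %| `|(a + b)%R|)%N -> a + b = 0) ->
  ((N %| `|(a - b)%R|)%N -> a - b = 0) ->
  \sum_(j < N) cos (2 * pi * a%:~R * j%:R / N%:R) * wave (2 * pi * b%:~R * j%:R / N%:R) =
  N%:R * ((a == 0)%:R - (a + b == 0)%:R / 2 - (a - b == 0)%:R / 2) :> R.
Proof.
move=> N0 h1 h2 h3.
have S (c : int) : ((N %| `|c|)%N -> c = 0) ->
    \sum_(j < N) cos (2 * pi * c%:~R * j%:R / N%:R) = N%:R * (c == 0)%:R :> R.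
  move=> hc; have := @sum_cos_roots R N c 0 N0.
  under eq_bigr do rewrite addr0.
  move=> ->; case: ifP => [/hc ->|H]; first by rewrite eqxx !(mulr0, mul0r) cos0.
  by case: eqP H => [->|]; rewrite ?dvdn0// mulr0.
have -> : N%:R * ((a == 0)%:R - (a + b == 0)%:R / 2 - (a - b == 0)%:R / 2) =
   N%:R * (a == 0)%:R - (N%:R * (a + b == 0)%:R + N%:R * (a - b == 0)%:R) / 2 :> R by field.
rewrite -!S// -big_split /= mulr_suml -sumrB; apply: eq_bigr => j _.
have -> : 2 * pi * (a + b)%:~R * j%:R / N%:R =
    2 * pi * a%:~R * j%:R / N%:R + 2 * pi * b%:~R * j%:R / N%:R :> R by rewrite intrD; ring.
have -> : 2 * pi * (a - b)%:~R * j%:R / N%:R =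
    2 * pi * a%:~R * j%:R / N%:R - 2 * pi * b%:~R * j%:R / N%:R :> R by rewrite intrB; ring.
by rewrite cosB cosD /wave; field.
Qed.

Lemma trig_sum_le (F : seq I) (f x : I -> R) (g : R -> R) : (forall y, `|g y| <= 1) ->
  (\sum_(p <- F) f p * g (x p)) ^+ 2 <= (\sum_(p <- F) `|f p|) ^+ 2.
Proof.
move=> g1; rewrite -real_normK ?num_real// ler_sqr ?nnegrE ?sumr_ge0//.
apply: le_trans (ler_norm_sum _ _ _) _; apply: ler_sum => p _.
by rewrite normrM ler_piMr.
Qed.

(** Bochner positivity for the finite sections of a matrix-valued convolution.
  The symbol hypothesis is applied at the Fourier coefficients of [dl] for the
  frequencies of a long period, and averaged: by orthogonality this gives back
  the two sides, up to the tail of the kernel. *)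
Lemma toeplitz_le (A B C : I -> R) (F : seq I) (dl : I -> R * R) :
  abs_summable A -> abs_summable B -> abs_summable C ->
  (forall p q, A (subI p q) = A (subI q p)) -> (forall p q, B (subI p q) = B (subI q p)) ->
  (forall p q, C (subI p q) = C (subI q p)) ->
  (forall z w d, 0 <= hsum (fun u => bform (A u) (B u) (C u) d d * wave (angle z w u))) ->
  uniq F ->
  \sum_(p <- F) \sum_(q <- F) bform (A (subI p q)) (B (subI p q)) (C (subI p q)) (dl p) (dl q) <=
  \sum_(p <- F) bform (hsum A) (hsum B) (hsum C) (dl p) (dl p).
Proof.
move=> SA SB SC eA eB eC sym uF; apply/ler_addgt0Pr => e e0.
pose D1 := \sum_(p <- F) `|(dl p).1|; pose D2 := \sum_(p <- F) `|(dl p).2|.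
pose M := 4 * (D1 ^+ 2 + D2 ^+ 2) + 3 * \sum_(p <- F) sqn (dl p).
have sq0 d : 0 <= sqn d by rewrite addr_ge0 ?sqr_ge0.
have M0 : 0 <= M.
  apply: addr_ge0; first by rewrite mulr_ge0// addr_ge0 ?sqr_ge0.
  by rewrite mulr_ge0// sumr_ge0.
pose t := e / (M + 1).
have t0 : 0 < t by rewrite divr_gt0// ltr_wpDl.
have tM : t * M <= e.
  rewrite /t mulrAC ler_pdivrMr ?ltr_wpDl// ler_pM2l// lerDl//.
pose ka u := `|A u| + (`|B u| + `|C u|).
have nn (f : I -> R) : abs_summable f -> abs_summable (fun u => `|f u|).
  by case=> a ha; exists a => s us; under eq_bigr do rewrite normr_id; exact: ha.
have Ska : abs_summable ka by do ?[apply: abs_summableD|apply: nn].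
have ka0 u : 0 <= ka u by rewrite !addr_ge0.
have [s0 hs0] := summable_tail Ska t0.
pose FF := [seq subI p q | p <- F, q <- F].
pose s := undup (s0 ++ FF).
have us : uniq s := undup_uniq _.
have sFF p q : p \in F -> q \in F -> subI p q \in s.
  by move=> pF qF; rewrite mem_undup mem_cat [_ \in FF]allpairs_f// orbT.
have tl s' : uniq s' -> (forall u, u \in s' -> u \notin s) -> \sum_(u <- s') ka u <= t.
  move=> us' ds; have := hs0 s' us'; under eq_bigr do rewrite ger0_norm//.
  by apply=> u /ds; rewrite mem_undup mem_cat negb_or => /andP[].
have close (f : I -> R) (k : R) : 0 <= k -> (forall u, `|f u| <= ka u * k) ->
    abs_summable f /\ `|hsum f - \sum_(u <- s) f u| <= t * k.
  move=> k0 fk; have Sf : abs_summable f.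
    apply: (dominated_summable fk); have := abs_summableZ k Ska.
    by congr abs_summable; apply/funext => u; rewrite mulrC.
  split=> //; apply: tail_close => // s' us' ds.
  apply: (@le_trans _ _ (\sum_(u <- s') ka u * k)); first by apply: ler_sum.
  by rewrite -mulr_suml; apply: ler_wpM2r => //; exact: tl.
(* the wave vectors (j/N, L j/N) see every difference that occurs *)
pose T := FF ++ [seq subI (0, 0) u | u <- [seq subI w u | w <- FF, u <- s]] ++
   [seq subI w u | w <- FF, u <- s] ++ [seq subI w (subI (0, 0) u) | w <- FF, u <- s].
have [L [N [N0 enc]]] := int_encoding T.
pose phi p : int := (p.1 + L%:Z * p.2)%R.
have phiB p q : phi (subI p q) = (phi p - phi q)%R by rewrite /phi /subI /=; ring.
have Np : 0 < N%:R :> R by rewrite ltr0n.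
pose Cj (j : nat) : R * R := (\sum_(p <- F) (dl p).1 * cos (2 * pi * (phi p)%:~R * j%:R / N%:R),
      \sum_(p <- F) (dl p).2 * cos (2 * pi * (phi p)%:~R * j%:R / N%:R)).
pose Sj (j : nat) : R * R := (\sum_(p <- F) (dl p).1 * sin (2 * pi * (phi p)%:~R * j%:R / N%:R),
      \sum_(p <- F) (dl p).2 * sin (2 * pi * (phi p)%:~R * j%:R / N%:R)).
have bC j : sqn (Cj j) <= D1 ^+ 2 + D2 ^+ 2.
  by apply: lerD; apply: trig_sum_le => y; exact: cos_max.
have bS j : sqn (Sj j) <= D1 ^+ 2 + D2 ^+ 2.
  by apply: lerD; apply: trig_sum_le => y; exact: sin_max.
have wj (j : nat) d : - (2 * t * sqn d) <=
   \sum_(u <- s) bform (A u) (B u) (C u) d d * wave (2 * pi * (phi u)%:~R * j%:R / N%:R).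
  set f := fun u => bform (A u) (B u) (C u) d d * wave (angle (j%:R / N%:R) (L%:R * j%:R / N%:R) u).
  have fE u : f u = bform (A u) (B u) (C u) d d * wave (2 * pi * (phi u)%:~R * j%:R / N%:R).
    rewrite /f /angle /phi; congr (_ * wave _).
    by rewrite intrD intrM; ring.
  under eq_bigr do rewrite -fE.
  have w2 (x : R) : `|wave x| <= 2.
    by rewrite ger0_norm ?wave_ge0// /wave; have := cos_geN1 x; lra.
  have k2 : 0 <= 2 * sqn d by rewrite mulr_ge0.
  have [|_] := close f (2 * sqn d) k2.
    move=> u; rewrite /f normrM; set x := angle _ _ _.
    have := ler_pM (normr_ge0 _) (normr_ge0 _) (bform_le (A u) (B u) (C u) d) (w2 x).
    by rewrite /ka; lra.
  have := sym (j%:R / N%:R) (L%:R * j%:R / N%:R) d; rewrite -/f ler_norml => s0' /andP[_ h].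
  by move: s0' h; lra.
have tot : - (N%:R * (4 * t * (D1 ^+ 2 + D2 ^+ 2))) <= \sum_(j < N) \sum_(u <- s)
    (bform (A u) (B u) (C u) (Cj j) (Cj j) + bform (A u) (B u) (C u) (Sj j) (Sj j)) *
    wave (2 * pi * (phi u)%:~R * j%:R / N%:R).
  have -> : - (N%:R * (4 * t * (D1 ^+ 2 + D2 ^+ 2))) =
      \sum_(j < N) - (4 * t * (D1 ^+ 2 + D2 ^+ 2)) :> R.
    by rewrite sumr_const card_ord mulNrn mulr_natl.
  apply: ler_sum => j _.
  under eq_bigr do rewrite mulrDl.
  rewrite big_split /=; apply: le_trans (lerD (wj j (Cj j)) (wj j (Sj j))).
  have := ler_wpM2l (ltW t0) (bC j); have := ler_wpM2l (ltW t0) (bS j); lra.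
have ex : \sum_(j < N) \sum_(u <- s)
    (bform (A u) (B u) (C u) (Cj j) (Cj j) + bform (A u) (B u) (C u) (Sj j) (Sj j)) *
    wave (2 * pi * (phi u)%:~R * j%:R / N%:R) =
  N%:R * (\sum_(p <- F) bform (\sum_(u <- s) A u) (\sum_(u <- s) B u) (\sum_(u <- s) C u) (dl p) (dl p) -
  \sum_(p <- F) \sum_(q <- F) bform (A (subI p q)) (B (subI p q)) (C (subI p q)) (dl p) (dl q)).
  rewrite exchange_big /=.
  under eq_bigr => u _ do rewrite (@plancherel_bform R (A u) (B u) (C u) F dl phi N
    (fun j => wave (2 * pi * (phi u)%:~R * j%:R / N%:R)) phiB).
  rewrite exchange_big /= -sumrB mulr_sumr; apply: eq_big_seq => p pF.
  rewrite exchange_big /=.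
  have row q : q \in F -> \sum_(u <- s) bform (A u) (B u) (C u) (dl p) (dl q) *
     \sum_(j < N) cos (2 * pi * (phi (subI p q))%:~R * j%:R / N%:R) *
       wave (2 * pi * (phi u)%:~R * j%:R / N%:R) =
     N%:R * ((q == p)%:R * \sum_(u <- s) bform (A u) (B u) (C u) (dl p) (dl q) -
       bform (A (subI p q)) (B (subI p q)) (C (subI p q)) (dl p) (dl q)).
    move=> qF; set w := subI p q.
    have wF : w \in FF by exact: allpairs_f.
    have sc : bform (A w) (B w) (C w) (dl p) (dl q) =
        \sum_(u <- s) bform (A u) (B u) (C u) (dl p) (dl q) * ((u == w)%:R / 2 + (u == subI q p)%:R / 2).
      under eq_bigr do rewrite mulrDr !mulrA.
      rewrite big_split /= -!mulr_suml !sum_pick ?sFF//.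
      by rewrite (eA q p) (eB q p) (eC q p) -/w; field.
    rewrite sc mulr_sumr -sumrB mulr_sumr; apply: eq_big_seq => u us'.
    have pz (x : I) : x \in T -> (phi x == 0) = (x == (0, 0)).
      move=> xT; apply/eqP/eqP => [h|->]; last by rewrite /phi /= mulr0 addr0.
      by apply: enc xT _; rewrite -/(phi x) h dvdn0.
    have w1 : w \in T by rewrite mem_cat wF.
    have w2 : subI w u \in T by rewrite !mem_cat (allpairs_f _ wF us') !orbT.
    have w3 : subI w (subI (0, 0) u) \in T.
      by rewrite !mem_cat (_ : _ \in [seq subI w (subI (0, 0) u) | w <- FF, u <- s]) ?orbT//; apply/allpairsP; exists (w, u).
    have pw3 : phi w + phi u = phi (subI w (subI (0, 0) u)) by rewrite /phi /subI /=; ring.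
    have enc' x : x \in T -> (N %| `|phi x|)%N -> phi x = 0.
      by move=> xT /(enc _ xT) ->; rewrite /phi /= mulr0 addr0.
    rewrite sum_cos_wave//; [|exact: enc'|by rewrite pw3; exact: enc'|by rewrite -phiB; exact: enc'].
    rewrite pw3 -phiB !pz//.
    have -> : (w == (0, 0)) = (q == p).
      rewrite /w /subI; case: (p) (q) => [m n] [m' n'] /=; rewrite !xpair_eqE !subr_eq0.
      by rewrite (eq_sym m) (eq_sym n).
    have -> : (subI w u == (0, 0)) = (u == w).
      by rewrite /subI; case: (w) (u) => [m n] [m' n'] /=; rewrite !xpair_eqE !subr_eq0 (eq_sym m) (eq_sym n).
    have -> : (subI w (subI (0, 0) u) == (0, 0)) = (u == subI q p).
      rewrite /w /subI /=; case: (p) (q) (u) => [m n] [m' n'] [a b] /=; rewrite !xpair_eqE.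
      by clear; apply/andP/andP => -[/eqP h1 /eqP h2]; split; apply/eqP; lia.
    by ring.
  rewrite (eq_big_seq _ row) -mulr_sumr sumrB; congr (_ * (_ - _)).
  rewrite (eq_bigr (fun q => (\sum_(u <- s) bform (A u) (B u) (C u) (dl p) (dl q)) * (q == p)%:R)); last by move=> q _; exact: mulrC.
  rewrite (@sum_pick R (fun q => \sum_(u <- s) bform (A u) (B u) (C u) (dl p) (dl q)))//.
  by rewrite /bform !big_split /= -!mulr_suml.
rewrite ex -mulrN ler_pM2l// in tot.
have hp p : bform (\sum_(u <- s) A u) (\sum_(u <- s) B u) (\sum_(u <- s) C u) (dl p) (dl p) -
    3 * t * sqn (dl p) <= bform (hsum A) (hsum B) (hsum C) (dl p) (dl p).
  have [_ cA] := close A 1 ler01 (fun u => ltac:(rewrite mulr1 /ka lerDl addr_ge0//)).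
  have [_ cB] := close B 1 ler01 (fun u => ltac:(rewrite mulr1 /ka addrCA lerDl addr_ge0//)).
  have [_ cC] := close C 1 ler01 (fun u => ltac:(rewrite mulr1 /ka addrA lerDr addr_ge0//)).
  rewrite !mulr1 in cA cB cC.
  have := @bform_le R (hsum A - \sum_(u <- s) A u) (hsum B - \sum_(u <- s) B u) (hsum C - \sum_(u <- s) C u) (dl p).
  have k : (`|hsum A - \sum_(u <- s) A u| + `|hsum B - \sum_(u <- s) B u| + `|hsum C - \sum_(u <- s) C u|) *
     sqn (dl p) <= 3 * t * sqn (dl p) by apply: ler_wpM2r => //; lra.
  move=> /le_trans/(_ k); rewrite ler_norml => /andP[h _]; move: h; rewrite /bform; lra.
have hP : \sum_(p <- F) bform (\sum_(u <- s) A u) (\sum_(u <- s) B u) (\sum_(u <- s) C u) (dl p) (dl p) -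
    3 * t * \sum_(p <- F) sqn (dl p) <= \sum_(p <- F) bform (hsum A) (hsum B) (hsum C) (dl p) (dl p).
  by rewrite mulr_sumr -sumrB; apply: ler_sum => p _; exact: hp.
move: tM; rewrite /M; move: tot hP; lra.
Qed.

End Toeplitz2.

(** * The Hessian kernel with the cubic remainder subtracted *)
Section Kernel.
Context {R : realType}.
Notation I := (int * int)%type.
Implicit Types (p q : I) (d : R * R).

Lemma summable_inj (T T' : eqType) (h : T' -> T) (f : T -> R) : injective h ->
  abs_summable f -> abs_summable (f \o h).
Proof.
move=> hi [A hA]; exists A => s us.
have := hA (map h s); rewrite big_map; apply.
by rewrite map_inj_uniq.
Qed.

Definition hw (la : R) p : R := hgauss la (hexpt p).

(** The cubic Taylor remainder of a pair at lattice distance [p] costs at most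
  a small multiple of this per squared displacement. *)
Definition om (la : R) p : R := (1 + 4 * habs (hexpt p)) ^+ 3 * hw la p.

(** Coefficients of half the Hessian of the Gaussian, minus [ka om] times the
  identity: with [kA, kB, kC] the Taylor polynomial is a lower bound without
  remainder. *)
Definition kA (g la ka : R) p : R :=
  g * (2 * la * (hexpt p).1%:~R ^+ 2 - 1) * hw la p - ka * om la p.
Definition kB (g la ka : R) p : R :=
  g * (2 * la * (hexpt p).1%:~R * (s3 * (hexpt p).2%:~R)) * hw la p.
Definition kC (g la ka : R) p : R :=
  g * (2 * la * (s3 * (hexpt p).2%:~R) ^+ 2 - 1) * hw la p - ka * om la p.

Lemma kformE (g la ka : R) p d :
  bform (kA g la ka p) (kB g la ka p) (kC g la ka p) d d =
  g * stiff la d.1 d.2 (hexpt p) - ka * om la p * sqn d.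
Proof. by rewrite /bform /stiff par_hexpt /dirv /sqn /kA /kB /kC -/(hw la p); ring. Qed.

Lemma hexpt_inj : injective hexpt. Proof. exact: can_inj hexptK. Qed.

Lemma weight_summable (C L la : R) (f : I -> R) : 0 < la -> 0 <= L ->
  (forall p, `|f p| <= C * expR (L * habs (hexpt p))) ->
  abs_summable (fun p => f p * hw la p).
Proof.
move=> la0 L0 fC.
have C0 : 0 <= C.
  have := le_trans (normr_ge0 _) (fC (0, 0)).
  by rewrite pmulr_lge0 ?expR_gt0.
have fu u : `|C * expR (L * habs u)| <= C * expR (L * habs u).
  by rewrite ger0_norm// mulr_ge0 ?expR_ge0.
have S := summable_inj hexpt_inj (@hgauss_summable R C L la _ la0 L0 fu).
apply: dominated_summable S => p /=.
by rewrite normrM (ger0_norm (expR_ge0 _)); apply: ler_wpM2r (fC p); exact: expR_ge0.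
Qed.

Lemma habs_le_exp u : 1 + 4 * habs u <= expR (4 * habs u) :> R.
Proof. exact: expR_ge1Dx. Qed.

Lemma om_summable (la : R) : 0 < la -> abs_summable (om la).
Proof.
move=> la0; apply: (@weight_summable 1 12) => // p.
have h0 : 0 <= 1 + 4 * habs (hexpt p) :> R by rewrite addr_ge0// mulr_ge0// habs_ge0.
rewrite mul1r ger0_norm ?exprn_ge0//.
have -> : 12 * habs (hexpt p) = 3%:R * (4 * habs (hexpt p)) :> R by ring.
by rewrite expRM_natl lerXn2r ?nnegrE ?expR_ge0// habs_le_exp.
Qed.

Lemma hw_le_om (la : R) p : hw la p <= om la p.
Proof.
rewrite /om ler_peMl ?expR_ge0//; apply: exprn_ege1.
by rewrite lerDl mulr_ge0// habs_ge0.
Qed.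

Lemma om_ge0 (la : R) p : 0 <= om la p.
Proof. by apply: le_trans (hw_le_om la p); exact: expR_ge0. Qed.

Lemma sq1_le_habs u : u.1%:~R ^+ 2 <= habs u ^+ 2 :> R.
Proof. by rewrite -real_normK ?num_real// ler_sqr ?nnegrE ?habs_ge0// lerDl. Qed.
Lemma sq2_le_habs u : u.2%:~R ^+ 2 <= habs u ^+ 2 :> R.
Proof. by rewrite -real_normK ?num_real// ler_sqr ?nnegrE ?habs_ge0// lerDr. Qed.

Lemma wave_add (x y : R) : wave (x + y) <= 2 * (wave x + wave y).
Proof.
have [|_] := @wave_tri R x (- (x + y)) y; first by ring.
by rewrite /wave cosN.
Qed.

(** [|sin (n x)| <= n |sin x|] by induction on [n]. *)
Lemma wave_mul (m : int) (x : R) : wave (m%:~R * x) <= m%:~R ^+ 2 * wave x.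
Proof.
have H (n : nat) y : `|sin (n%:R * y)| <= n%:R * `|sin y| :> R.
  elim: n => [|n IH]; first by rewrite !mul0r sin0 normr0.
  rewrite -addn1 natrD mulrDl mul1r sinD; apply: le_trans (ler_normD _ _) _.
  rewrite !normrM mulrDl mul1r; apply: lerD.
    by apply: le_trans IH; rewrite ler_piMr// cos_max.
  by rewrite ler_piMl// cos_max.
have e : wave (m%:~R * x) = wave (`|m|%N%:R * x).
  by case: m => k //=; rewrite NegzE mulrNz mulNr /wave cosN.
have -> : m%:~R ^+ 2 = `|m|%N%:R ^+ 2 :> R by rewrite natr_absz intr_norm real_normK ?num_real.
rewrite e !wave_sin; have -> : `|m|%N%:R * x / 2 = `|m|%N%:R * (x / 2) :> R by rewrite mulrA.
have := H `|m|%N (x / 2) => h.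
have : sin (`|m|%N%:R * (x / 2)) ^+ 2 <= (`|m|%N%:R * `|sin (x / 2)|) ^+ 2 :> R.
  by rewrite -(@real_normK _ (sin _)) ?num_real// lerXn2r ?nnegrE ?mulr_ge0.
by rewrite exprMn real_normK ?num_real//; clear; lra.
Qed.

Lemma wave_angle_le z w p : wave (angle z w p) <=
  4 * habs (hexpt p) ^+ 2 * (wave (2 * pi * z) + wave (2 * pi * w)) :> R.
Proof.
have -> : angle z w p = p.1%:~R * (2 * pi * z) + p.2%:~R * (2 * pi * w) :> R.
  by rewrite /angle; ring.
apply: le_trans (wave_add _ _) _.
have h1 := wave_mul p.1 (2 * pi * z); have h2 := wave_mul p.2 (2 * pi * w).
have a2 := sq2_le_habs (hexpt p); have W1 := wave_ge0 (2 * pi * z : R).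
have W2 := wave_ge0 (2 * pi * w : R).
have a1 : p.1%:~R ^+ 2 <= habs (hexpt p) ^+ 2 :> R.
  rewrite -real_normK ?num_real// ler_sqr ?nnegrE ?habs_ge0//.
  have -> : p.1%:~R = ((hexpt p).1%:~R - (hexpt p).2%:~R) / 2 :> R.
    by rewrite /hexpt /= intrD intrM; field.
  rewrite normrM normfV (@ger0_norm _ 2)// /habs.
  have := ler_normB ((hexpt p).1%:~R : R) (hexpt p).2%:~R.
  have := normr_ge0 ((hexpt p).1%:~R : R); have := normr_ge0 ((hexpt p).2%:~R : R).
  lra.
have {}a2 : p.2%:~R ^+ 2 <= habs (hexpt p) ^+ 2 :> R := a2.
have := ler_wpM2r W1 a1; have := ler_wpM2r W2 a2.
have := mulr_ge0 (sqr_ge0 (habs (hexpt p))) W1; have := mulr_ge0 (sqr_ge0 (habs (hexpt p))) W2.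
move: h1 h2; clear; lra.
Qed.

Lemma hw_mono (l0 la : R) p : l0 <= la -> hw la p <= hw l0 p.
Proof.
move=> h; rewrite ler_expR lerN2 ler_wpM2r// addr_ge0 ?sqr_ge0//.
by rewrite mulr_ge0// sqr_ge0.
Qed.

(** A phase at a far point is a combination of the two phases in [wave2], at a
  quadratic cost that the Gaussian absorbs. The constant is that of the
  smallest parameter. *)
Lemma om_wave_sum (l0 : R) : 0 < l0 -> exists2 C : R, 0 < C & forall la z w, l0 <= la ->
  abs_summable (fun p => om la p * wave (angle z w p)) /\
  hsum (fun p => om la p * wave (angle z w p)) <= C * (wave (2 * pi * z) + wave (2 * pi * w)).
Proof.
move=> l00; pose F p : R := (1 + 4 * habs (hexpt p)) ^+ 3 * (4 * habs (hexpt p) ^+ 2).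
have F0 p : 0 <= F p.
  apply: mulr_ge0; last by apply: mulr_ge0 => //; exact: sqr_ge0.
  by apply: exprn_ge0; apply: addr_ge0 => //; apply: mulr_ge0 => //; exact: habs_ge0.
have SF : abs_summable (fun p => F p * hw l0 p).
  apply: (@weight_summable 4 14) => // p; rewrite ger0_norm// /F.
  have h0 := @habs_ge0 R (hexpt p).
  have -> : 14 * habs (hexpt p) = 3%:R * (4 * habs (hexpt p)) + 2%:R * habs (hexpt p) :> R by ring.
  rewrite expRD !expRM_natl mulrCA ler_pM2l//.
  have b0 : 0 <= 1 + 4 * habs (hexpt p) :> R by move: h0; clear; lra.
  apply: ler_pM; [exact: exprn_ge0|exact: sqr_ge0| |].
    by rewrite lerXn2r ?nnegrE ?exprn_ge0 ?expR_ge0 // -expRM_natl habs_le_exp.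
  rewrite lerXn2r ?nnegrE ?expR_ge0//.
  by have := expR_ge1Dx (habs (hexpt p) : R); lra.
have H0 : 0 <= hsum (fun p => F p * hw l0 p).
  by apply: hsum_ge0 => // p; rewrite mulr_ge0 ?expR_ge0.
exists (hsum (fun p => F p * hw l0 p) + 1); first by rewrite ltr_wpDl.
move=> la z w h; set W := wave _ + wave _.
have W0 : 0 <= W by apply: addr_ge0; exact: wave_ge0.
have le p : om la p * wave (angle z w p) <= W * (F p * hw l0 p).
  have -> : W * (F p * hw l0 p) = (1 + 4 * habs (hexpt p)) ^+ 3 * hw l0 p * (4 * habs (hexpt p) ^+ 2 * W).
    by rewrite /F; ring.
  apply: ler_pM; [exact: om_ge0|exact: wave_ge0| |exact: wave_angle_le].
  apply: ler_wpM2l; last exact: hw_mono.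
  by rewrite exprn_ge0// addr_ge0// mulr_ge0// habs_ge0.
have SWF := abs_summableZ W SF.
have S : abs_summable (fun p => om la p * wave (angle z w p)).
  by apply: dominated_summable SWF => p; rewrite ger0_norm// mulr_ge0 ?om_ge0 ?wave_ge0.
split=> //; apply: le_trans (le_hsum S SWF le) _; rewrite hsumZ// mulrC ler_wpM2r//.
by rewrite lerDl.
Qed.

(** The cubic remainders are harmless: their symbol is controlled by the same
  first-shell expression that bounds the symbol of the Hessian from below. *)
Lemma kernel_symbol (rr a0 a1 : R) : 0 < rr -> 0 < a0 -> exists2 ka : R, 0 < ka &
  forall g, a0 <= g <= a1 -> forall z w d,
  0 <= hsum (fun p => bform (kA g (g * rr) ka p) (kB g (g * rr) ka p) (kC g (g * rr) ka p) d d *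
     wave (angle z w p)).
Proof.
move=> r0 a00; have l00 : 0 < a0 * rr by rewrite mulr_gt0.
have [c c0 Hc] := @symbol_lower R (a0 * rr) (a1 * rr) l00.
have [C C0 HC] := om_wave_sum l00.
exists (a0 * c / C); first by rewrite divr_gt0// mulr_gt0.
set ka := a0 * c / C => g /andP[g0 g1] z w d.
have gp : 0 < g := lt_le_trans a00 g0.
set la := g * rr; have la0 : a0 * rr <= la by rewrite ler_pM2r.
have la1 : la <= a1 * rr by rewrite ler_pM2r.
have lap : 0 < la by rewrite mulr_gt0.
have [S2 h2] := HC la z w la0.
have h1 := Hc la _ (z / 2) (w - z / 2) d.1 d.2.
rewrite la0 la1 in h1; have {}h1 := h1 isT.
have w2E : wave2 (z / 2) (w - z / 2) = wave (2 * pi * z) + wave (2 * pi * w).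
  by rewrite /wave2 /angle /=; congr (wave _ + wave _); field.
set f := fun u => stiff _ _ _ _ * _ in h1.
have Sf : abs_summable f.
  have := abs_summableB (stiff_summable d.1 d.2 lap) (stiff_cos_summable (z / 2) (w - z / 2) d.1 d.2 lap).
  by congr abs_summable; apply/funext => u; rewrite /f /wave; ring.
have [Sg Eg] : abs_summable (f \o hexpt) /\ hsum f = hsum (f \o hexpt).
  by apply: hsum_hexpt => // u p0; rewrite /f /stiff p0 !mul0r.
have -> : (fun p => bform (kA g la ka p) (kB g la ka p) (kC g la ka p) d d * wave (angle z w p)) =
   (fun p => g * (f \o hexpt) p - ka * sqn d * (om la p * wave (angle z w p))).
  apply/funext => p; rewrite kformE /f /=.
  have -> : angle (z / 2) (w - z / 2) (hexpt p) = angle z w p.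
    by rewrite /angle /hexpt /= intrD intrM; field.
  by ring.
rewrite hsumB; [|exact: abs_summableZ|exact: abs_summableZ].
rewrite !hsumZ// -Eg subr_ge0.
rewrite w2E -/(sqn d) in h1.
set W := wave _ + wave _ in h1 h2.
have W0 : 0 <= W by apply: addr_ge0; exact: wave_ge0.
have V0 : 0 <= sqn d by rewrite addr_ge0 ?sqr_ge0.
have ka0 : 0 <= ka * sqn d by rewrite mulr_ge0// divr_ge0 ?mulr_ge0 ?ltW.
apply: le_trans (ler_wpM2l ka0 h2) _.
have -> : ka * sqn d * (C * W) = a0 * (c * sqn d * W).
  by rewrite /ka; field; rewrite gt_eqF.
apply: ler_pM => //; first exact: ltW.
by rewrite !mulr_ge0// ltW.
Qed.

End Kernel.

(** * The energy of a finite window *)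
Section PairTaylor.
Context {R : realType}.
Notation I := (int * int)%type.
Implicit Types (p q : I) (d : R * R).

(** The cubic Taylor polynomial is a lower bound for the exponential on the
  whole line; what exceeds the second order in [D] is bounded by [D ^ 3]. *)
Lemma gauss_taylor (g y M D : R) : 0 <= g -> 0 <= D -> D <= 1 -> 0 <= M -> `|y| <= M * D ->
  1 - 2 * g * y - g * D ^+ 2 + 2 * g ^+ 2 * y ^+ 2 - D ^+ 3 * ((1 + g) ^+ 3 * (1 + 2 * M) ^+ 3) <=
  expR (- (2 * g * y + g * D ^+ 2)).
Proof.
move=> g0 D0 D1 M0 yM; set E := 2 * g * y + g * D ^+ 2.
have T := expR_ge_taylor3 (- E).
have D2 : D ^+ 2 <= D by rewrite expr2 ler_piMr.
have EE : E <= g * D * (1 + 2 * M).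
  have h : y <= M * D by apply: le_trans yM; exact: ler_norm.
  have := ler_wpM2l g0 h; have := ler_wpM2l g0 D2; rewrite /E; clear; lra.
have E3 : E ^+ 3 <= (g * D * (1 + 2 * M)) ^+ 3.
  have [E0|E0] := leP 0 E.
    by rewrite lerXn2r ?nnegrE//; apply: le_trans EE.
  apply: (@le_trans _ _ 0).
    by rewrite exprS mulr_le0_ge0 ?sqr_ge0// ltW.
  by apply: exprn_ge0; apply: mulr_ge0; [exact: mulr_ge0|move: M0; clear; lra].
have E2 : 2 * g ^+ 2 * y ^+ 2 - 2 * g ^+ 2 * M * D ^+ 3 <= E ^+ 2 / 2.
  have h : - (M * D) <= y by move: yM; rewrite ler_norml => /andP[].
  have k : 0 <= g ^+ 2 * D ^+ 2 by rewrite mulr_ge0 ?sqr_ge0.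
  have := ler_wpM2l k h; have := sqr_ge0 (g * D ^+ 2).
  have -> : E ^+ 2 / 2 = 2 * g ^+ 2 * y ^+ 2 + 2 * (g ^+ 2 * D ^+ 2 * y) + (g * D ^+ 2) ^+ 2 / 2.
    by rewrite /E; field.
  have -> : 2 * g ^+ 2 * M * D ^+ 3 = 2 * (g ^+ 2 * D ^+ 2 * (M * D)) by ring.
  rewrite mulrN; clear; lra.
have D3 : 0 <= D ^+ 3 by exact: exprn_ge0.
have K : 2 * g ^+ 2 * M + g ^+ 3 * (1 + 2 * M) ^+ 3 / 6 <= (1 + g) ^+ 3 * (1 + 2 * M) ^+ 3.
  have m1 : 2 * M <= (1 + 2 * M) ^+ 3.
    have := mulr_ge0 M0 M0; have := mulr_ge0 M0 (mulr_ge0 M0 M0).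
    by rewrite !exprS expr0; move: M0; clear; lra.
  have g2 : g ^+ 2 + g ^+ 3 <= (1 + g) ^+ 3.
    by have := mulr_ge0 g0 g0; rewrite !exprS expr0; move: g0; clear; lra.
  have q0 : 0 <= (1 + 2 * M) ^+ 3 by apply: exprn_ge0; move: M0; clear; lra.
  have h1 := ler_wpM2l (sqr_ge0 g) m1; have h2 := ler_wpM2r q0 g2.
  have g3 : 0 <= g ^+ 3 * (1 + 2 * M) ^+ 3 by rewrite mulr_ge0// exprn_ge0.
  move: h1 h2 g3; clear; lra.
have := ler_wpM2l D3 K.
have e : (g * D * (1 + 2 * M)) ^+ 3 = D ^+ 3 * (g ^+ 3 * (1 + 2 * M) ^+ 3) by rewrite !exprMn; ring.
rewrite e in E3; move: T E3 E2; rewrite sqrrN.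
have -> : (- E) ^+ 3 = - E ^+ 3 by ring.
set P := (1 + g) ^+ 3 * _; set Q := g ^+ 3 * _.
rewrite /E; move: (expR _) => X; clear; lra.
Qed.

Lemma dirv_le d u : `|dirv d.1 d.2 u| <= 2 * habs u * Num.sqrt (sqn d).
Proof.
have D0 := sqrtr_ge0 (sqn d).
have sq0 : 0 <= sqn d by rewrite addr_ge0 ?sqr_ge0.
have h1 : `|d.1| <= Num.sqrt (sqn d) by rewrite -sqrtr_sqr ler_wsqrtr// lerDl sqr_ge0.
have h2 : `|d.2| <= Num.sqrt (sqn d) by rewrite -sqrtr_sqr ler_wsqrtr// lerDr sqr_ge0.
apply: le_trans (ler_normD _ _) _; rewrite !normrM (ger0_norm (ltW (@s3_gt0 R))).
have s2 : s3 <= 2 :> R.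
  have h := @s3_sqr R; rewrite -(ler_pXn2r (isT : (0 < 2)%N)) ?nnegrE//; last exact: ltW s3_gt0.
  by rewrite h; clear; lra.
have k1 := ler_wpM2l (normr_ge0 (u.1%:~R : R)) h1.
have k2 := ler_pM (ltW s3_gt0) (normr_ge0 (u.2%:~R : R)) s2 (lexx `|u.2%:~R|).
have k3 := ler_pM (mulr_ge0 (ltW s3_gt0) (normr_ge0 (u.2%:~R : R))) (normr_ge0 d.2) k2 h2.
have := mulr_ge0 (normr_ge0 (u.1%:~R : R)) D0; rewrite /habs; move: k1 k3; clear; lra.
Qed.

Lemma rstar_sqr : rstar R ^+ 2 = 2 / s3.
Proof. by rewrite sqr_sqrtr// divr_ge0// ltW// s3_gt0. Qed.

Lemma rstar_gt0 : 0 < rstar R.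
Proof. by rewrite sqrtr_gt0 divr_gt0// s3_gt0. Qed.

Lemma rstar_le2 : rstar R <= 2.
Proof.
rewrite -(ler_pXn2r (isT : (0 < 2)%N)) ?nnegrE//; last exact: ltW rstar_gt0.
rewrite rstar_sqr ler_pdivrMr ?s3_gt0//.
have h := @s3_sqr R; have h0 := @s3_gt0 R.
have : 1 <= s3 :> R by rewrite -(ler_pXn2r (isT : (0 < 2)%N)) ?nnegrE ?ltW// h expr1n; clear; lra.
clear; lra.
Qed.

(** Displacements of size at most [eps] give differences of size at most [2
  eps], and the cubic remainder is at most [2 eps] times a quadratic term. *)
Lemma pair_taylor (g la ka eps : R) p d : la = g * (rstar R ^+ 2 / 4) -> 0 <= g -> 0 <= eps -> 2 * eps <= 1 ->
  2 * eps * (1 + g) ^+ 3 <= ka -> sqn d <= (2 * eps) ^+ 2 ->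
  hw la p - g * rstar R * dirv d.1 d.2 (hexpt p) * hw la p +
  bform (kA g la ka p) (kB g la ka p) (kC g la ka p) d d <=
  expR (- (la * ((hexpt p).1%:~R ^+ 2 + 3 * (hexpt p).2%:~R ^+ 2) +
     g * rstar R * dirv d.1 d.2 (hexpt p) + g * sqn d)).
Proof.
move=> laE g0 e0 e1 kaE dE.
have sq0 : 0 <= sqn d by rewrite addr_ge0 ?sqr_ge0.
pose D := Num.sqrt (sqn d).
have D0 : 0 <= D := sqrtr_ge0 _.
have DE : D ^+ 2 = sqn d by rewrite sqr_sqrtr.
have D2 : D <= 2 * eps.
  by rewrite -(ler_pXn2r (isT : (0 < 2)%N)) ?nnegrE ?DE ?mulr_ge0.
have D1 : D <= 1 := le_trans D2 e1.
pose y := rstar R / 2 * dirv d.1 d.2 (hexpt p).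
have M0 : 0 <= 2 * habs (hexpt p) :> R by rewrite mulr_ge0// habs_ge0.
have yM : `|y| <= 2 * habs (hexpt p) * D.
  rewrite /y normrM; apply: le_trans (dirv_le _ _).
  rewrite ler_piMl// ger0_norm; first by have := rstar_le2; clear; lra.
  by rewrite divr_ge0// ltW// rstar_gt0.
have T := gauss_taylor g0 D0 D1 M0 yM.
have W0 : 0 <= hw la p := expR_ge0 _.
have -> : expR (- (la * ((hexpt p).1%:~R ^+ 2 + 3 * (hexpt p).2%:~R ^+ 2) +
     g * rstar R * dirv d.1 d.2 (hexpt p) + g * sqn d)) = hw la p * expR (- (2 * g * y + g * D ^+ 2)).
  by rewrite -expRD; congr expR; rewrite DE /y; field.
apply: le_trans (ler_wpM2l W0 T).
rewrite kformE /stiff par_hexpt mul1r -/(hw la p) /om.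
have -> : 1 + 2 * (2 * habs (hexpt p)) = 1 + 4 * habs (hexpt p) :> R by ring.
set Y := (1 + 4 * habs (hexpt p)) ^+ 3.
have Y0 : 0 <= Y by apply: exprn_ge0; move: M0; clear; lra.
have G0 : 0 <= (1 + g) ^+ 3 by apply: exprn_ge0; move: g0; clear; lra.
have h1 : D ^+ 3 * (1 + g) ^+ 3 <= sqn d * ka.
  rewrite exprSr DE -mulrA ler_wpM2l//; apply: le_trans kaE.
  by rewrite ler_wpM2r.
have h2 := ler_wpM2r (mulr_ge0 Y0 W0) h1.
have e : g * (2 * la * dirv d.1 d.2 (hexpt p) ^+ 2) = 2 * g ^+ 2 * y ^+ 2.
  by rewrite laE /y; field.
have e' : g * ((2 * la * dirv d.1 d.2 (hexpt p) ^+ 2 - (d.1 ^+ 2 + d.2 ^+ 2)) * hw la p) =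
  (2 * g ^+ 2 * y ^+ 2 - g * sqn d) * hw la p by rewrite mulrA mulrBr e.
rewrite e' DE.
have -> : g * rstar R * dirv d.1 d.2 (hexpt p) = 2 * g * y by rewrite /y; field.
move: h2; clear; lra.
Qed.

End PairTaylor.

Section EnergyLower.
Context {R : realType}.
Notation I := (int * int)%type.
Implicit Types (p q : I) (d e : R * R).

Definition vsub d e : R * R := (d.1 - e.1, d.2 - e.2).

Lemma subI_injr p : injective (subI p).
Proof. by case: p => m n [a b] [a' b']; rewrite /subI /= => -[h1 h2]; congr pair; lia. Qed.

(** All boundary terms are defects: what the window [F], seen from [p], misses
  of the sum over the lattice. *)
Definition defect (f : I -> R) (F : seq I) p : R := hsum f - \sum_(q <- F) f (subI p q).

(** The points missed are the same for [f] and [psi]. *)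
Lemma defect_le (f psi : I -> R) (F : seq I) p : uniq F -> abs_summable psi ->
  (forall u, `|f u| <= psi u) -> `|defect f F p| <= defect psi F p.
Proof.
move=> uF Sp fp; have Sf := dominated_summable fp Sp.
have us : uniq (map (subI p) F) by rewrite map_inj_uniq//; exact: subI_injr.
have h1 := hsum_ge_finite us (abs_summableB Sp Sf) (fun u _ => ltac:(rewrite subr_ge0; exact: le_trans (ler_norm _) (fp u))).
have h2 := hsum_ge_finite us (abs_summableD Sp Sf) (fun u _ => ltac:(
  rewrite -[X in _ <= _ + X]opprK subr_ge0; apply: le_trans (fp u); rewrite -normrN; exact: ler_norm)).
rewrite !big_map sumrB hsumB// in h1; rewrite !big_map big_split hsumD//= in h2.
by rewrite /defect ler_norml; apply/andP; split; lra.
Qed.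

Lemma defect_sum (f : I -> R) (F : seq I) :
  \sum_(p <- F) defect f F p = (size F)%:R * hsum f - \sum_(p <- F) \sum_(q <- F) f (subI p q).
Proof. by rewrite sumrB big_const_seq count_predT iter_addr_0 mulr_natl. Qed.

Lemma hexpt_negz p : hexpt (negz p) = negz (hexpt p).
Proof. by rewrite /hexpt /negz /=; congr pair; lia. Qed.

Lemma subI_negz p q : subI q p = negz (subI p q).
Proof. by rewrite /subI /negz /=; congr pair; lia. Qed.

Lemma hw_negz (la : R) p : hw la (negz p) = hw la p.
Proof. by rewrite /hw hexpt_negz /hgauss /negz /= !mulrNz !sqrrN. Qed.

Lemma om_negz (la : R) p : om la (negz p) = om la p.
Proof. by rewrite /om hw_negz hexpt_negz /habs /negz /= !mulrNz !normrN. Qed.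

Lemma kABC_negz (g la ka : R) p : [/\ kA g la ka (negz p) = kA g la ka p,
  kB g la ka (negz p) = kB g la ka p & kC g la ka (negz p) = kC g la ka p].
Proof.
rewrite /kA /kB /kC hw_negz om_negz hexpt_negz /negz /= !mulrNz.
by split; ring.
Qed.

Lemma dirv_negz d u : dirv d.1 d.2 (negz u) = - dirv d.1 d.2 u.
Proof. by rewrite /dirv /negz /= !mulrNz; ring. Qed.

Lemma kernel_summable (g la ka : R) : 0 < la ->
  [/\ abs_summable (kA g la ka), abs_summable (kB g la ka) & abs_summable (kC g la ka)].
Proof.
move=> la0.
have So := abs_summableZ ka (om_summable la0).
have P (f : I -> R) (c : R) : 0 <= c -> (forall p, `|f p| <= c * (habs (hexpt p) ^+ 2 + 1)) ->
    abs_summable (fun p => f p * hw la p).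
  move=> c0 fc; apply: (@weight_summable R (3 * c) 1) => // p.
  apply: le_trans (fc p) _.
  have h1 := @habs_sqr_le R (hexpt p); have h2 := expR_ge1Dx (1 * habs (hexpt p) : R).
  have h0 := @habs_ge0 R (hexpt p).
  by rewrite (mulrC 3) -mulrA ler_wpM2l//; move: h1 h2 h0; clear; lra.
have l2 : 0 <= 2 * la by rewrite mulr_ge0// ltW.
have gg (x : R) : `|g * x| = `|g| * `|x| by rewrite normrM.
have g0 := normr_ge0 g.
have D (x h : R) : 0 <= h -> x ^+ 2 <= 3 * h -> `|g * (2 * la * x ^+ 2 - 1)| <= `|g| * (6 * la + 1) * (h + 1).
  move=> h0 xh; rewrite gg -[X in _ <= X]mulrA ler_wpM2l//.
  apply: le_trans (ler_normB _ _) _; rewrite normr1 ger0_norm; last by rewrite mulr_ge0 ?sqr_ge0.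
  have := ler_wpM2l l2 xh; have := mulr_ge0 (ltW la0) h0; move: la0; clear; nra.
have c0 : 0 <= `|g| * (6 * la + 1) by rewrite mulr_ge0//; move: la0; clear; lra.
have s33 := @s3_sqr R.
have hs p := sqr_ge0 (habs (hexpt p) : R).
split.
- apply: abs_summableB => //; apply: (P _ _ c0) => p; apply: D => //.
  by have := @sq1_le_habs R (hexpt p); have := hs p; lra.
- apply: (P _ _ c0) => p; rewrite gg -(mulrA `|g|) ler_wpM2l//.
  have h1 := @sq1_le_habs R (hexpt p); have h2 := @sq2_le_habs R (hexpt p).
  rewrite -mulrA normrM (ger0_norm l2).
  set a : R := (hexpt p).1%:~R in h1 *; set b : R := (hexpt p).2%:~R in h2 *.
  have : `|a * (s3 * b)| <= 2 * habs (hexpt p) ^+ 2.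
    have s3b : (s3 * b) ^+ 2 = 3 * b ^+ 2 by rewrite exprMn s33.
    rewrite ler_norml; apply/andP; split.
      by have := sqr_ge0 (a + s3 * b); rewrite sqrrD s3b; move: h1 h2; clear; lra.
    by have := sqr_ge0 (a - s3 * b); rewrite sqrrB s3b; move: h1 h2; clear; lra.
  move=> h; have := ler_wpM2l l2 h; have := mulr_ge0 (ltW la0) (hs p).
  by move: la0 (hs p); clear; nra.
- apply: abs_summableB => //; apply: (P _ _ c0) => p; apply: D => //.
  by rewrite exprMn s33; have := @sq2_le_habs R (hexpt p); have := hs p; lra.
Qed.

Lemma hsum_bform (A B C : I -> R) d : abs_summable A -> abs_summable B -> abs_summable C ->
  hsum (fun u => bform (A u) (B u) (C u) d d) = bform (hsum A) (hsum B) (hsum C) d d.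
Proof.
move=> SA SB SC; rewrite /bform.
have E (f : I -> R) (k : R) : abs_summable f -> hsum (fun u => f u * k) = hsum f * k /\ abs_summable (fun u => f u * k).
  move=> Sf; have e : (fun u => f u * k) = (fun u => k * f u) by apply/funext => u; rewrite mulrC.
  by rewrite e hsumZ// mulrC; split=> //; exact: abs_summableZ.
have [E1 S1] := E _ (d.1 * d.1) SA; have [E2 S2] := E _ (d.1 * d.2 + d.2 * d.1) SB.
have [E3 S3] := E _ (d.2 * d.2) SC.
rewrite hsumD//; last exact: abs_summableD.
by rewrite hsumD// E1 E2 E3.
Qed.

Definition lin (g la : R) d p : R := g * rstar R * dirv d.1 d.2 (hexpt p) * hw la p.

Lemma hsum_lin (g la : R) d : abs_summable (lin g la d) -> hsum (lin g la d) = 0.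
Proof.
move=> S; have [_ E] := hsum_reindex negzK negzK S.
have : hsum (lin g la d \o negz) = - hsum (lin g la d).
  rewrite -mulN1r -hsumZ//; congr hsum; apply/funext => p /=.
  by rewrite /lin hexpt_negz dirv_negz hw_negz; ring.
by rewrite E; lra.
Qed.

(** The interaction of two displaced points with lattice difference [p] and
  displacement difference [d]. *)
Definition pairphi (g la : R) p d : R :=
  expR (- (la * ((hexpt p).1%:~R ^+ 2 + 3 * (hexpt p).2%:~R ^+ 2) +
     g * rstar R * dirv d.1 d.2 (hexpt p) + g * sqn d)).

(** In the sum of the pairwise Taylor bounds the linear terms have total sum
  zero around each point, by symmetry, and the quadratic ones are nonnegative
  by [toeplitz_le]; both statements concern full rows, and the rows cut by the
  window cost defects. The function [psi] does not depend on the window. *)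
Lemma energy_lower (g la ka eps : R) : la = g * (rstar R ^+ 2 / 4) -> 0 < g -> 0 <= eps -> 2 * eps <= 1 ->
  2 * eps * (1 + g) ^+ 3 <= ka ->
  (forall z w d, 0 <= hsum (fun p => bform (kA g la ka p) (kB g la ka p) (kC g la ka p) d d *
     wave (angle z w p))) ->
  exists psi : I -> R, [/\ abs_summable psi, forall u, 0 <= psi u &
    forall (F : seq I) (dl : I -> R * R), uniq F -> (forall p, sqn (dl p) <= eps ^+ 2) ->
    (size F)%:R * hsum (hw la) - \sum_(p <- F) defect psi F p <=
    \sum_(p <- F) \sum_(q <- F) pairphi g la (subI p q) (vsub (dl p) (dl q))].
Proof.
move=> laE g0 e0 e1 kaE sym.
have r0 := @rstar_gt0 R.
have la0 : 0 < la by rewrite laE mulr_gt0// divr_gt0// exprn_gt0.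
set A := kA g la ka in sym *; set B := kB g la ka in sym *; set C := kC g la ka in sym *.
have [SA SB SC] := kernel_summable g ka la0; rewrite -/A -/B -/C in SA SB SC.
pose k u := (`|A u| + `|B u| + `|C u|) * eps ^+ 2.
pose l u : R := g * rstar R * (2 * eps) * (habs (hexpt u) * hw la u).
pose psi u := hw la u + l u + k u.
have nn (f : I -> R) : abs_summable f -> abs_summable (fun u => `|f u|).
  by case=> a ha; exists a => s us; under eq_bigr do rewrite normr_id; exact: ha.
have Sh : abs_summable (hw la).
  by apply: dominated_summable (om_summable la0) => p; rewrite ger0_norm ?expR_ge0// hw_le_om.
have Sl : abs_summable l.
  apply: abs_summableZ; apply: (@weight_summable R 1 1) => // p.
  rewrite ger0_norm ?habs_ge0// !mul1r.
  by have := expR_ge1Dx (habs (hexpt p) : R); lra.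
have Sk : abs_summable k.
  have -> : k = (fun u => eps ^+ 2 * (`|A u| + `|B u| + `|C u|)) by apply/funext => u; rewrite /k mulrC.
  by apply: abs_summableZ; apply: abs_summableD; [apply: abs_summableD|]; exact: nn.
have hw0 u : 0 <= hw la u by exact: expR_ge0.
have l0 u : 0 <= l u.
  apply: mulr_ge0; last by apply: mulr_ge0 => //; exact: habs_ge0.
  by apply: mulr_ge0; apply: mulr_ge0 => //; exact: ltW.
have k0 u : 0 <= k u by apply: mulr_ge0 (sqr_ge0 _); apply: addr_ge0 => //; exact: addr_ge0.
have Sp : abs_summable psi by apply: abs_summableD => //; exact: abs_summableD.
have p0 u : 0 <= psi u by have := hw0 u; have := l0 u; have := k0 u; rewrite /psi; clear; lra.
exists (fun u => 5 * psi u); split; [exact: abs_summableZ|by move=> u; exact: mulr_ge0|].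
move=> F dl uF de.
have dE : \sum_(p <- F) defect (fun u => 5 * psi u) F p = 5 * \sum_(p <- F) defect psi F p.
  rewrite mulr_sumr; apply: eq_bigr => p _; rewrite /defect hsumZ// mulrBr; congr (_ - _).
  by rewrite mulr_sumr.
rewrite dE.
have se d : sqn d <= eps ^+ 2 -> Num.sqrt (sqn d) <= eps.
  by move=> h; rewrite -(ger0_norm e0) -sqrtr_sqr ler_wsqrtr.
have sq0 d : 0 <= sqn d by rewrite addr_ge0 ?sqr_ge0.
have hh u : `|hw la u| <= psi u.
  rewrite ger0_norm// /psi; have := l0 u; have := k0 u; clear; lra.
have hl p u : `|lin g la (dl p) u| <= psi u.
  apply: (@le_trans _ _ (l u)); last by rewrite /psi; have := hw0 u; have := k0 u; clear; lra.
  rewrite /lin !normrM (ger0_norm (hw0 u)) (gtr0_norm g0) (gtr0_norm r0) /l.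
  rewrite -!mulrA; do 2 (apply: ler_wpM2l; first exact: ltW).
  have h1 := dirv_le (dl p) (hexpt u).
  have h2 := ler_wpM2l (mulr_ge0 (ler0n R 2) (@habs_ge0 R (hexpt u))) (se _ (de p)).
  have h3 := ler_wpM2r (hw0 u) (le_trans h1 h2).
  by apply: le_trans h3 _; rewrite le_eqVlt; apply/orP; left; apply/eqP; ring.
have hk p u : `|bform (A u) (B u) (C u) (dl p) (dl p)| <= psi u.
  apply: (@le_trans _ _ (k u)); last by rewrite /psi; have := hw0 u; have := l0 u; clear; lra.
  apply: le_trans (bform_le _ _ _ _) _; apply: ler_wpM2l; last exact: de.
  by apply: addr_ge0 => //; exact: addr_ge0.
have D0 p := defect_le p uF Sp hh.
have DL p := defect_le p uF Sp (hl p).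
have DK p := defect_le p uF Sp (hk p).
have step1 : \sum_(p <- F) \sum_(q <- F) (hw la (subI p q) - lin g la (vsub (dl p) (dl q)) (subI p q) +
    bform (A (subI p q)) (B (subI p q)) (C (subI p q)) (vsub (dl p) (dl q)) (vsub (dl p) (dl q))) <=
    \sum_(p <- F) \sum_(q <- F) pairphi g la (subI p q) (vsub (dl p) (dl q)).
  apply: ler_sum => p _; apply: ler_sum => q _.
  apply: (@pair_taylor R g la ka eps _ _ laE (ltW g0) e0 e1 kaE).
  have := de p; have := de q; rewrite /sqn /vsub /=.
  have := sqr_ge0 ((dl p).1 + (dl q).1); have := sqr_ge0 ((dl p).2 + (dl q).2).
  by rewrite exprMn; clear; lra.
apply: le_trans step1.
have E0 : \sum_(p <- F) \sum_(q <- F) hw la (subI p q) =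
   (size F)%:R * hsum (hw la) - \sum_(p <- F) defect (hw la) F p by rewrite defect_sum; ring.
have EL : \sum_(p <- F) \sum_(q <- F) lin g la (vsub (dl p) (dl q)) (subI p q) =
   - (2 * \sum_(p <- F) defect (lin g la (dl p)) F p).
  have -> : \sum_(p <- F) defect (lin g la (dl p)) F p =
      - \sum_(p <- F) \sum_(q <- F) lin g la (dl p) (subI p q).
    rewrite -sumrN; apply: eq_bigr => p _.
    by rewrite /defect hsum_lin ?sub0r//; exact: dominated_summable (hl p) Sp.
  rewrite mulrN opprK mulr2n mulrDl mul1r.
  rewrite [X in _ = _ + X]exchange_big -big_split; apply: eq_bigr => p _ /=.
  rewrite -big_split; apply: eq_bigr => q _ /=.
  rewrite (subI_negz p q) /lin hexpt_negz dirv_negz hw_negz.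
  by rewrite /dirv /vsub /=; ring.
have EK : \sum_(p <- F) \sum_(q <- F) bform (A (subI p q)) (B (subI p q)) (C (subI p q))
     (vsub (dl p) (dl q)) (vsub (dl p) (dl q)) =
  2 * (\sum_(p <- F) bform (hsum A) (hsum B) (hsum C) (dl p) (dl p) -
   \sum_(p <- F) defect (fun u => bform (A u) (B u) (C u) (dl p) (dl p)) F p -
   \sum_(p <- F) \sum_(q <- F) bform (A (subI p q)) (B (subI p q)) (C (subI p q)) (dl p) (dl q)).
  have -> : \sum_(p <- F) bform (hsum A) (hsum B) (hsum C) (dl p) (dl p) -
     \sum_(p <- F) defect (fun u => bform (A u) (B u) (C u) (dl p) (dl p)) F p =
     \sum_(p <- F) \sum_(q <- F) bform (A (subI p q)) (B (subI p q)) (C (subI p q)) (dl p) (dl p).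
    by rewrite -sumrB; apply: eq_bigr => p _; rewrite /defect hsum_bform// subKr.
  rewrite mulrBr !(mulr2n 1) !mulrDl !mul1r.
  rewrite [X in _ = _ + X - _]exchange_big -!big_split -sumrB; apply: eq_bigr => p _ /=.
  rewrite -!big_split -sumrB; apply: eq_bigr => q _ /=.
  have [eA eB eC] := kABC_negz g la ka (subI p q).
  rewrite (subI_negz p q) /A /B /C eA eB eC /bform /vsub /=; ring.
have TP := @toeplitz_le R A B C F dl SA SB SC _ _ _ sym uF.
have {}TP : \sum_(p <- F) \sum_(q <- F) bform (A (subI p q)) (B (subI p q)) (C (subI p q)) (dl p) (dl q) <=
  \sum_(p <- F) bform (hsum A) (hsum B) (hsum C) (dl p) (dl p).
  by apply: TP => p q; rewrite (subI_negz q p); have [eA eB eC] := kABC_negz g la ka (subI q p); rewrite /A /B /C ?eA ?eB ?eC.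
have -> : \sum_(p <- F) \sum_(q <- F) (hw la (subI p q) - lin g la (vsub (dl p) (dl q)) (subI p q) +
    bform (A (subI p q)) (B (subI p q)) (C (subI p q)) (vsub (dl p) (dl q)) (vsub (dl p) (dl q))) =
  \sum_(p <- F) \sum_(q <- F) hw la (subI p q) -
  \sum_(p <- F) \sum_(q <- F) lin g la (vsub (dl p) (dl q)) (subI p q) +
  \sum_(p <- F) \sum_(q <- F) bform (A (subI p q)) (B (subI p q)) (C (subI p q))
     (vsub (dl p) (dl q)) (vsub (dl p) (dl q)).
  rewrite -sumrB -big_split; apply: eq_bigr => p _ /=.
  by rewrite -sumrB -big_split.
rewrite E0 EL EK.
have S0 : \sum_(p <- F) defect (hw la) F p <= \sum_(p <- F) defect psi F p.
  by apply: ler_sum => p _; apply: le_trans (D0 p); exact: ler_norm.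
have SL : - \sum_(p <- F) defect psi F p <= \sum_(p <- F) defect (lin g la (dl p)) F p.
  by rewrite -sumrN; apply: ler_sum => p _; have := DL p; rewrite ler_norml => /andP[].
have SK : \sum_(p <- F) defect (fun u => bform (A u) (B u) (C u) (dl p) (dl p)) F p <= \sum_(p <- F) defect psi F p.
  by apply: ler_sum => p _; apply: le_trans (DK p); exact: ler_norm.
move: TP S0 SL SK; clear; lra.
Qed.

End EnergyLower.

(** * Boundary effects in large disks *)
Section Counting.
Context {R : realType}.
Notation I := (int * int)%type.
Implicit Types (p q : I) (d e : R * R).

Definition nrm d : R := Num.sqrt (sqn d).
Definition vadd d e : R * R := (d.1 + e.1, d.2 + e.2).
Definition pos p : R * R := (rstar R / 2 * (hexpt p).1%:~R, rstar R / 2 * (s3 * (hexpt p).2%:~R)).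
Definition rad p : R := nrm (pos p).

Lemma sqn_ge0 d : 0 <= sqn d. Proof. by rewrite addr_ge0 ?sqr_ge0. Qed.
Lemma nrm_ge0 d : 0 <= nrm d. Proof. exact: sqrtr_ge0. Qed.
Lemma nrm_sqr d : nrm d ^+ 2 = sqn d. Proof. by rewrite sqr_sqrtr ?sqn_ge0. Qed.

Lemma nrm_triangle d e : nrm (vadd d e) <= nrm d + nrm e.
Proof.
have d0 := nrm_ge0 d; have e0 := nrm_ge0 e.
have s0 : 0 <= nrm d + nrm e by exact: addr_ge0.
rewrite -(ler_pXn2r (isT : (0 < 2)%N)) ?nnegrE ?nrm_ge0// sqrrD !nrm_sqr.
have C : d.1 * e.1 + d.2 * e.2 <= nrm d * nrm e.
  have [h|h] := leP (d.1 * e.1 + d.2 * e.2) 0; first by apply: le_trans h (mulr_ge0 _ _).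
  rewrite -(@ler_pXn2r R 2 isT) ?nnegrE ?mulr_ge0//; last exact: ltW.
  rewrite [X in _ <= X]exprMn !nrm_sqr /sqn; have := sqr_ge0 (d.1 * e.2 - d.2 * e.1); clear; lra.
move: C; rewrite /sqn /vadd /=; move: (nrm d) (nrm e) => x y; clear; lra.
Qed.

Lemma rstar_ge1 : 1 <= rstar R.
Proof.
have p0 := ltW (@rstar_gt0 R); have q0 := ltW (@s3_gt0 R).
rewrite -(@ler_pXn2r R 2 isT) ?nnegrE// rstar_sqr expr1n ler_pdivlMr ?s3_gt0// mul1r.
by rewrite -(@ler_pXn2r R 2 isT) ?nnegrE// s3_sqr; clear; lra.
Qed.

Lemma pos_sub p q : pos (subI p q) = vsub (pos p) (pos q).
Proof.
by rewrite /pos /vsub /subI /hexpt /=; congr pair; rewrite !(intrD, intrM, mulrNz); ring.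
Qed.

Lemma rad_sqr p : rad p ^+ 2 = (rstar R / 2) ^+ 2 * ((hexpt p).1%:~R ^+ 2 + 3 * (hexpt p).2%:~R ^+ 2).
Proof. by rewrite nrm_sqr /sqn /pos /= !exprMn s3_sqr; ring. Qed.

Lemma rad_ge0 p : 0 <= rad p. Proof. exact: nrm_ge0. Qed.

Definition irange (k : nat) : seq int := [seq (i%:Z - k%:Z)%R | i <- iota 0 (2 * k).+1].

Lemma irangeP (k : nat) (m : int) : (`|m| <= k)%N -> m \in irange k.
Proof.
move=> mk; apply/mapP; exists `|(m + k%:Z)%R|%N; last by lia.
by rewrite mem_iota; lia.
Qed.

Lemma irange_uniq k : uniq (irange k).
Proof. by rewrite map_inj_uniq ?iota_uniq// => i j; lia. Qed.

Definition box (k : nat) : seq I := [seq (m, n) | m <- irange k, n <- irange k].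

Lemma rad_index p : (`|p.1|%N%:R <= 2 * rad p) /\ (`|p.2|%N%:R <= 2 * rad p).
Proof.
have r1 := rstar_ge1; have r0 := rad_ge0 p.
have h : (hexpt p).1%:~R ^+ 2 + 3 * (hexpt p).2%:~R ^+ 2 <= (2 * rad p) ^+ 2 :> R.
  rewrite exprMn rad_sqr.
  have k : 1 <= rstar R ^+ 2 by rewrite exprn_ege1.
  set X : R := _ + _; have X0 : 0 <= X by rewrite addr_ge0 ?sqr_ge0// mulr_ge0 ?sqr_ge0.
  by have := ler_wpM2r X0 k; lra.
have q1 := sqr_ge0 ((hexpt p).1%:~R : R); have q2 := sqr_ge0 ((hexpt p).2%:~R : R).
have rr0 : 0 <= 2 * rad p by rewrite mulr_ge0.
have ha : `|(hexpt p).1%:~R| <= 2 * rad p :> R.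
  by rewrite -(@ler_pXn2r R 2 isT) ?nnegrE// real_normK ?num_real//; lra.
have hb : `|(hexpt p).2%:~R| <= 2 * rad p :> R.
  by rewrite -(@ler_pXn2r R 2 isT) ?nnegrE// real_normK ?num_real//; lra.
rewrite !natr_absz !intr_norm; split; last exact: hb.
have -> : p.1%:~R = ((hexpt p).1%:~R - (hexpt p).2%:~R) / 2 :> R.
  by rewrite /hexpt /= intrD intrM; field.
rewrite normrM normfV (@ger0_norm _ 2)//.
by have := ler_normB ((hexpt p).1%:~R : R) (hexpt p).2%:~R; lra.
Qed.

Lemma box_rad (rho : R) p : rad p < rho -> p \in box (Num.bound (2 * rho)).
Proof.
move=> h; have [h1 h2] := rad_index p.
have r0 : 0 <= 2 * rho by have := rad_ge0 p; lra.
have b := archi_boundP r0.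
have le (n : nat) : n%:R <= 2 * rad p -> (n <= Num.bound (2 * rho))%N.
  by move=> hn; rewrite -(ler_nat R); lra.
by rewrite [p]surjective_pairing; apply: allpairs_f; apply: irangeP; exact: le.
Qed.

Lemma box_uniq k : uniq (box k).
Proof.
apply: allpairs_uniq; [exact: irange_uniq|exact: irange_uniq|].
by move=> [a b] [a' b'] _ _ /= [-> ->].
Qed.

Definition ball_seq (rho : R) : seq I := [seq p <- box (Num.bound (2 * rho)) | rad p < rho].

Lemma mem_ball_seq rho p : (p \in ball_seq rho) = (rad p < rho).
Proof. by rewrite mem_filter; case: (boolP (rad p < rho)) => //= /box_rad. Qed.

Lemma ball_seq_uniq rho : uniq (ball_seq rho).
Proof. by rewrite filter_uniq ?box_uniq. Qed.

Definition annulus (rho c : R) : seq I := [seq p <- ball_seq (rho + c) | rho - c <= rad p].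

(** The step [hexpt (m, n) = (e1, e2)] with [e1, e2] equal to 1 or -1 is one
  of four lattice vectors of length [r_star], one in each quadrant. *)
Definition walk (m n t : int) p : I := (p.1 + t * m, p.2 + t * n).

Definition slope (e1 e2 : int) p : R :=
  (rstar R / 2) ^+ 2 * (e1%:~R * (hexpt p).1%:~R + 3 * (e2%:~R * (hexpt p).2%:~R)).

Lemma rad_walk (m e1 e2 t : int) p : e1 ^+ 2 = 1 -> e2 ^+ 2 = 1 -> 2 * m + e2 = e1 ->
  rad (walk m e2 t p) ^+ 2 = rad p ^+ 2 + 2 * t%:~R * slope e1 e2 p + (t%:~R * rstar R) ^+ 2.
Proof.
move=> s1 s2 mE; rewrite !rad_sqr /slope /walk /hexpt /=.
have s1R : e1%:~R ^+ 2 = 1 :> R by rewrite -rmorphXn /= s1.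
have s2R : e2%:~R ^+ 2 = 1 :> R by rewrite -rmorphXn /= s2.
have -> : (2 * (p.1 + t * m) + (p.2 + t * e2) = (2 * p.1 + p.2) + t * e1)%R by rewrite -mE; ring.
move: (2 * p.1 + p.2)%R => a; rewrite !(intrD, intrM).
set x : R := a%:~R; set y : R := p.2%:~R; set T : R := t%:~R; set E1 : R := e1%:~R; set E2 : R := e2%:~R.
have -> : (x + T * E1) ^+ 2 + 3 * (y + T * E2) ^+ 2 = x ^+ 2 + 3 * y ^+ 2 +
   2 * T * (E1 * x + 3 * (E2 * y)) + T ^+ 2 * (E1 ^+ 2 + 3 * E2 ^+ 2) by ring.
by rewrite s1R s2R; field.
Qed.

(** The lattice vector in the quadrant of a point makes an angle of at most 60
  degrees with it, as [|a| + 3 |b| >= sqrt (a ^ 2 + 3 b ^ 2)]. *)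
Lemma slope_ge (e1 e2 : int) p : `|e1| = 1 -> `|e2| = 1 ->
  (0 <= e1 * (hexpt p).1) && (0 <= e2 * (hexpt p).2) -> rstar R / 2 * rad p <= slope e1 e2 p.
Proof.
move=> E1 E2 /andP[a0 b0].
have nE (e x : int) : `|e| = 1 -> 0 <= e * x -> e%:~R * x%:~R = `|x%:~R| :> R.
  move=> e1' ex; rewrite -intrM -intr_norm; congr (_%:~R).
  by rewrite -(ger0_norm ex) normrM e1' mul1r.
rewrite /slope !nE//.
set a : R := (hexpt p).1%:~R; set b : R := (hexpt p).2%:~R.
have r0 := @rstar_gt0 R; have r20 : 0 <= rstar R / 2 by rewrite divr_ge0// ltW.
rewrite expr2 -[X in _ <= X]mulrA; apply: ler_wpM2l => //.
have x0 := normr_ge0 a; have y0 := normr_ge0 b.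
have s0 : 0 <= `|a| + 3 * `|b| by move: x0 y0; clear; lra.
rewrite -(@ler_pXn2r R 2 isT) ?nnegrE ?rad_ge0//; last exact: mulr_ge0.
rewrite rad_sqr [X in _ <= X]exprMn ler_wpM2l ?sqr_ge0// -/a -/b.
rewrite -(@real_normK _ a) ?num_real// -(@real_normK _ b) ?num_real//.
have := mulr_ge0 x0 y0; have := sqr_ge0 `|b|; clear; lra.
Qed.

Definition sector (e1 e2 : int) (s : seq I) : seq I :=
  [seq p <- s | (0 <= e1 * (hexpt p).1) && (0 <= e2 * (hexpt p).2)].

(** Points of a thin annulus in one sector have many disjoint translates
  towards the origin, so they are a small proportion of the disk. *)
Lemma sector_count (rho c : R) (M L : nat) (e1 e2 : int) : 0 <= c ->
  `|e1| = 1 -> `|e2| = 1 -> 4 * c < L%:R -> c + 2 * (M%:R * L%:R) <= rho ->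
  (M.+1 * size (sector e1 e2 (annulus rho c)) <=
   size (ball_seq (rho + c)))%N.
Proof.
move=> c0 E1 E2 Lc rhoE.
set A := sector _ _ _.
have s1 : e1 ^+ 2 = 1 by lia. have s2 : e2 ^+ 2 = 1 by lia.
have [m mE] : exists m : int, 2 * m + e2 = e1 by exists (divz (e1 - e2) 2); lia.
have r1 := rstar_ge1; have r2 := @rstar_le2 R; have r0 := @rstar_gt0 R.
have hA p : p \in A -> [/\ rad p < rho + c, rho - c <= rad p & rstar R / 2 * rad p <= slope e1 e2 p].
  by rewrite mem_filter => /andP[/(slope_ge E1 E2) h]; rewrite mem_filter mem_ball_seq => /andP[].
pose sh p (k : nat) : I := walk m e2 (- (k * L)%:Z) p.
have key p q (k : nat) : p \in A -> q \in A -> (0 < k)%N -> p <> walk m e2 (k * L)%:Z q.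
  move=> pA qA k0 pE; have [p1 _ _] := hA _ pA; have [_ q1 qs] := hA _ qA.
  have := rad_walk (k * L)%:Z q s1 s2 mE; rewrite -pE.
  set T : R := (k * L)%:Z%:~R => e.
  have TL : L%:R <= T by rewrite /T -pmulrn ler_nat leq_pmull.
  have L0 : 0 <= L%:R :> R by [].
  have T0 : 0 <= T by apply: le_trans TL.
  have rq := rad_ge0 q; have rp := rad_ge0 p.
  have h : (rad q + T * rstar R / 2) ^+ 2 <= rad p ^+ 2.
    rewrite e; have := ler_wpM2l T0 qs; have := sqr_ge0 (T * rstar R); clear; lra.
  have Tr : T <= T * rstar R by rewrite ler_peMr.
  have {}h : rad q + T * rstar R / 2 <= rad p.
    by rewrite -(@ler_pXn2r R 2 isT) ?nnegrE//; move: rq T0 Tr; clear; lra.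
  by move: h Tr TL Lc p1 q1; clear; lra.
have shB p q (k l : nat) : (l <= k)%N -> sh p k = sh q l -> p = walk m e2 ((k - l) * L)%:Z q.
  rewrite /sh /walk => lk; case: p q => [x y] [x' y'] /= [h1 h2].
  by congr pair; nia.
have us : uniq [seq sh p k | p <- A, k <- iota 0 M.+1].
  apply: allpairs_uniq; [by rewrite !filter_uniq ?box_uniq|exact: iota_uniq|].
  move=> x y /allpairsP[[p k] [pA _ ->]] /allpairsP[[q l] [qA _ ->]] /= E.
  rewrite /= in pA qA.
  have [kl|lk|kl] := ltngtP k l.
  - by case: (key q p (l - k)%N qA pA); rewrite ?subn_gt0//; apply: shB (ltnW kl) (esym E).
  - by case: (key p q (k - l)%N pA qA); rewrite ?subn_gt0//; apply: shB (ltnW lk) E.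
  by rewrite -kl in E *; rewrite (shB _ _ _ _ (leqnn k) E) subnn mul0n /walk !mul0r !addr0 -surjective_pairing.
have := uniq_leq_size us (s2 := ball_seq (rho + c)); rewrite size_allpairs size_iota mulnC; apply.
move=> _ /allpairsP[[p k] [pA + ->]]; rewrite mem_iota add0n ltnS => /andP[_ kM].
rewrite [p]/= in pA kM; rewrite [(p, k).1]/= [(p, k).2]/= in pA kM *.
rewrite mem_ball_seq; have [p1 p2 ps] := hA _ pA.
have := rad_walk (- (k * L)%:Z) p s1 s2 mE; rewrite -/(sh p k) mulrNz.
set T : R := (k * L)%:Z%:~R => e.
have T0 : 0 <= T by rewrite /T -pmulrn.
have TM : T <= M%:R * L%:R by rewrite /T -pmulrn -natrM ler_nat leq_mul2r kM orbT.
have Tr : T * rstar R <= rad p.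
  have := ler_wpM2l T0 r2; move: TM p2 rhoE; clear; lra.
apply: le_lt_trans p1.
rewrite -(@ler_pXn2r R 2 isT) ?nnegrE ?rad_ge0// e.
have Tr0 : 0 <= T * rstar R by rewrite mulr_ge0// ltW.
have := ler_wpM2l T0 ps; have := ler_wpM2l Tr0 Tr; clear; lra.
Qed.

Lemma annulus_uniq rho c : uniq (annulus rho c).
Proof. by rewrite filter_uniq ?ball_seq_uniq. Qed.

Lemma annulus_count (rho c : R) (M L : nat) : 0 <= c ->
  4 * c < L%:R -> c + 2 * (M%:R * L%:R) <= rho ->
  (M.+1 * size (annulus rho c) <= 4 * size (ball_seq (rho + c)))%N.
Proof.
move=> c0 Lc rhoE.
pose S (e1 e2 : int) := sector e1 e2 (annulus rho c).
have H (e1 e2 : int) (h1 : `|e1| = 1) (h2 : `|e2| = 1) := sector_count c0 h1 h2 Lc rhoE.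
have cover : (size (annulus rho c) <= size (S 1%R 1%R ++ S 1%R (-1)%R ++ S (-1)%R 1%R ++ S (-1)%R (-1)%R))%N.
  apply: uniq_leq_size; first exact: annulus_uniq.
  move=> p pA; have ms (e1 e2 : int) : (p \in S e1 e2) = (0 <= e1 * (hexpt p).1) && (0 <= e2 * (hexpt p).2).
    by rewrite mem_filter pA andbT.
  rewrite !mem_cat !ms; clear pA ms.
  move: (hexpt p).1 (hexpt p).2 => x y; clear; lia.
have := leq_mul (leqnn M.+1) cover; rewrite !size_cat !mulnDr => /leq_trans; apply.
have := H 1 1 erefl erefl; have := H 1 (-1) erefl erefl.
have := H (-1) 1 erefl erefl; have := H (-1) (-1) erefl erefl.
rewrite -/(S 1 1) -/(S 1 (-1)) -/(S (-1) 1) -/(S (-1) (-1)); clear; lia.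
Qed.

End Counting.

Section WindowDefect.
Context {R : realType}.
Notation I := (int * int)%type.
Implicit Types (p q : I) (d e : R * R).

Lemma subI_K p q : subI p (subI p q) = q.
Proof. by case: p q => a b [a' b']; rewrite /subI /=; congr pair; lia. Qed.

Lemma nrm_bounds d e (eps : R) : 0 <= eps -> sqn e <= eps ^+ 2 ->
  nrm (vadd d e) <= nrm d + eps /\ nrm d <= nrm (vadd d e) + eps.
Proof.
move=> e0 he.
have ne : nrm e <= eps by rewrite -(ger0_norm e0) -sqrtr_sqr ler_wsqrtr.
have h1 := nrm_triangle d e.
have h2 := nrm_triangle (vadd d e) (- e.1, - e.2).
have e1 : nrm (- e.1, - e.2) = nrm e by rewrite /nrm /sqn /= !sqrrN.
have e2 : vadd (vadd d e) (- e.1, - e.2) = d by case: d {h1 h2} => x y; rewrite /vadd /= !addrK.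
by rewrite e1 e2 in h2; lra.
Qed.

Lemma nrm_vsub d e : nrm d <= nrm (vsub d e) + nrm e /\ nrm (vsub d e) <= nrm d + nrm e.
Proof.
have h1 := nrm_triangle (vsub d e) e; have h2 := nrm_triangle d (- e.1, - e.2).
have e1 : nrm (- e.1, - e.2) = nrm e by rewrite /nrm /sqn /= !sqrrN.
have e2 : vadd (vsub d e) e = d by case: d {h1 h2} => x y; rewrite /vadd /vsub /= !subrK.
by rewrite e1 in h2; rewrite e2 in h1.
Qed.

(** Up to [eta / 2] only finitely many differences [u] matter. A point of the
  window whose translate by [u] leaves it lies in an annulus of fixed width,
  and these points are a small proportion of a large disk. *)
Lemma window_defect (psi : I -> R) (eps eta : R) : abs_summable psi -> (forall u, 0 <= psi u) ->
  0 <= eps -> 0 < eta -> exists r0 : R, forall (r : R) (F : seq I) (dl : I -> R * R),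
  r0 <= r -> uniq F -> (forall p, sqn (dl p) <= eps ^+ 2) ->
  (forall p, (p \in F) = (nrm (vadd (pos p) (dl p)) < r)) ->
  \sum_(p <- F) defect psi F p <= eta * (size F)%:R.
Proof.
move=> Sp p0 eps0 eta0; have eta2 : 0 < eta / 2 by rewrite divr_gt0.
have [s0 hs0] := summable_tail Sp eta2.
set s := undup s0; have us : uniq s := undup_uniq _.
have tl : hsum psi <= \sum_(u <- s) psi u + eta / 2.
  have := @tail_close R _ psi s (eta / 2) Sp us; rewrite ler_norml.
  have H s' : uniq s' -> (forall u, u \in s' -> u \notin s) -> \sum_(u <- s') `|psi u| <= eta / 2.
    by move=> us' h; apply: hs0 => // u /h; rewrite mem_undup.
  by move=> /(_ H) /andP[_]; lra.
pose Ps := \sum_(u <- s) psi u.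
have Ps0 : 0 <= Ps by apply: sumr_ge0.
pose K := Num.bound (8 * Ps / eta).
have hK : 8 * Ps / eta < K%:R by apply: archi_boundP; rewrite divr_ge0 ?mulr_ge0// ltW.
pose M := (K + 4)%N.
pose c := eps + \sum_(u <- s) rad u : R.
have cu u : u \in s -> eps + rad u <= c.
  move=> us'; rewrite lerD2l (bigD1_seq u)//= lerDl sumr_ge0// => i _; exact: rad_ge0.
have c0 : 0 <= c by rewrite addr_ge0// sumr_ge0// => i _; exact: rad_ge0.
pose L := Num.bound (4 * c).
have hL : 4 * c < L%:R by apply: archi_boundP; rewrite mulr_ge0.
exists (c + 2 * (M%:R * L%:R)) => r F dl hr uF de mF.
have ec : eps <= c by rewrite lerDl sumr_ge0// => i _; exact: rad_ge0.
set A := annulus r c.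
have AC := annulus_count c0 hL hr.
have AN : (size (ball_seq (r + c)) <= size F + size A)%N.
  rewrite -size_cat; apply: uniq_leq_size; first exact: ball_seq_uniq.
  move=> p pb; rewrite mem_cat mF mem_filter pb andbT.
  have [h1 h2] := nrm_bounds (pos p) eps0 (de p).
  have [h|h] := leP (r - c) (rad p); first by rewrite orbT.
  by rewrite orbF; move: h h1 ec; rewrite /rad; clear; lra.
have AF : ((K + 1) * size A <= 4 * size F)%N.
  move: AC AN; rewrite -/A /M; move: (size A) (size F) (size (ball_seq _)) => a f b; clear; lia.
have cnt u : u \in s -> \sum_(p <- F) (subI p u \notin F)%:R <= (size A)%:R :> R.
  move=> us'; pose G := [seq p <- F | subI p u \notin F].
  have -> : \sum_(p <- F) (subI p u \notin F)%:R = (size G)%:R :> R.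
    rewrite size_filter -sum1_count natr_sum [RHS]big_mkcond; apply: eq_bigr => p _.
    by case: (_ \notin _).
  rewrite ler_nat; apply: uniq_leq_size; first by rewrite filter_uniq.
  move=> p; rewrite mem_filter !mF -leNgt => /andP[h1 h2].
  have [_ k1] := nrm_bounds (pos p) eps0 (de p).
  have [k2 _] := nrm_bounds (pos (subI p u)) eps0 (de (subI p u)).
  have [_ k3] := nrm_vsub (pos p) (pos u); rewrite -pos_sub in k3.
  have := cu u us'; rewrite mem_filter mem_ball_seq /rad => k4.
  by apply/andP; split; move: h1 h2 k1 k2 k3 k4 ec; clear; lra.
have row p : defect psi F p <= \sum_(u <- s) psi u * (subI p u \notin F)%:R + eta / 2.
  have h : \sum_(u <- s | subI p u \in F) psi u <= \sum_(q <- F) psi (subI p q).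
    have -> : \sum_(q <- F) psi (subI p q) = \sum_(u <- map (subI p) F) psi u by rewrite big_map.
    rewrite -[leLHS]big_filter; apply: ler_sum_subseq => //.
    - by rewrite filter_uniq.
    - by rewrite map_inj_uniq//; exact: subI_injr.
    move=> u; rewrite mem_filter => /andP[uF' _]; apply/mapP; exists (subI p u) => //.
    by rewrite subI_K.
  have e : \sum_(u <- s) psi u = \sum_(u <- s | subI p u \in F) psi u + \sum_(u <- s) psi u * (subI p u \notin F)%:R.
    rewrite (bigID (fun u => subI p u \in F)) /=; congr (_ + _).
    by rewrite big_mkcond; apply: eq_bigr => u _; case: (_ \in F); rewrite /= ?mulr0 ?mulr1.
  by rewrite /defect; move: tl h; rewrite e; clear; lra.
apply: (@le_trans _ _ (\sum_(p <- F) (\sum_(u <- s) psi u * (subI p u \notin F)%:R + eta / 2))).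
  by apply: ler_sum.
rewrite big_split /= exchange_big /= big_const_seq count_predT iter_addr_0 -mulr_natl.
have AR : (size A)%:R * (K%:R + 1) <= 4 * (size F)%:R :> R.
  by rewrite mulrC natr1 -!natrM ler_nat -addn1.
have S1 : \sum_(u <- s) \sum_(p <- F) psi u * (subI p u \notin F)%:R <= Ps * (size A)%:R.
  rewrite mulr_suml big_seq [leRHS]big_seq; apply: ler_sum => u us'; rewrite -mulr_sumr.
  by apply: ler_wpM2l => //; exact: cnt.
have PK : 8 * Ps <= eta * K%:R.
  by move: hK; rewrite ltr_pdivrMr// (mulrC _ eta) => /ltW.
have A0 : 0 <= (size A)%:R :> R by [].
have h1 := ler_wpM2r A0 PK.
have h2 := ler_wpM2l (ltW eta0) AR.
have h3 := mulr_ge0 (ltW eta0) A0.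
by move: S1 h1 h2 h3; clear; lra.
Qed.

End WindowDefect.

(** * From finite windows to the energy per point *)
Section Energy.
Context {R : realType}.
Notation I := (int * int)%type.
Implicit Types (p q : I) (d : R * R).

Definition vec d : 'rV[R]_2 := vec2 d.1 d.2.
Definition coord (x : 'rV[R]_2) : R * R := (x 0 0, x 0 1).

Lemma coordK : cancel coord vec.
Proof.
move=> x; apply/rowP => j; rewrite mxE /=; case: ifP => [/eqP -> //|j0].
by congr (x 0 _); apply/val_inj; case: j j0 => -[|[|]].
Qed.

Lemma enorm_vec d : enorm (vec d) = nrm d.
Proof. by rewrite /enorm big_ord_recr big_ord1 /= !mxE. Qed.

Lemma enorm_coord (x : 'rV[R]_2) : enorm x = nrm (coord x).
Proof. by rewrite -enorm_vec coordK. Qed.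

Lemma vecB d e : vec d - vec e = vec (vsub d e).
Proof. by apply/rowP => j; rewrite !mxE /=; case: ifP. Qed.

Lemma vecD d e : vec d + vec e = vec (vadd d e).
Proof. by apply/rowP => j; rewrite !mxE /=; case: ifP. Qed.

Lemma lattice_vec (m n : int) : hex_sigma R *~ m + hex_tau R *~ n = vec (pos (m, n)).
Proof.
apply/rowP => j; rewrite -[hex_sigma R *~ m]scaler_int -[hex_tau R *~ n]scaler_int !mxE /pos /hexpt /=.
by case: ifP => _; rewrite ?intrD ?intrM -/(@s3 R); field.
Qed.

Lemma A2E : A2 R = [set vec (pos p) | p in [set: I]].
Proof.
apply/seteqP; split=> x /=.
  by move=> [m [n ->]]; exists (m, n) => //; rewrite lattice_vec.
by move=> [[m n] _ <-]; exists m, n; rewrite lattice_vec.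
Qed.

(** Adding the diagonal, [f 0] for each point, completes the sum over distinct
  points to a sum over all pairs. *)
Lemma pair_sum_seq (f : R -> R) (s : seq 'rV[R]_2) : uniq s ->
  \sum_(x \in [set` s]) \sum_(y \in [set` s] `\ x) f (enorm (x - y)) =
  \sum_(x <- s) \sum_(y <- s) f (enorm (x - y)) - (size s)%:R * f (enorm (0 : 'rV[R]_2)).
Proof.
move=> us; rewrite -fsbig_seq//.
have -> : (size s)%:R * f (enorm (0 : 'rV[R]_2)) = \sum_(x <- s) f (enorm (0 : 'rV[R]_2)).
  by rewrite big_const_seq count_predT iter_addr_0 mulr_natl.
rewrite -sumrB; apply: eq_big_seq => x xs.
have h := fsbigD1 x [set` s] (fun y => f (enorm (x - y))) (finite_seq s) xs.
have h2 : \sum_(y <- s) f (enorm (x - y)) = \sum_(y \in [set` s]) f (enorm (x - y)) by exact: fsbig_seq.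
by rewrite h2 h subrr addrAC subrr add0r.
Qed.

Lemma card_fset_seq (s : seq 'rV[R]_2) : uniq s -> #|` fset_set [set` s]| = size s.
Proof.
move=> us; apply/perm_size/uniq_perm => // x.
rewrite in_fset_set; last by apply/finite_seqP; exists s.
by apply/idP/idP => [/set_mem|h]; rewrite ?inE.
Qed.

Lemma subI_eq0 p q : subI p q = (0, 0) -> p = q.
Proof. by case: p q => a b [a' b'] [h1 h2]; congr pair; lia. Qed.

(** Distinct lattice points are at distance at least 1, so displacements of
  size at most [1 / 4] keep them apart, and sums over the perturbed set are
  sums over lattice indices. *)
Section Configuration.
Variables (eps : R) (dl : I -> R * R).
Hypotheses (e0 : 0 <= eps) (e1 : eps <= 1 / 4) (de : forall p, sqn (dl p) <= eps ^+ 2).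

Definition site p : 'rV[R]_2 := vec (vadd (pos p) (dl p)).
Definition window (r : R) : seq I := [seq p <- ball_seq (r + eps) | nrm (vadd (pos p) (dl p)) < r].

Lemma mem_window r p : (p \in window r) = (nrm (vadd (pos p) (dl p)) < r).
Proof.
rewrite mem_filter mem_ball_seq; case: (ltP (nrm _) r) => //= h.
by have [_] := nrm_bounds (pos p) e0 (de p); rewrite /rad; move: h; lra.
Qed.

Lemma window_uniq r : uniq (window r).
Proof. by rewrite filter_uniq ?ball_seq_uniq. Qed.

Lemma site_sub p q : enorm (site p - site q) = nrm (vadd (pos (subI p q)) (vsub (dl p) (dl q))).
Proof.
rewrite /site vecB enorm_vec pos_sub /vsub /vadd /=; congr nrm; congr pair; ring.
Qed.

Lemma rad_ge1 p : p != (0, 0) -> 1 <= rad p :> R.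
Proof.
move=> p0; rewrite -(@ler_pXn2r R 2 isT) ?nnegrE ?rad_ge0// rad_sqr expr1n.
have k : 1 <= rstar R ^+ 2 by rewrite exprn_ege1// rstar_ge1.
have n4 : (4 <= (hexpt p).1 ^+ 2 + 3 * (hexpt p).2 ^+ 2)%R.
  by move: p0; case: p => m n; rewrite xpair_eqE /hexpt /=; nia.
move: n4; rewrite -(ler_int R) [X in _ <= X]intrD [X in _ + X]intrM !rmorphXn /= => n4.
have := ler_pM (ler0n R 1) (ler0n R 4) k n4; lra.
Qed.

Lemma site_inj : injective site.
Proof.
move=> p q E; apply/eqP; apply: contraT => pq.
have h : enorm (site p - site q) = 0 by rewrite E subrr enorm_coord /nrm /sqn /coord /= !mxE expr0n addr0 sqrtr0.
rewrite site_sub in h.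
have s0 : subI p q != (0, 0).
  by apply: contraNN pq => /eqP /subI_eq0 ->.
have d2 : sqn (vsub (dl p) (dl q)) <= (2 * eps) ^+ 2.
  have := de p; have := de q; rewrite /sqn /vsub /=.
  have := sqr_ge0 ((dl p).1 + (dl q).1); have := sqr_ge0 ((dl p).2 + (dl q).2).
  by rewrite exprMn; lra.
have e20 : 0 <= 2 * eps by rewrite mulr_ge0.
have [_] := nrm_bounds (pos (subI p q)) e20 d2; rewrite h.
by have := rad_ge1 s0; rewrite /rad; move: e1; lra.
Qed.

Lemma window_set r : [set site p | p in [set: I]] `&` disk r = [set` map site (window r)].
Proof.
apply/seteqP; split=> x /=.
  move=> [[p _ <-]]; rewrite /disk /= enorm_vec => h.
  by apply/mapP; exists p; rewrite ?mem_window.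
move=> /mapP[p pw ->]; split; first by exists p.
by rewrite /disk /= enorm_vec -mem_window.
Qed.

Variables (alpha g la : R).
Hypotheses (gE : g = pi * alpha) (laE : la = g * (rstar R ^+ 2 / 4)).

Lemma Phi_pair p q : Phi alpha (enorm (site p - site q)) =
  pairphi g la (subI p q) (vsub (dl p) (dl q)).
Proof.
rewrite site_sub /Phi nrm_sqr /pairphi -gE; congr expR; congr (- _).
set u := subI p q; set d := vsub _ _; rewrite /sqn /vadd /pos /= laE /dirv.
set a : R := (hexpt u).1%:~R; set b : R := (hexpt u).2%:~R.
have -> : g * ((rstar R / 2 * a + d.1) ^+ 2 + (rstar R / 2 * (s3 * b) + d.2) ^+ 2) =
  g * (rstar R ^+ 2 / 4) * (a ^+ 2 + s3 ^+ 2 * b ^+ 2) + g * rstar R * (a * d.1 + s3 * b * d.2) +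
  g * (d.1 ^+ 2 + d.2 ^+ 2) by field.
by rewrite s3_sqr.
Qed.

Definition window_energy r : R :=
  (\sum_(p <- window r) \sum_(q <- window r) pairphi g la (subI p q) (vsub (dl p) (dl q)) -
   (size (window r))%:R) / (size (window r))%:R.

Lemma energyE : energy (Phi alpha) [set site p | p in [set: I]] =
  limf_einf (fun r => (window_energy r)%:E) (pinfty_nbhs R).
Proof.
rewrite /energy; congr (limf_einf _ _); apply/funext => r; congr (_%:E).
have us : uniq (map site (window r)) by rewrite map_inj_uniq ?window_uniq//; exact: site_inj.
rewrite window_set pair_sum_seq// card_fset_seq// size_map /window_energy.
have -> : Phi alpha (enorm (0 : 'rV[R]_2)) = 1.
  rewrite enorm_coord /Phi nrm_sqr /sqn /coord /= !mxE expr0n addr0 mulr0 oppr0; exact: expR0.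
rewrite mulr1; congr ((_ - _) / _).
rewrite big_map; apply: eq_bigr => p _; rewrite big_map; apply: eq_bigr => q _.
exact: Phi_pair.
Qed.

End Configuration.

Lemma limf_einf_le (f : R -> R) (c : R) : (forall r, f r <= c) ->
  (limf_einf (fun r => (f r)%:E) (pinfty_nbhs R) <= c%:E)%E.
Proof.
move=> fc; rewrite limf_einfE; apply: ge_ereal_sup => _ [V FV <-].
have [r Vr] : V !=set0 by apply: filter_ex FV.
apply: (@le_trans _ _ (f r)%:E); last by rewrite lee_fin.
by apply: ereal_inf_lbound; exists r.
Qed.

Lemma limf_einf_ge (f : R -> R) (c r0 : R) : (forall r, r0 < r -> c <= f r) ->
  (c%:E <= limf_einf (fun r => (f r)%:E) (pinfty_nbhs R))%E.
Proof.
move=> fc; rewrite limf_einfE.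
apply: (@le_trans _ _ (ereal_inf [set (f r)%:E | r in [set r | r0 < r]])).
  by apply: le_ereal_inf_tmp => _ [r /= h <-]; rewrite lee_fin; exact: fc.
apply: ereal_sup_ubound; exists [set r | r0 < r] => //.
by exists r0; split; rewrite ?num_real.
Qed.

End Energy.

Section Main.
Context {R : realType}.
Notation I := (int * int)%type.
Implicit Types (p q : I) (d : R * R).

Lemma hw_summable (la : R) : 0 < la -> abs_summable (hw la).
Proof.
move=> la0; apply: dominated_summable (om_summable la0) => p.
by rewrite ger0_norm ?expR_ge0// hw_le_om.
Qed.

(** In every window each point sees at most the whole lattice. *)
Lemma energy_lattice_le (alpha g la : R) : g = pi * alpha -> la = g * (rstar R ^+ 2 / 4) -> 0 < la ->
  (energy (Phi alpha) (A2 R) <= (hsum (hw la) - 1)%:E)%E.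
Proof.
move=> gE laE la0; pose dl (q : I) : R * R := (0, 0).
have S := hw_summable la0.
have -> : A2 R = [set site dl q | q in [set: I]].
  rewrite A2E; congr (image _ _); apply/funext => q.
  by rewrite /site /vadd /= !addr0.
have e1 : (0 : R) <= 1 / 4 by lra.
have de q : sqn (dl q) <= 0 ^+ 2 :> R by rewrite /sqn /= expr0n addr0.
rewrite (energyE (lexx 0) e1 de gE laE); apply: limf_einf_le => r.
rewrite /window_energy; set F := window _ _ _.
have uF : uniq F := window_uniq _ _ _.
have h1 : 1 <= hsum (hw la).
  have := @hsum_ge_finite R _ (hw la) [:: (0, 0)] isT S (fun u _ => expR_ge0 _).
  by rewrite big_seq1 /hw /hgauss /hexpt /= !mulr0 !expr0n /= mulr0 addr0 mulr0 oppr0 expR0.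
have row p : \sum_(q <- F) pairphi g la (subI p q) (vsub (dl p) (dl q)) <= hsum (hw la).
  have us : uniq (map (subI p) F) by rewrite map_inj_uniq//; exact: subI_injr.
  have := hsum_ge_finite us S (fun u _ => expR_ge0 _); rewrite big_map.
  apply: le_trans; rewrite le_eqVlt; apply/orP; left; apply/eqP; apply: eq_bigr => q _.
  rewrite /pairphi /dirv /sqn /vsub /= subrr !mulr0 !expr0n /= !addr0 mulr0 mulr0 !addr0.
  by [].
have tot : \sum_(p <- F) \sum_(q <- F) pairphi g la (subI p q) (vsub (dl p) (dl q)) <=
    (size F)%:R * hsum (hw la).
  apply: (@le_trans _ _ (\sum_(p <- F) hsum (hw la))); first by apply: ler_sum.
  by rewrite big_const_seq count_predT iter_addr_0 mulr_natl.
have [->|F0] := posnP (size F); first by rewrite invr0 mulr0 subr_ge0.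
have Fr : 0 < (size F)%:R :> R by rewrite ltr0n.
by rewrite ler_pdivrMr// mulrBl mul1r lerB// mulrC.
Qed.

(** The kernel shift [ka] from [kernel_symbol] serves all the parameters of
  the range, and [eps] has to satisfy [2 eps (1 + g) ^ 3 <= ka] at the largest
  one. *)
Lemma uniform_threshold (a0 a1 : R) : 0 < a0 -> exists2 eps : R, 0 < eps &
  forall alpha, a0 <= alpha <= a1 -> forall p : 'rV[R]_2 -> 'rV[R]_2,
    (pert_norm p <= eps%:E)%E ->
    (energy (Phi alpha) (A2 R) <= energy (Phi alpha) (perturb p))%E.
Proof.
move=> a00; have pi0 := @pi_gt0 R; have r0 := @rstar_gt0 R.
have rr0 : 0 < rstar R ^+ 2 / 4 by rewrite divr_gt0// exprn_gt0.
have pa0 : 0 < pi * a0 by rewrite mulr_gt0.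
have [ka ka0 sym] := @kernel_symbol R _ _ (pi * a1) rr0 pa0.
pose G := (1 + pi * `|a1|) ^+ 3.
have G0 : 0 < G by rewrite exprn_gt0// ltr_pwDl// mulr_ge0// ltW.
pose eps := Num.min (1 / 4) (ka / (2 * G)).
have eps0 : 0 < eps by rewrite lt_min !divr_gt0// mulr_gt0.
have eps4 : eps <= 1 / 4 by rewrite ge_min lexx.
have epsG : 2 * eps * G <= ka.
  have : eps <= ka / (2 * G) by rewrite ge_min lexx orbT.
  have G2 : 0 < 2 * G by exact: mulr_gt0.
  rewrite (ler_pdivlMr _ _ G2); move: (eps) => x; clear; lra.
exists eps => // alpha /andP[al0 al1] p hp.
have alp : 0 < alpha := lt_le_trans a00 al0.
pose g := pi * alpha; have g0 : 0 < g by rewrite mulr_gt0.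
pose la := g * (rstar R ^+ 2 / 4); have la0 : 0 < la by rewrite mulr_gt0.
apply: le_trans (energy_lattice_le (erefl g) (erefl la) la0) _.
have gG : (1 + g) ^+ 3 <= G.
  have gA : g <= pi * `|a1| by rewrite ler_pM2l//; apply: le_trans al1 _; exact: ler_norm.
  have g1 : 0 <= 1 + g by apply: addr_ge0 => //; exact: ltW.
  have gA1 : 1 + g <= 1 + pi * `|a1| by rewrite lerD2l.
  by rewrite /G lerXn2r ?nnegrE//; exact: le_trans gA1.
have kaE : 2 * eps * (1 + g) ^+ 3 <= ka.
  by apply: le_trans epsG; apply: ler_wpM2l => //; apply: mulr_ge0 => //; exact: ltW.
have gr : pi * a0 <= g <= pi * a1 by rewrite !ler_pM2l// al0.
have e2 : 2 * eps <= 1 by move: eps4; clear; lra.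
have [psi [Sp p0 low]] := energy_lower (erefl la) g0 (ltW eps0) e2 kaE (sym g gr).
pose dl (q : I) : R * R := coord (p (vec (pos q))).
have de q : sqn (dl q) <= eps ^+ 2.
  have h : enorm (p (vec (pos q))) <= eps.
    rewrite -lee_fin; apply: le_trans hp; apply: ereal_sup_ubound.
    by exists (vec (pos q)) => //; rewrite A2E; exists q.
  have n0 := ltW eps0.
  by rewrite -nrm_sqr lerXn2r ?nnegrE ?nrm_ge0// /dl -enorm_coord.
have -> : perturb p = [set site dl q | q in [set: I]].
  rewrite /perturb A2E; apply/seteqP; split=> x /=.
    by move=> [_ [q _ <-] <-]; exists q => //; rewrite /site -vecD coordK.
  by move=> [q _ <-]; exists (vec (pos q)); [exists q|rewrite /site -vecD coordK].
rewrite (energyE (ltW eps0) eps4 de (erefl g) (erefl la)).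
apply/lee_addgt0Pr => eta eta0.
have [r1 hr] := window_defect Sp p0 (ltW eps0) eta0.
(* beyond [eps] the origin is in the window, so the quotient is not [0 / 0] *)
rewrite -leeBlDr//; rewrite -EFinB.
apply: (@limf_einf_ge R _ _ (Num.max r1 eps)) => r; rewrite gt_max => /andP[rr1 reps].
rewrite /window_energy; set F := window _ _ _.
have uF : uniq F := window_uniq _ _ _.
have mF q : (q \in F) = (nrm (vadd (pos q) (dl q)) < r) by exact: mem_window (ltW eps0) de r q.
have D := hr r F dl (ltW rr1) uF de mF.
have L := low F dl uF de.
have F0 : (0 < size F)%N.
  suff : (0, 0) \in F by case: (F).
  rewrite mF; apply: le_lt_trans reps.
  have [+ _] := nrm_bounds (pos (0, 0)) (ltW eps0) (de (0, 0)).
  by rewrite {2}/nrm /sqn /pos /= !mulr0 expr0n addr0 sqrtr0 add0r.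
have Fr : 0 < (size F)%:R :> R by rewrite ltr0n.
rewrite ler_pdivlMr//; move: D L; clear; lra.
Qed.

Lemma compact_pos_bounds (K : set R) : compact K -> K `<=` [set alpha | 0 < alpha] ->
  exists a0 a1 : R, 0 < a0 /\ forall x, K x -> a0 <= x <= a1.
Proof.
move=> cK Kp; have [->|/set0P [x0 Kx0]] := eqVneq K set0; first by exists 1, 1; split.
have K0 : K !=set0 by exists x0.
have cid : {within K, continuous (@id R)} by apply: continuous_subspaceT => x; exact: cvg_id.
have [a Ka ha] := compact_EVT_min K0 cK cid.
have [b Kb hb] := compact_EVT_max K0 cK cid.
exists a, b; split; first by apply: Kp; rewrite -inE.
by move=> x Kx; rewrite ha ?hb ?inE.
Qed.

End Main.

Theorem theorem1 (R : realType) :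
  (forall alpha : R, 0 < alpha ->
     exists2 eps : R, 0 < eps &
       forall p : 'rV[R]_2 -> 'rV[R]_2,
         (pert_norm p <= eps%:E)%E ->
         (energy (Phi alpha) (A2 R) <= energy (Phi alpha) (perturb p))%E)
  /\
  (forall K : set R, compact K -> K `<=` [set alpha | 0 < alpha] ->
     exists2 eps : R, 0 < eps &
       forall alpha : R, K alpha ->
       forall p : 'rV[R]_2 -> 'rV[R]_2,
         (pert_norm p <= eps%:E)%E ->
         (energy (Phi alpha) (A2 R) <= energy (Phi alpha) (perturb p))%E).
Proof.
split=> [alpha alpha0|K cK Kpos].
  have [eps eps0 H] := uniform_threshold alpha alpha0.
  by exists eps => // p; apply: H; rewrite lexx.
have [a0 [a1 [a00 Ka]]] := compact_pos_bounds cK Kpos.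
have [eps eps0 H] := uniform_threshold a1 a00.
by exists eps => // alpha /Ka; exact: H.
Qed.
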